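(* Let $X=X_1\times X_2$ be a product of two proper Hadamard spaces with the standard product metric and let $G\subset Is(X_1)\times Is(X_2)$ be a group acting properly on $X$. Assume that $G$ contains two elements $g=(g_1,g_2)$ and $h=(h_1,h_2)$ such that, for each $i\in\{1,2\}$, $g_i$ and $h_i$ are independent rank one isometries of $X_i$, and that the action satisfies the regular growth condition, i.e. $\delta_\theta\ge 0$ for every $\theta\in[0,\pi/2]$. Then the growth rate $\delta_\theta$ of $G$ with slope $\theta$ is a continuous function of $\theta\in[0,\pi/2]$.
   Context: A Hadamard space is a complete simply connected metric space of non-positive Alexandrov curvature (a complete CAT(0) space); it is proper if all balls of finite radius are compact. For $(X_1,d_1),(X_2,d_2)$ proper Hadamard spaces, $X=X_1\times X_2$ carries the metric $d=\sqrt{d_1^2+d_2^2}$; $Is(X_i)$ is the isometry group of $X_i$; $o=(o_1,o_2)\in X$ is a fixed base point. A group $G\subset Is(X_1)\times Is(X_2)$ acts properly on $X$ if $\{g\in G: d(x,gx)\le r\}$ is finite for all $x\in X$, $r>0$. An isometry of a Hadamard space is rank one if it acts as a translation on a geodesic axis which does not bound a flat half plane; it then fixes the two endpoints of its axis in the geometric boundary. Two rank one isometries are independent if their sets of fixed boundary endpoints are disjoint. For $g=(g_1,g_2)\in G$ with $go\ne o$ let $\theta(g)=\arctan\frac{d_2(o_2,g_2o_2)}{d_1(o_1,g_1o_1)}\in[0,\pi/2]$ (with value $\pi/2$ if the denominator is $0$). For $\theta\in[0,\pi/2]$, $\epsilon>0$, integer $n\ge1$, put $A_{\epsilon,\theta}(o,n)=\{g\in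 G: go\neq o,\ n-1\le d(o,go)<n,\ |\theta(g)-\theta|\le\epsilon\}$, $\delta_{\epsilon,\theta}=\limsup_{n\to\infty}\frac{\log|A_{\epsilon,\theta}(o,n)|}{n}$ (with $\log 0=-\infty$), and $\delta_\theta=\liminf_{\epsilon\to0}\delta_{\epsilon,\theta}\in[-\infty,\infty)$. The number $\delta_\theta$ is the growth rate of $G$ with slope $\theta$. *)

(* Defs.v *)
From HB Require Import structures.
From mathcomp Require Import all_boot all_order all_algebra finmap.
From mathcomp Require Import all_classical all_reals all_analysis.
Set Implicit Arguments.
Unset Strict Implicit.
Unset Printing Implicit Defensive.
Import Order.TTheory GRing.Theory Num.Theory.
Import numFieldNormedType.Exports.
Local Open Scope classical_set_scope.
Local Open Scope ring_scope.

(* The balls of the library's product structure are those of the maximum of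
   the two distances, hence the two explicit Euclidean distances below. *)
Definition edist (R : realType) (u v : R * R) : R :=
  Num.sqrt ((u.1 - v.1) ^+ 2 + (u.2 - v.2) ^+ 2).

Definition prod_dist (R : realType) (X1 X2 : metricType R)
    (x y : X1 * X2) : R :=
  Num.sqrt (mdist x.1 y.1 ^+ 2 + mdist x.2 y.2 ^+ 2).

Section Hadamard.
Context {R : realType} (X : metricType R).
Implicit Types (x y z p q : X) (c r : R -> X) (f : X -> X).

(* A path is a total function, of which only the values on [D] matter. *)
Definition isometric_on (D : set R) c : Prop :=
  forall s t, D s -> D t -> mdist (c s) (c t) = `|s - t|.

Definition geodesic_segment x y (S : set X) : Prop :=
  exists c, [/\ c 0 = x, c (mdist x y) = y,
    isometric_on [set t | 0 <= t <= mdist x y] c &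
    S = c @` [set t | 0 <= t <= mdist x y]].

Definition geodesic_space : Prop :=
  forall x y, exists S, geodesic_segment x y S.

(* [p'] is the point of the Euclidean segment [x', y'] corresponding to the
   point [p] of a geodesic segment from [x] to [y]. *)
Definition comparison_point x y (x' y' : R * R) p (p' : R * R) : Prop :=
  edist x' p' = mdist x p /\ edist p' y' = mdist p y.

(* Two sides of a triangle share a vertex, called [x] here; as [x], [y], [z]
   are arbitrary, this covers all pairs of distinct sides.  For two points of
   the same side the comparison inequality is an equality. *)
Definition triangle_comparison : Prop :=
  forall x y z (Sxy Syz Szx : set X),
  geodesic_segment x y Sxy -> geodesic_segment y z Syz ->
  geodesic_segment z x Szx ->
  forall x' y' z' : R * R,
  edist x' y' = mdist x y -> edist y' z' = mdist y z ->
  edist z' x' = mdist z x ->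
  forall p q (p' q' : R * R), Sxy p -> Szx q ->
  comparison_point x y x' y' p p' -> comparison_point z x z' x' q q' ->
  mdist p q <= edist p' q'.

Definition CAT0 : Prop := geodesic_space /\ triangle_comparison.

Definition complete_space : Prop :=
  forall F : set_system X, ProperFilter F -> cauchy F -> exists x : X, F --> x.

Definition hadamard : Prop := complete_space /\ CAT0.

Definition proper_space : Prop :=
  forall x (e : R), compact [set y | mdist x y <= e].

Definition isometry f : Prop :=
  (forall x y, mdist (f x) (f y) = mdist x y) /\ (forall y, exists x, f x = y).

Definition geodesic_line c : Prop := isometric_on setT c.

Definition geodesic_ray r : Prop := isometric_on [set t | 0 <= t] r.

Definition asymptotic r r' : Prop :=
  exists K : R, forall t, 0 <= t -> mdist (r t) (r' t) <= K.

(* Points of the geometric boundary are classes of asymptotic rays. *)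
Definition boundary_point r : set (R -> X) :=
  [set r' | geodesic_ray r' /\ asymptotic r r'].

Definition bounds_flat_half_plane c : Prop :=
  exists F : R * R -> X, (forall t, F (t, 0) = c t) /\
    forall u v, 0 <= u.2 -> 0 <= v.2 -> mdist (F u) (F v) = edist u v.

Definition rank_one_axis f c : Prop :=
  [/\ geodesic_line c,
      exists l : R, 0 < l /\ forall t, f (c t) = c (t + l) &
      ~ bounds_flat_half_plane c].

Definition rank_one f : Prop := isometry f /\ exists c, rank_one_axis f c.

Definition fixed_endpoints f : set (set (R -> X)) :=
  [set xi | exists c, rank_one_axis f c /\
     (xi = boundary_point c \/ xi = boundary_point (fun t => c (- t)))].

Definition independent_rank_one f f' : Prop :=
  [/\ rank_one f, rank_one f' &
      fixed_endpoints f `&` fixed_endpoints f' = set0].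

End Hadamard.

Section Growth.
Context {R : realType} {X1 X2 : metricType R}.
Implicit Types (G : set ((X1 -> X1) * (X2 -> X2))) (o x : X1 * X2).
Implicit Types (g h : (X1 -> X1) * (X2 -> X2)).

Definition pact g x : X1 * X2 := (g.1 x.1, g.2 x.2).

Definition isometry_group G : Prop :=
  [/\ forall g, G g -> isometry g.1 /\ isometry g.2,
      G (id, id),
      forall g h, G g -> G h -> G (g.1 \o h.1, g.2 \o h.2) &
      forall g, G g -> exists h, [/\ G h, cancel g.1 h.1, cancel h.1 g.1,
                                    cancel g.2 h.2 & cancel h.2 g.2]].

Definition acts_properly G : Prop :=
  forall x (e : R), 0 < e ->
    finite_set [set g | G g /\ prod_dist x (pact g x) <= e].

Definition slope o g : R :=
  let d1 := mdist o.1 (g.1 o.1) in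
  let d2 := mdist o.2 (g.2 o.2) in
  if d1 == 0 then pi / 2 else atan (d2 / d1).

Definition annulus G o (eps theta : R) (n : nat) :
    set ((X1 -> X1) * (X2 -> X2)) :=
  [set g | [/\ G g, pact g o <> o,
               n%:R - 1 <= prod_dist o (pact g o) < n%:R &
               `|slope o g - theta| <= eps]].

(* The annulus is finite when [G] acts properly, so that [fset_set] does not
   take its default value; [lne 0 = -oo].  The value at [n = 0] does not affect
   the upper limit. *)
Definition growth_eps G o (eps theta : R) : \bar R :=
  limn_esup (fun n : nat =>
    (lne (#|` fset_set (annulus G o eps theta n)|%:R)%:E * (n%:R^-1)%:E)%E).

Definition growth_rate G o (theta : R) : \bar R :=
  limf_einf (fun eps : R => growth_eps G o eps theta) 0^'+.

End Growth.

(* Main.v *)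
Require Import Defs.
From mathcomp Require Import all_boot all_order all_algebra finmap.
From mathcomp Require Import all_classical all_reals all_analysis.
From mathcomp Require Import ring lra.
Import Order.TTheory GRing.Theory Num.Theory.
Import numFieldNormedType.Exports.

(**
The proof extends the growth rate to the homogeneous function on the quadrant
whose value at [r] times the unit vector of slope [t] is [r] times the growth
rate with slope [t].  This function is upper semicontinuous by definition, and
it is superadditive enough to be lower semicontinuous as well: if the unit
vector of slope [t] is [s1] times that of slope [t0] plus [s2] times that of slope
[p], with [s1, s2 >= 0], and if the growth rate with slope [p] is nonnegative,
then the growth rate with slope [t] is at least [s1] times the one with slope [t0]
([growth_lower]).  Applied with [p = 0] for [t < t0] and [p = pi / 2] for [t > t0],
where [s1] tends to [1] as [t] tends to [t0], this gives continuity.  The growth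
rate may be infinite; then the same inequalities apply to all its finite lower
bounds.

Superadditivity comes from an almost multiplicative structure of the group
([product_map]): there is a product [Phi g h = g a h], with [a] chosen from a fixed
finite set according to [g] and [h], such that the displacements of the base
point in the two factors are additive up to a constant, and such that the number
of pairs [(g, h)] with a given product is bounded as long as [g] has prescribed
displacements up to [1].  Words in many elements of slope close to [t0] and in one
element of slope close to [p] therefore give many elements in every intermediate
direction.

The elements [a] are found in each factor by a ping-pong argument.  The axis of a
rank one isometry of a proper Hadamard space is strongly contracting
([rank_one_contracting]): a geodesic between two points with distant projections
to the axis follows the axis in between ([contracting_visits]).  By the Behrstock
inequality ([behrstock]) a point can project far from the origin of at most one of
the axes of the conjugates of [g] by the powers of a large power of [h]; two points
in two factors thus exclude at most four conjugates, and a large power of a fifth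
one connects in both factors ([connecting_elements]).  Then the geodesic from the
base point [o] to its image under [g a h] passes near [g o] in each factor, which
yields both additivity and the bound on the multiplicity.

Contraction is proved by contradiction, in two steps that both produce a flat half
plane bounded by the axis.  Along an axis the distance to a point is a convex
function.  If its slope stays away from [1] and [-1] on long intervals, a limit
point at infinity has an affine Busemann function of slope in [(-1, 1)] along the
axis, and the rays to that point sweep out the half plane
([flat_half_plane_of_slope], [slope_after_projection]).  Hence geodesics from the
axis to a point with distant projection follow the axis for a long time.  If
nevertheless geodesics between points on the two sides avoid a point of the axis by
a large amount, a continuity argument yields isosceles triangles of a given large
height, which converge to a line parallel to the axis ([limit_parallel]).  Far
parallels again give a flat half plane ([parallel_bounded]), because from their
points the axis is seen with slope [0].
*)

Set Implicit Arguments.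
Unset Strict Implicit.
Unset Printing Implicit Defensive.
Local Open Scope classical_set_scope.
Local Open Scope ring_scope.

(** * Comparison with Euclidean triangles *)

Section Stewart.
Context {R : realType} {X : metricType R}.
Implicit Types (x y z p q : X) (m : X -> X -> R -> X) (c : R -> X).

(** [m x y l] stands for the point at fraction [l] of a geodesic from [x] to [y].
    Stewart's formula is an equality in the plane; as an inequality it is the
    only form of nonpositive curvature used below. *)
Definition stewart m : Prop := forall x y p l, 0 <= l <= 1 ->
  mdist p (m x y l) ^+ 2 <=
  (1 - l) * mdist p x ^+ 2 + l * mdist p y ^+ 2 - l * (1 - l) * mdist x y ^+ 2.

Lemma eudistE (u v : R * R) (r : R) : 0 <= r ->
  (u.1 - v.1) ^+ 2 + (u.2 - v.2) ^+ 2 = r ^+ 2 -> Defs.edist u v = r.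
Proof. by move=> r0 e; rewrite /Defs.edist e sqrtr_sqr ger0_norm. Qed.

Lemma eudist_sq (u v : R * R) :
  Defs.edist u v ^+ 2 = (u.1 - v.1) ^+ 2 + (u.2 - v.2) ^+ 2.
Proof. by rewrite /Defs.edist sqr_sqrtr // addr_ge0 // sqr_ge0. Qed.

Lemma eudist_ge0 (u v : R * R) : 0 <= Defs.edist u v.
Proof. by rewrite /Defs.edist sqrtr_ge0. Qed.

Lemma ler_sqr_nneg (a b : R) : 0 <= b -> a ^+ 2 <= b ^+ 2 -> a <= b.
Proof.
move=> b0 h; case: (lerP a b) => // ba; suff : b ^+ 2 < a ^+ 2 by lra.
by rewrite ltr_pXn2r // ?nnegrE //; lra.
Qed.

Lemma CAT0_stewart : CAT0 X -> exists m, stewart m.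
Proof.
move=> [geo tri].
have /choice[S SE] : forall xy : X * X, exists c, [/\ c 0 = xy.1,
    c (mdist xy.1 xy.2) = xy.2,
    isometric_on [set t | 0 <= t <= mdist xy.1 xy.2] c &
    geodesic_segment xy.1 xy.2 (c @` [set t | 0 <= t <= mdist xy.1 xy.2])].
  by move=> [x y]; have [_ [c [? ? ? _]]] := geo x y; exists c; split => //; exists c.
exists (fun x y l => S (x, y) (l * mdist x y)) => x y p l /andP[l0 l1].
have [c0 cL iso seg] := SE (x, y); rewrite /= in c0 cL iso seg.
set L := mdist x y in c0 cL iso seg *.
have L0 : 0 <= L by exact: mdist_ge0.
have [Lz|Ln0] := eqVneq L 0.
  have xy : x = y by apply: mdist_positivity.
  rewrite Lz mulr0 c0 -xy; lra.
have Lp : 0 < L by rewrite lt_neqAle eq_sym Ln0.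
have [d0 dL diso dseg] := SE (y, p); rewrite /= in d0 dL diso dseg.
have [_ _ _ eseg] := SE (p, x); rewrite /= in eseg.
set q := S (x, y) (l * L).
have hl : 0 <= l * L <= L by apply/andP; split; nra.
have Dxq : mdist x q = l * L.
  rewrite -c0 iso //= ?lexx ?L0 // sub0r normrN ger0_norm //; nra.
have Dqy : mdist q y = (1 - l) * L.
  rewrite -cL iso //= ?lexx ?L0 // ler0_norm; nra.
set a := mdist p y; set b := mdist p x.
have a0 : 0 <= a by exact: mdist_ge0.
have b0 : 0 <= b by exact: mdist_ge0.
have t1 : a <= b + L by exact: metric_triangle.
have t2 : b <= a + L by rewrite /L (metric_sym x y); exact: metric_triangle.
have t3 : L <= a + b.
  by rewrite addrC /b metric_sym; exact: metric_triangle.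
(* The comparison triangle has its vertices at [(L, 0)], [(u, v)], [(0, 0)]. *)
pose u := (b ^+ 2 + L ^+ 2 - a ^+ 2) / (2 * L).
have uE : u * (2 * L) = b ^+ 2 + L ^+ 2 - a ^+ 2.
  by rewrite /u divfK // mulf_neq0 // pnatr_eq0.
have v0 : 0 <= b ^+ 2 - u ^+ 2.
  have h1 : u <= b by rewrite -(ler_pM2r (_ : 0 < 2 * L)); nra.
  have h2 : - b <= u by rewrite -(ler_pM2r (_ : 0 < 2 * L)); nra.
  nra.
pose v := Num.sqrt (b ^+ 2 - u ^+ 2).
have vE : v ^+ 2 = b ^+ 2 - u ^+ 2 by rewrite sqr_sqrtr.
have := tri y p x _ _ _ dseg eseg seg (L, 0) (u, v) (0, 0) _ _ _ p q (u, v) (l * L, 0).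
move=> H.
have {}H : mdist p q <= Defs.edist (u, v) (l * L, 0).
  apply: H.
  - by rewrite metric_sym; apply: eudistE => //=; rewrite -/a; nra.
  - by apply: eudistE => //=; rewrite -/b; nra.
  - by apply: eudistE => //=; rewrite -/L; ring.
  - by exists (mdist y p) => //=; rewrite mdist_ge0 lexx.
  - by exists (l * L).
  - split; last by rewrite mdistxx; apply: eudistE => //=; ring.
    by rewrite metric_sym; apply: eudistE => //=; rewrite -/a; nra.
  - rewrite /comparison_point Dxq Dqy; split; apply: eudistE => //=; try nra; ring.
have : mdist p q ^+ 2 <= Defs.edist (u, v) (l * L, 0) ^+ 2.
  by rewrite ler_pXn2r // ?nnegrE ?eudist_ge0 ?mdist_ge0.
rewrite eudist_sq /=; nra.
Qed.

End Stewart.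

(** * Geodesics and projections to lines *)

Lemma lipschitz1_continuous (R : realType) (f : R -> R) (k : R) :
  (forall s t, `|f s - f t| <= k * `|s - t|) -> continuous f.
Proof.
move=> h x; apply/cvgrPdist_lt => e e0; near=> t.
apply: le_lt_trans (h _ _) _.
have k1 : 0 < `|k| + 1 by rewrite ltr_wpDl.
have : `|x - t| < e / (`|k| + 1).
  near: t; apply/nbhs_ballP; exists (e / (`|k| + 1)) => //=.
  by rewrite divr_gt0.
rewrite ltr_pdivlMr // => h2; apply: le_lt_trans h2.
rewrite mulrC; apply: ler_wpM2l => //; have := ler_norm k; lra.
Unshelve. all: by end_near. Qed.

Lemma sqr_normr (R : realType) (x : R) : `|x| ^+ 2 = x ^+ 2.
Proof. by rewrite real_normK ?num_real. Qed.

Section Geodesics.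
Context {R : realType} {X : metricType R} (m : X -> X -> R -> X).
Hypothesis hm : stewart m.
Implicit Types (x y z p q a b : X) (c : R -> X) (l k s t : R).

Lemma geo_dist_left x y l : 0 <= l <= 1 -> mdist x (m x y l) = l * mdist x y.
Proof.
move=> l01; have /andP[l0 l1] := l01.
have d0 := mdist_ge0 x y.
have h1 : mdist x (m x y l) <= l * mdist x y.
  apply: ler_sqr_nneg; first by nra.
  by have := hm x y x l01; rewrite mdistxx; nra.
have h2 : mdist y (m x y l) <= (1 - l) * mdist x y.
  apply: ler_sqr_nneg; first by nra.
  by have := hm x y y l01; rewrite mdistxx (metric_sym y x); nra.
have := metric_triangle x (m x y l) y; rewrite (metric_sym (m x y l)); lra.
Qed.

Lemma geo_dist_right x y l : 0 <= l <= 1 ->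
  mdist (m x y l) y = (1 - l) * mdist x y.
Proof.
move=> l01; have /andP[l0 l1] := l01.
have d0 := mdist_ge0 x y; have h1 := geo_dist_left x y l01.
have h2 : mdist y (m x y l) <= (1 - l) * mdist x y.
  apply: ler_sqr_nneg; first by nra.
  by have := hm x y y l01; rewrite mdistxx (metric_sym y x); nra.
have := metric_triangle x (m x y l) y; rewrite (metric_sym (m x y l)); lra.
Qed.

Lemma geo_uniq x y z l : 0 <= l <= 1 -> mdist x z <= l * mdist x y ->
  mdist z y <= (1 - l) * mdist x y -> z = m x y l.
Proof.
move=> l01 h1 h2; have /andP[l0 l1] := l01.
have := hm x y z l01; rewrite (metric_sym z x).
have := mdist_ge0 x z; have := mdist_ge0 z y; have := mdist_ge0 x y => *.
apply: mdist_positivity; apply/eqP.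
rewrite -sqrf_eq0 eq_le sqr_ge0 andbT.
apply: le_trans (hm x y z l01) _; rewrite (metric_sym z x).
have h3 : mdist x z ^+ 2 <= (l * mdist x y) ^+ 2.
  by rewrite ler_pXn2r ?nnegrE // mulr_ge0.
have h4 : mdist z y ^+ 2 <= ((1 - l) * mdist x y) ^+ 2.
  by rewrite ler_pXn2r ?nnegrE // mulr_ge0 //; lra.
have : (1 - l) * mdist x z ^+ 2 <= (1 - l) * (l * mdist x y) ^+ 2.
  by apply: ler_wpM2l => //; lra.
have : l * mdist z y ^+ 2 <= l * ((1 - l) * mdist x y) ^+ 2.
  exact: ler_wpM2l.
set D := mdist x y; rewrite !exprMn.
have -> : l * (1 - l) * D ^+ 2 =
  (1 - l) * (l ^+ 2 * D ^+ 2) + l * ((1 - l) ^+ 2 * D ^+ 2) by ring.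
lra.
Qed.

Lemma geo0 x y : m x y 0 = x.
Proof.
apply/esym/geo_uniq; rewrite ?lexx ?ler01 // ?mdistxx ?mul0r // subr0 mul1r.
exact: lexx.
Qed.

Lemma geo1 x y : m x y 1 = y.
Proof.
by apply/esym/geo_uniq; rewrite ?lexx ?ler01 // ?mdistxx ?mul1r // subrr mul0r.
Qed.

Lemma geo_sym x y l : 0 <= l <= 1 -> m x y l = m y x (1 - l).
Proof.
move=> l01; apply: geo_uniq; first by move/andP: l01 => [? ?]; apply/andP; lra.
  by rewrite metric_sym geo_dist_right // metric_sym.
by rewrite metric_sym geo_dist_left // metric_sym; lra.
Qed.

Lemma geo_dist x y l k : 0 <= l <= 1 -> 0 <= k <= 1 ->
  mdist (m x y l) (m x y k) = `|l - k| * mdist x y.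
Proof.
move=> l01 k01; have d0 := mdist_ge0 x y.
apply/eqP; rewrite eq_le; apply/andP; split.
  apply: ler_sqr_nneg; first by rewrite mulr_ge0.
  apply: le_trans (hm _ _ _ k01) _.
  rewrite (metric_sym _ x) geo_dist_left // geo_dist_right // !exprMn sqr_normr.
  by rewrite le_eqVlt; apply/orP; left; apply/eqP; ring.
have := metric_triangle x (m x y l) (m x y k).
have := metric_triangle x (m x y k) (m x y l).
rewrite !geo_dist_left // (metric_sym (m x y k)).
by case: (ger0P (l - k)) => _; nra.
Qed.

(** Stewart's inequality, applied twice along the two sides issued from [x]. *)
Lemma geo_fan x y z l : 0 <= l <= 1 ->
  mdist (m x y l) (m x z l) <= l * mdist y z.
Proof.
move=> l01; have /andP[l0 l1] := l01.
apply: ler_sqr_nneg; first by rewrite mulr_ge0 // mdist_ge0.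
apply: le_trans (hm x z _ l01) _.
rewrite (metric_sym _ x) geo_dist_left // (metric_sym _ z).
have := hm x y z l01; rewrite (metric_sym z x) (metric_sym z y).
move/(ler_wpM2l l0).
set A := mdist z _; set B := mdist x z; set C := mdist y z; set D := mdist x y.
nra.
Qed.

Lemma geo_convex x y x' y' l : 0 <= l <= 1 ->
  mdist (m x y l) (m x' y' l) <= (1 - l) * mdist x x' + l * mdist y y'.
Proof.
move=> l01; apply: le_trans (metric_triangle _ (m x y' l) _) _.
rewrite addrC; apply: lerD; last exact: geo_fan.
rewrite geo_sym // (geo_sym x') //; apply: geo_fan.
by move/andP: l01 => [? ?]; apply/andP; lra.
Qed.

Lemma dist_geo_convex x y p l : 0 <= l <= 1 ->
  mdist p (m x y l) <= (1 - l) * mdist p x + l * mdist p y.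
Proof.
move=> l01; have := geo_convex p p x y l01.
suff -> : m p p l = p by [].
by apply/esym/geo_uniq => //; rewrite !mdistxx mulr0.
Qed.

(** Stewart's inequality at the midpoint of one diagonal, seen from the two ends
    of the other one. *)
Lemma roundness a b p q : mdist a p ^+ 2 + mdist b q ^+ 2 <=
  mdist a b ^+ 2 + mdist b p ^+ 2 + mdist p q ^+ 2 + mdist q a ^+ 2.
Proof.
have h : 0 <= (2^-1 : R) <= 1 by apply/andP; lra.
set c := m a p 2^-1.
have hb := hm a p b h; have hq := hm a p q h.
have t : mdist b q <= mdist b c + mdist q c.
  by rewrite (metric_sym q); exact: metric_triangle.
rewrite -/c (metric_sym b a) in hb; rewrite -/c (metric_sym q p) in hq.
have := mdist_ge0 b q; have := mdist_ge0 b c; have := mdist_ge0 q c => q0 b0 bq0.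
have t2 : mdist b q ^+ 2 <= (mdist b c + mdist q c) ^+ 2.
  by rewrite ler_pXn2r ?nnegrE // addr_ge0.
have := sqr_ge0 (mdist b c - mdist q c); rewrite -/c in hb hq.
nra.
Qed.

Section Line.
Variable c : R -> X.
Hypothesis hc : geodesic_line c.

Lemma line_dist s t : mdist (c s) (c t) = `|s - t|.
Proof. exact: hc. Qed.

Lemma line_geo s t l : 0 <= l <= 1 -> c ((1 - l) * s + l * t) = m (c s) (c t) l.
Proof.
move=> l01; have /andP[l0 l1] := l01; apply: geo_uniq => //; rewrite !line_dist.
  have -> : s - ((1 - l) * s + l * t) = l * (s - t) by ring.
  by rewrite normrM ger0_norm.
have -> : (1 - l) * s + l * t - t = (1 - l) * (s - t) by ring.
by rewrite normrM ger0_norm //; lra.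
Qed.

Lemma line_stewart p s t l : 0 <= l <= 1 ->
  mdist p (c ((1 - l) * s + l * t)) ^+ 2 <=
  (1 - l) * mdist p (c s) ^+ 2 + l * mdist p (c t) ^+ 2
  - l * (1 - l) * (s - t) ^+ 2.
Proof.
by move=> l01; rewrite line_geo //; have := hm (c s) (c t) p l01;
  rewrite line_dist sqr_normr.
Qed.

Lemma line_midpoint p s t : 2 * mdist p (c t) ^+ 2 + 2 * s ^+ 2 <=
  mdist p (c (t - s)) ^+ 2 + mdist p (c (t + s)) ^+ 2.
Proof.
have h : 0 <= (2^-1 : R) <= 1 by apply/andP; lra.
have := line_stewart p (t - s) (t + s) h.
have -> : (1 - 2^-1) * (t - s) + 2^-1 * (t + s) = t by field.
nra.
Qed.

Lemma dist_line_convex p s t l : 0 <= l <= 1 ->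
  mdist p (c ((1 - l) * s + l * t)) <=
  (1 - l) * mdist p (c s) + l * mdist p (c t).
Proof. by move=> l01; rewrite line_geo //; exact: dist_geo_convex. Qed.

Lemma dist_line_lip p s t : `|mdist p (c s) - mdist p (c t)| <= `|s - t|.
Proof.
have := metric_triangle p (c s) (c t); have := metric_triangle p (c t) (c s).
rewrite !line_dist (distrC t) ler_norml => h1 h2; apply/andP; lra.
Qed.

End Line.

(** [c s] is a nearest-point projection of [x] to the line [c]; it is recorded by
    its parameter [s], since lines are given with a parametrization. *)
Definition near_param c x s : Prop := forall t, mdist x (c s) <= mdist x (c t).

Lemma near_param_exists c x : geodesic_line c -> exists s, near_param c x s.
Proof.
move=> hc; set D := mdist x (c 0); have D0 : 0 <= D := mdist_ge0 _ _.
have cont : continuous (fun s => mdist x (c s)).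
  apply: (@lipschitz1_continuous _ _ 1) => s t.
  by rewrite mul1r; exact: dist_line_lip.
have [||s sI smin] := @EVT_min R (fun s => mdist x (c s)) (- (2 * D)) (2 * D).
- lra.
- exact: continuous_subspaceT.
exists s => t; case: (boolP (t \in `[- (2 * D), 2 * D])) => [/smin//|tI].
have : mdist x (c s) <= D by apply: smin; rewrite in_itv /=; apply/andP; lra.
have : 2 * D < `|t|.
  move: tI; rewrite in_itv /= negb_and -!ltNge => /orP[h|h].
    by rewrite ltr0_norm; lra.
  by rewrite gtr0_norm; lra.
have := metric_triangle (c 0) x (c t); rewrite line_dist // sub0r normrN.
by rewrite (metric_sym (c 0)) -/D; lra.
Qed.

(** The angle at the projection is at least a right angle. *)
Lemma near_param_sq c x s t : geodesic_line c -> near_param c x s ->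
  mdist x (c s) ^+ 2 + (t - s) ^+ 2 <= mdist x (c t) ^+ 2.
Proof.
move=> hc hs; apply/ler_addgt0Pl => e e0.
(* A point so close to [c s] that the error [l * (t - s) ^+ 2] is below [e]. *)
pose l := e / (e + (t - s) ^+ 2).
have sq0 := sqr_ge0 (t - s).
have l0 : 0 < l by rewrite divr_gt0 //; lra.
have l01 : 0 <= l <= 1 by rewrite ltW //= ler_pdivrMr //; lra.
have lE : l * (e + (t - s) ^+ 2) = e by rewrite divfK //; apply/eqP; lra.
have := line_stewart hc x s t l01.
have : mdist x (c s) ^+ 2 <= mdist x (c ((1 - l) * s + l * t)) ^+ 2.
  by rewrite ler_pXn2r // ?nnegrE ?mdist_ge0.
have -> : (s - t) ^+ 2 = (t - s) ^+ 2 by ring.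
move=> h1 h2.
have /andP[_ l1] := l01.
have h3 : l * (mdist x (c s) ^+ 2 + (1 - l) * (t - s) ^+ 2) <=
          l * mdist x (c t) ^+ 2 by nra.
rewrite ler_pM2l // in h3; nra.
Qed.

(** Roundness of the quadrilateral formed by two points and their projections. *)
Lemma near_param_lip c x y s t : geodesic_line c ->
  near_param c x s -> near_param c y t -> `|s - t| <= mdist x y.
Proof.
move=> hc hs ht; apply: ler_sqr_nneg; first exact: mdist_ge0.
rewrite sqr_normr.
have h1 := near_param_sq t hc hs; have h2 := near_param_sq s hc ht.
have := roundness x y (c t) (c s); rewrite line_dist // sqr_normr.
rewrite (metric_sym (c s)); nra.
Qed.

Lemma near_param_line c s : geodesic_line c -> near_param c (c s) s.
Proof. by move=> hc t; rewrite mdistxx mdist_ge0. Qed.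

Lemma near_param_uniq c x s t : geodesic_line c ->
  near_param c x s -> near_param c x t -> s = t.
Proof.
move=> hc hs ht; have := near_param_lip hc hs ht.
by rewrite mdistxx normr_le0 subr_eq0 => /eqP.
Qed.

End Geodesics.

(** * Limits along ultrafilters *)

(** Along an ultrafilter bounded sequences of a proper space converge, so that
    limits of geodesics can be taken pointwise, without equicontinuity. *)
Lemma ultra_cvg_compact (T : topologicalType) (I : Type) (U : set_system I)
    (UU : UltraFilter U) (K : set T) (x : I -> T) :
  compact K -> (\forall i \near U, K (x i)) -> exists2 p, K p & x @ U --> p.
Proof.
move=> cK Kx; have FF : ProperFilter (x @ U) by exact: fmap_proper_filter.
have [p [Kp clp]] := cK _ FF Kx.
exists p => // V Vp; have [//|UC] := in_ultra_setVsetC (x @^-1` V) UU.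
have [y [/= nVy /nbhs_singleton Vy]] := clp (~` V) _ UC (nbhs_interior Vp).
by case: nVy.
Qed.

Lemma ultra_nat : exists U : set_system nat, UltraFilter U /\ \oo `<=` U.
Proof. exact: ultraFilterLemma. Qed.

Section Ultralimits.
Context {R : realType} {X : metricType R} (U : set_system nat).
Hypothesis UU : UltraFilter U.
Let UP : ProperFilter U := ultra_proper.
Existing Instance UP.

Lemma proper_ultra_cvg (pX : proper_space X) (o : X) (K : R) (x : nat -> X) :
  (\forall n \near U, mdist o (x n) <= K) -> exists p : X, x @ U --> p.
Proof.
by move=> h; have [p _ xp] := ultra_cvg_compact UU (pX o K) h; exists p.
Qed.

Lemma real_ultra_cvg (a b : R) (x : nat -> R) :
  (\forall n \near U, a <= x n <= b) -> exists2 p : R, a <= p <= b & x @ U --> p.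
Proof.
move=> h; have [||p pab xp] := @ultra_cvg_compact _ _ U UU `[a, b] x.
- exact: segment_compact.
- by apply: filterS h => n h; rewrite /= in_itv.
by exists p => //; move: pab; rewrite /= in_itv.
Qed.

Lemma cvg_mdist (x y : nat -> X) (p q : X) : x @ U --> p -> y @ U --> q ->
  (fun n => mdist (x n) (y n)) @ U --> mdist p q.
Proof.
move=> xp yq; apply/cvgrPdist_le => e e0.
have e2 : 0 < e / 2 by lra.
have h1 := metricType_numDomainType.cvgr_dist_lt xp e2.
have h2 := metricType_numDomainType.cvgr_dist_lt yq e2.
near=> n.
have h1' : mdist p (x n) < e / 2 by near: n; exact: h1.
have h2' : mdist q (y n) < e / 2 by near: n; exact: h2.
have := metric_triangle p (x n) q; have := metric_triangle (x n) (y n) q.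
have := metric_triangle (x n) p (y n); have := metric_triangle p q (y n).
rewrite (metric_sym (y n) q) (metric_sym (x n) p) => *.
by rewrite ler_norml; apply/andP; lra.
Unshelve. all: by end_near. Qed.

Lemma cvg_mdistl (x : nat -> X) (p q : X) : x @ U --> p ->
  (fun n => mdist (x n) q) @ U --> mdist p q.
Proof. by move=> xp; apply: (cvg_mdist xp); exact: cvg_cst. Qed.

Lemma cvg_eq_limit (f : nat -> R) (a b : R) : f @ U --> a ->
  (\forall n \near U, f n = b) -> a = b.
Proof.
move=> fa fb; apply: (cvg_unique (@Rhausdorff R) fa).
exact: cvg_near_cst.
Qed.

Lemma cvg_inv_infty (f : nat -> R) :
  (forall A, \forall n \near U, A <= f n) -> (fun n => (f n)^-1) @ U --> (0 : R).
Proof.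
move=> h; apply/cvgrPdist_le => e e0; near=> n.
have h1 : e^-1 <= f n by near: n; exact: h.
have e1 : 0 < e^-1 by rewrite invr_gt0.
have f0 : 0 < f n by lra.
rewrite sub0r normrN ger0_norm ?invr_ge0 ?(ltW f0) //.
by rewrite -(invrK e) lef_pV2.
Unshelve. all: by end_near. Qed.

Variable m : X -> X -> R -> X.
Hypothesis hm : stewart m.

(** The geodesic from [a] towards [x n], followed for a length [s], converges to a
    point of the ray from [a] to the point at infinity defined by [x].  In the
    limit the comparison inequality becomes a law of cosines in which the
    difference [e] of the values of the Busemann function at [b] and at [a]
    replaces the angle. *)
Lemma busemann_comparison (x y : nat -> X) (a r b : X) (s e : R) :
  0 <= s -> (forall A, \forall n \near U, A <= mdist a (x n)) ->
  (fun n => m a (x n) (s / mdist a (x n))) @ U --> r ->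
  y @ U --> b ->
  (fun n => mdist (y n) (x n) - mdist a (x n)) @ U --> e ->
  mdist b r ^+ 2 <= mdist b a ^+ 2 + s ^+ 2 + 2 * s * e.
Proof.
move=> s0 far xr yb ye.
pose L n := mdist a (x n); pose lam n := s / L n.
pose E n := mdist (y n) (x n) - L n.
have iL : (fun n => (L n)^-1) @ U --> (0 : R) by exact: cvg_inv_infty.
have clam : lam @ U --> (0 : R).
  by rewrite -(mulr0 s); apply: cvgMr; exact: iL.
have cya : (fun n => mdist (y n) a) @ U --> mdist b a by exact: cvg_mdistl.
have clhs : (fun n => mdist (y n) (m a (x n) (lam n)) *
    mdist (y n) (m a (x n) (lam n))) @ U --> mdist b r * mdist b r.
  by apply: cvgM; apply: cvg_mdist.
have crhs : (fun n => (1 - lam n) * (mdist (y n) a * mdist (y n) a) + s ^+ 2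
    + 2 * s * E n + lam n * (E n * E n)) @ U -->
    (1 - 0) * (mdist b a * mdist b a) + s ^+ 2 + 2 * s * e + 0 * (e * e).
  apply: cvgD; last by apply: cvgM => //; exact: cvgM.
  apply: cvgD; last by apply: cvgMr.
  apply: cvgD; last exact: cvg_cst.
  apply: cvgM; last exact: cvgM.
  by apply: cvgB => //; exact: cvg_cst.
have := ler_cvg_to clhs crhs; rewrite mul0r addr0 subr0 mul1r -!expr2; apply.
near=> n.
have Ls : s + 1 <= L n by near: n; exact: far.
have L0 : 0 < L n by lra.
have lamL : lam n * L n = s by rewrite divfK //; apply/eqP; lra.
have l01 : 0 <= lam n <= 1.
  by rewrite divr_ge0 ?(ltW L0) //= ler_pdivrMr // mul1r; lra.
have := hm a (x n) (y n) l01; rewrite -/(L n) -!expr2 => /le_trans; apply.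
have -> : mdist (y n) (x n) = L n + E n by rewrite /E; ring.
have -> : s ^+ 2 = (lam n * L n) ^+ 2 by rewrite lamL.
have -> : 2 * s * E n = 2 * (lam n * L n) * E n by rewrite lamL.
by rewrite le_eqVlt; apply/orP; left; apply/eqP; ring.
Unshelve. all: by end_near. Qed.

End Ultralimits.

(** * Flat half planes swept out by rays *)

Section FlatHalfPlane.
Context {R : realType} {X : metricType R} (m : X -> X -> R -> X).
Hypothesis hm : stewart m.
Variable c : R -> X.
Hypothesis hc : geodesic_line c.

(** The Euclidean line through two points of the half plane meets the boundary,
    where distances are exact, so by the triangle inequality the distance of the
    two points cannot decrease.  If the line is parallel to the boundary, one of
    the points is moved a little. *)
Lemma isometric_half_plane (F : R * R -> X) :
  (forall u t, 0 <= u.2 -> mdist (F u) (c t) = Defs.edist u (t, 0)) ->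
  (forall u v, 0 <= u.2 -> 0 <= v.2 -> mdist (F u) (F v) <= Defs.edist u v) ->
  forall u v, 0 <= u.2 -> 0 <= v.2 -> mdist (F u) (F v) = Defs.edist u v.
Proof.
move=> exact_c short.
have lt_case u v : 0 <= v.2 -> v.2 < u.2 -> Defs.edist u v <= mdist (F u) (F v).
  move=> v0 vu; pose rho := v.2 / (u.2 - v.2).
  have rhoE : rho * (u.2 - v.2) = v.2 by rewrite divfK //; apply/eqP; lra.
  have rho0 : 0 <= rho by rewrite divr_ge0 //; lra.
  (* The line through [u] and [v] meets the boundary at [(t, 0)]. *)
  pose t := v.1 - rho * (u.1 - v.1).
  have e0 := eudist_ge0 u v; have e2 := eudist_sq u v.
  have eu : Defs.edist u (t, 0) = (1 + rho) * Defs.edist u v.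
    apply: eudistE => /=; first by rewrite mulr_ge0 //; lra.
    rewrite exprMn e2 mulrDr -!exprMn; congr (_ ^+ 2 + _ ^+ 2); rewrite /t; lra.
  have ev : Defs.edist v (t, 0) = rho * Defs.edist u v.
    apply: eudistE => /=; first by rewrite mulr_ge0.
    rewrite exprMn e2 mulrDr -!exprMn; congr (_ ^+ 2 + _ ^+ 2); rewrite /t; lra.
  have := metric_triangle (F u) (F v) (c t).
  rewrite !exact_c ?eu ?ev //; lra.
move=> u v u0 v0; apply/eqP; rewrite eq_le short //=.
have [uv|vu|uv] := ltgtP u.2 v.2.
- rewrite metric_sym; apply: le_trans (lt_case v u u0 uv).
  by rewrite /Defs.edist; apply: ler_wsqrtr; lra.
- exact: lt_case.
apply/ler_addgt0Pl => e egt0.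
pose w := (u.1, u.2 + e).
have := lt_case w v v0; rewrite /w /= => /(_ ltac:(lra)) h.
have hw : mdist (F w) (F u) <= e.
  apply: le_trans (short _ _ _ u0) _; first by rewrite /=; lra.
  by rewrite (@eudistE _ _ _ e) //=; [lra | ring].
have : Defs.edist u v <= Defs.edist w v.
  rewrite /Defs.edist /=; apply: ler_wsqrtr; rewrite uv; nra.
have := metric_triangle (F w) (F u) (F v); rewrite /w; rewrite /w in hw; lra.
Qed.

Hypothesis pX : proper_space X.
Variables (U : set_system nat) (UU : UltraFilter U).
Let UP : ProperFilter U := ultra_proper.
Existing Instance UP.

(** The rays from the points of [c] to the limit of [x] sweep out the half plane.
    Since the Busemann function is affine along [c], the law of cosines in the
    limit bounds the distances by the Euclidean ones, and the midpoint
    inequality along [c] turns this into an equality for the distances to [c]. *)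
Lemma flat_half_plane_of_slope (x : nat -> X) (k : R) : -1 < k < 1 ->
  (forall A, \forall n \near U, A <= mdist (c 0) (x n)) ->
  (forall t, (fun n => mdist (c t) (x n) - mdist (c 0) (x n)) @ U --> k * t) ->
  bounds_flat_half_plane c.
Proof.
move=> /andP[k1 k2] far0 slope0.
have far t A : \forall n \near U, A <= mdist (c t) (x n).
  apply: filterS (far0 (A + `|t|)) => n.
  have := metric_triangle (c 0) (c t) (x n); rewrite line_dist // sub0r normrN.
  lra.
have slope s t :
    (fun n => mdist (c s) (x n) - mdist (c t) (x n)) @ U --> k * (s - t).
  rewrite mulrBr; apply: (cvg_trans _ (cvgB (slope0 s) (slope0 t)));
    apply: near_eq_cvg; apply: nearW => n.
  by rewrite !fctE; ring.
pose y t s n := m (c t) (x n) (s / mdist (c t) (x n)).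
have yfrac t s : 0 <= s -> \forall n \near U,
    [/\ 0 <= s / mdist (c t) (x n) <= 1 &
        s / mdist (c t) (x n) * mdist (c t) (x n) = s].
  move=> s0; apply: filterS (far t (s + 1)) => n h.
  have L0 : 0 < mdist (c t) (x n) by lra.
  split; last by rewrite divfK //; apply/eqP; lra.
  by rewrite divr_ge0 ?(ltW L0) //= ler_pdivrMr // mul1r; lra.
have ydist t s : 0 <= s -> \forall n \near U, mdist (c t) (y t s n) = s.
  move=> s0; apply: filterS (yfrac t s s0) => n [l01 e].
  by rewrite /y geo_dist_left.
have /choice[r rE] : forall ts : R * R, exists p : X,
    0 <= ts.2 -> y ts.1 ts.2 @ U --> p.
  move=> [t s] /=; case: (lerP 0 s) => s0; last by exists (c 0).
  have [|p hp] := @proper_ultra_cvg _ _ U UU pX (c t) s (y t s); last by exists p.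
  by apply: filterS (ydist t s s0) => n ->.
have r_cvg t s : 0 <= s -> y t s @ U --> r (t, s) by exact: (rE (t, s)).
have r_dist t s : 0 <= s -> mdist (c t) (r (t, s)) = s.
  move=> s0; apply: (@cvg_eq_limit _ U UU (fun n => mdist (c t) (y t s n))).
    by apply: cvg_mdist (r_cvg _ _ s0) => //; exact: cvg_cst.
  exact: ydist.
have r_c_le t s t' : 0 <= s -> mdist (c t') (r (t, s)) ^+ 2 <=
    (t' - t) ^+ 2 + s ^+ 2 + 2 * s * (k * (t' - t)).
  move=> s0.
  have := @busemann_comparison _ _ U UU m hm x (fun=> c t') (c t) (r (t, s))
    (c t') s (k * (t' - t)) s0 (far t) (r_cvg t s s0).
  by rewrite line_dist // sqr_normr; apply; [exact: cvg_cst | exact: slope].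
have r_c t s t' : 0 <= s -> mdist (r (t, s)) (c t') ^+ 2 =
    (t' - t) ^+ 2 + s ^+ 2 + 2 * s * (k * (t' - t)).
  move=> s0; have h1 := r_c_le t s t' s0.
  have h2 := r_c_le t s (t - (t' - t)) s0.
  have := line_midpoint hm hc (r (t, s)) (t' - t) t.
  have -> : t + (t' - t) = t' by ring.
  rewrite (metric_sym _ (c t)) r_dist //.
  rewrite (metric_sym _ (c t')) (metric_sym _ (c (t - _))).
  by move=> h3; apply/eqP; rewrite eq_le h1 /=; lra.
have r_r t s t' s' : 0 <= s -> 0 <= s' -> mdist (r (t, s)) (r (t', s')) ^+ 2 <=
    (t' - t) ^+ 2 + s ^+ 2 + 2 * s * (k * (t' - t)) + s' ^+ 2
    + 2 * s' * (k * (t - t') - s).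
  move=> s0 s0'; rewrite -r_c //.
  apply: (@busemann_comparison _ _ U UU m hm x (y t s) (c t') (r (t', s'))
    (r (t, s)) s' (k * (t - t') - s) s0' (far t') (r_cvg t' s' s0')
    (r_cvg t s s0)).
  apply: (cvg_trans _ (cvgB (slope t t') (cvg_cst s (F := U)))); apply: near_eq_cvg.
  apply: filterS (yfrac t s s0) => n [l01 e] /=.
  by rewrite /y geo_dist_right // mulrBl e mul1r addrAC.
(* The ray from [c t] points in the direction [(- k, sg)]. *)
pose sg := Num.sqrt (1 - k ^+ 2).
have sg2 : sg ^+ 2 = 1 - k ^+ 2 by rewrite sqr_sqrtr //; nra.
have sg0 : 0 < sg by rewrite sqrtr_gt0; nra.
pose F (u : R * R) := r (u.1 + k * (u.2 / sg), u.2 / sg).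
have sgE (a : R) : a = a / sg * sg by rewrite divfK //; apply/eqP; lra.
have div0 (a : R) : 0 <= a -> 0 <= a / sg.
  by move=> a0; rewrite divr_ge0 // ltW.
exists F; split.
  move=> t; rewrite /F /= mul0r mulr0 addr0; apply/esym/mdist_positivity.
  exact: r_dist.
apply: isometric_half_plane.
  move=> u t u0; apply/esym/eudistE; first exact: mdist_ge0.
  rewrite /F r_c ?div0 //= subr0 {1}(sgE u.2) exprMn sg2; ring.
move=> u v u0 v0; apply: ler_sqr_nneg; first exact: eudist_ge0.
rewrite eudist_sq; apply: le_trans (r_r _ _ _ _ (div0 _ u0) (div0 _ v0)) _.
have -> : (u.2 - v.2) ^+ 2 = (u.2 / sg - v.2 / sg) ^+ 2 * (1 - k ^+ 2).
  by rewrite -sg2 -exprMn mulrBl -!sgE.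
by rewrite le_eqVlt; apply/orP; left; apply/eqP; ring.
Qed.

End FlatHalfPlane.

(** * Slopes of distance functions along a periodic line *)

Section ConvexReal.
Context {R : realType} (f : R -> R).
Hypothesis cf : forall s t l, 0 <= l <= 1 ->
  f ((1 - l) * s + l * t) <= (1 - l) * f s + l * f t.

Lemma convex_chord a b d : a <= b -> b <= d ->
  (d - a) * f b <= (d - b) * f a + (b - a) * f d.
Proof.
rewrite le_eqVlt => /orP[/eqP <- _|ab bd]; first by lra.
have da : 0 < d - a by lra.
pose l := (b - a) / (d - a).
have lE : l * (d - a) = b - a by rewrite divfK //; apply/eqP; lra.
have l01 : 0 <= l <= 1.
  by rewrite /l; apply/andP; split; [apply: divr_ge0 | rewrite ler_pdivrMr //]; lra.
have := cf a d l01.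
have -> : (1 - l) * a + l * d = b.
  have -> : (1 - l) * a + l * d = a + l * (d - a) by ring.
  by rewrite lE; ring.
move/(ler_wpM2l (ltW da)) => /le_trans; apply.
have -> : (d - a) * ((1 - l) * f a + l * f d) =
  ((d - a) - l * (d - a)) * f a + (l * (d - a)) * f d by ring.
rewrite lE; lra.
Qed.

Lemma convex_slope_le K a b t t' : a <= b -> b <= t -> t < t' ->
  f t' - f t <= K * (t' - t) -> f b - f a <= K * (b - a).
Proof.
move=> ab bt tt h.
have c1 := convex_chord bt (ltW tt).
have h1 : f t' - f b <= K * (t' - b).
  have p : 0 < t' - t by lra.
  rewrite -(ler_pM2l p); have : 0 <= t' - b by lra.
  by move/ler_wpM2l => /(_ _ _ h); lra.
have bt' : b <= t' by lra.
have c2 := convex_chord ab bt'.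
have p : 0 < t' - b by lra.
rewrite -(ler_pM2l p); have : 0 <= b - a by lra.
by move/ler_wpM2l => /(_ _ _ h1); lra.
Qed.

(** The slopes of a convex function are monotone, so that on [[a - h, a + h]] they
    vary by no more than the second difference allows. *)
Lemma convex_almost_affine a h t : 0 < h -> `|t| <= h ->
  `|f (a + t) - f a - (f (a + h) - f (a - h)) / (2 * h) * t| <=
  (f (a + h) + f (a - h) - 2 * f a) / 2.
Proof.
move=> h0; rewrite ler_norml => /andP[t1 t2].
pose k := (f (a + h) - f (a - h)) / (2 * h).
pose D := f (a + h) + f (a - h) - 2 * f a.
have kE : k * (2 * h) = f (a + h) - f (a - h).
  by rewrite divfK //; apply/eqP; lra.
have D0 : 0 <= D.
  have := @convex_chord (a - h) a (a + h); move=> /(_ ltac:(lra) ltac:(lra)).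
  have -> : (a + h - (a - h)) = h + h by ring.
  have -> : (a + h - a) = h by ring.
  have -> : (a - (a - h)) = h by ring.
  by rewrite /D => H; rewrite -(pmulr_rge0 _ h0); lra.
rewrite -/k -/D ler_norml; have [t0|t0] := lerP 0 t.
  have c1 := @convex_chord a (a + t) (a + h) ltac:(lra) ltac:(lra).
  have c2 := @convex_chord (a - h) a (a + t) ltac:(lra) ltac:(lra).
  have -> : f (a + t) = f a + k * t + (f (a + t) - f a - k * t) by ring.
  set E := f (a + t) - f a - k * t.
  have EE : f (a + t) = f a + k * t + E by rewrite /E; ring.
  have F1 : f (a + h) = f a + k * h + D / 2 by rewrite /D; lra.
  have F2 : f (a - h) = f a - k * h + D / 2 by rewrite /D; lra.
  rewrite EE F1 in c1; rewrite EE F2 in c2.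
  by apply/andP; split; rewrite -(ler_pM2l h0); nra.
have c1 := @convex_chord (a - h) (a + t) a ltac:(lra) ltac:(lra).
have c2 := @convex_chord (a + t) a (a + h) ltac:(lra) ltac:(lra).
set E := f (a + t) - f a - k * t.
have EE : f (a + t) = f a + k * t + E by rewrite /E; ring.
have F1 : f (a + h) = f a + k * h + D / 2 by rewrite /D; lra.
have F2 : f (a - h) = f a - k * h + D / 2 by rewrite /D; lra.
rewrite EE F2 in c1; rewrite EE F1 in c2.
by apply/andP; split; rewrite -(ler_pM2l h0); nra.
Qed.

End ConvexReal.

Section Periodic.
Context {R : realType} {X : metricType R} (m : X -> X -> R -> X).
Hypothesis hm : stewart m.
Hypothesis pX : proper_space X.

(** The isometries [psi] only have to move every point of the line to a bounded
    part of it; unlike a translation, this notion is invariant under reversal of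
    the line. *)
Definition periodic_line (c : R -> X) : Prop :=
  geodesic_line c /\ exists l : R, forall t0, exists psi : X -> X,
    (forall x y, mdist (psi x) (psi y) = mdist x y) /\
    exists t1, `|t1| <= l /\ forall t, psi (c (t0 + t)) = c (t1 + t).

(** By periodicity the intervals on which the distance to a far point is almost
    affine can be moved to a bounded part of the line; then the previous section
    applies to an ultralimit. *)
Lemma flat_half_plane_of_approx (c : R -> X) (e : R) : periodic_line c -> 0 < e ->
  (forall W : R, 0 < W -> exists x t0 k, [/\ `|k| <= 1 - e,
     W <= mdist x (c t0) & forall t, `|t| <= W ->
     `|mdist x (c (t0 + t)) - mdist x (c t0) - k * t| <= W^-1]) ->
  bounds_flat_half_plane c.
Proof.
move=> [hc [l per]] e0 approx.
have /choice[D hD] : forall n : nat, exists D : X * R * R,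
    [/\ `|D.2| <= 1 - e, `|D.1.2| <= l, n.+1%:R <= mdist D.1.1 (c D.1.2) &
    forall t, `|t| <= n.+1%:R ->
     `|mdist D.1.1 (c (D.1.2 + t)) - mdist D.1.1 (c D.1.2) - D.2 * t| <= n.+1%:R^-1].
  move=> n; have [|x [t0 [k [hk hx ha]]]] := approx n.+1%:R; first by [].
  have [psi [iso [t1 [ht1 psic]]]] := per t0.
  exists (psi x, t1, k) => /=.
  have e1 t : mdist (psi x) (c (t1 + t)) = mdist x (c (t0 + t)).
    by rewrite -psic iso.
  have e2 : mdist (psi x) (c t1) = mdist x (c t0).
    by have := e1 0; rewrite !addr0.
  by split => //; [rewrite e2 | move=> t ht; rewrite e1 e2; exact: ha].
pose x n := (D n).1.1; pose t1 n := (D n).1.2; pose k n := (D n).2.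
have [U [UU oU]] := ultra_nat.
have UP : ProperFilter U := ultra_proper.
have [k0 hk0 ck] : exists2 p : R, - (1 - e) <= p <= 1 - e & k @ U --> p.
  apply: real_ultra_cvg; apply: nearW => n; rewrite -ler_norml.
  by have [] := hD n.
have big A : \forall n \near U, A <= n.+1%:R :> R.
  by apply/oU; near=> n; rewrite -addn1 natrD; apply: (@le_trans _ _ n%:R);
   [near: n; exact: nbhs_infty_ger | rewrite lerDl].
have c_t1 n : mdist (c 0) (c (t1 n)) <= l.
  by rewrite line_dist // sub0r normrN; have [] := hD n.
apply: (flat_half_plane_of_slope hm hc pX UU (x := x) (k := k0)).
- by apply/andP; move/andP: hk0 => [? ?]; lra.
- move=> A; apply: filterS (big (A + l)) => n h.
  have [_ _ h1 _] := hD n; have := c_t1 n; rewrite -/(x n) -/(t1 n) in h1 *.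
  have := metric_triangle (x n) (c 0) (c (t1 n)).
  rewrite (metric_sym (x n) (c 0)); lra.
move=> t; pose err n := mdist (c t) (x n) - mdist (c 0) (x n) - k n * t.
have cerr : err @ U --> (0 : R).
  apply/cvgrPdist_le => d d0.
  have d20 : 0 < 2 / d by rewrite divr_gt0.
  apply: filterS2 (big (2 / d)) (big (`|t| + l)) => n n1 n2.
  have [_ hl _ ha] := hD n.
  rewrite -/(t1 n) in hl.
  have n3 : 0 <= `|t| by [].
  have tn : `|t - t1 n| <= n.+1%:R by apply: le_trans (ler_normB _ _) _; lra.
  have tn0 : `|0 - t1 n| <= n.+1%:R by rewrite sub0r normrN; lra.
  have := ha _ tn; have := ha _ tn0.
  rewrite -/(x n) -/(t1 n) -/(k n) !subrKC => a1 a2.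
  have : (n.+1%:R)^-1 <= d / 2.
    rewrite -(invrK (d / 2)) lef_pV2 ?posrE ?invr_gt0 ?divr_gt0 //.
    by rewrite invf_div.
  move: a1 a2; rewrite (sub0r (err n)) normrN /err !ler_norml !(metric_sym (x n)).
  move: (k n) (n.+1%:R^-1) (mdist (c t) _) (mdist (c 0) _) (mdist (c (t1 n)) _).
  move=> K w A B C /andP[? ?] /andP[? ?] ?; apply/andP; lra.
have -> : k0 * t = k0 * t + 0 by rewrite addr0.
apply: (cvg_trans _ (cvgD (cvgM ck (cvg_cst t (F := U))) cerr)); apply: near_eq_cvg.
by apply: nearW => n; rewrite !fctE /err /mul_fun subrKC.
Unshelve. all: by end_near. Qed.

(** Otherwise the slope stays in [[0, 1 - e]] on arbitrarily long intervals that
    start at the projection.  As it is monotone, it is almost constant on some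
    long subinterval, and such subintervals produce a flat half plane. *)
Lemma slope_after_projection (c : R -> X) (e : R) : periodic_line c ->
  ~ bounds_flat_half_plane c -> 0 < e < 1 ->
  exists2 T, 0 < T & forall x p, near_param c x p -> forall t t',
    p + T <= t -> t <= t' ->
    (1 - e) * (t' - t) <= mdist x (c t') - mdist x (c t).
Proof.
move=> pc nflat /andP[e0 e1]; have [hc _] := pc.
apply: contrapT => nT; apply: nflat; apply: (flat_half_plane_of_approx pc e0).
move=> W W0.
have We : 0 < 2 * W / e by apply: divr_gt0 => //; lra.
pose N := Num.bound (W * W).
have NW : W * W < N%:R.
  by have := archi_boundP (mulr_ge0 (ltW W0) (ltW W0)).
move: N NW => N NW; (* There is room for [N.+2] intervals of length [W], and [x] is so far from the
   line that its distance is at least [e * T / 2 >= W]. *)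
pose T := N.+2%:R * W + 2 * W / e.
have T0 : 0 < T.
  have : 0 <= N.+2%:R * W by rewrite mulr_ge0 // ltW.
  by rewrite /T; lra.
have [x [p [t [t' [hp pt tt hbad]]]]] : exists x p t t', [/\ near_param c x p,
    p + T <= t, t <= t' & mdist x (c t') - mdist x (c t) < (1 - e) * (t' - t)].
  apply: contrapT => H; apply: nT; exists T => // x p hp t t' pt tt.
  by rewrite leNgt; apply/negP => h; apply: H; exists x, p, t, t'.
pose f s := mdist x (c s).
have cf s u l : 0 <= l <= 1 -> f ((1 - l) * s + l * u) <= (1 - l) * f s + l * f u.
  by move=> l01; exact: (dist_line_convex hm hc).
have {}tt : t < t'.
  by rewrite lt_neqAle tt andbT; apply/eqP => tE; move: hbad; rewrite tE !subrr; lra.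
have slope_le a b : a <= b -> b <= p + T -> f b - f a <= (1 - e) * (b - a).
  move=> ab bT; apply: (convex_slope_le cf ab _ tt); first by lra.
  exact: ltW.
have slope_ge0 a b : p <= a -> a <= b -> 0 <= f b - f a.
  move=> pa ab; have := hp a; rewrite -/(f a) -/(f p) => h1.
  have := convex_chord cf pa ab; move: ab; rewrite le_eqVlt => /orP[/eqP ->|ab].
    by move=> _; rewrite subrr.
  have := hp b; rewrite -/(f b) -/(f p) => h2 h3.
  have [pa'|pa'] := eqVneq p a; first by rewrite -pa'; lra.
  have {}pa : 0 < a - p by rewrite subr_gt0 lt_neqAle pa'.
  have ba : 0 < b - a by lra.
  rewrite -(pmulr_rge0 _ pa).
  have : 0 <= (b - a) * (f a - f p) by rewrite mulr_ge0 //; lra.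
  lra.
pose a j := p + j%:R * W.
have aS j : a j.+1 = a j + W by rewrite /a -natr1; ring.
have a_le j : (j <= N.+1)%N -> a j <= p + T.
  move=> jN; have : (j%:R : R) <= N.+2%:R by rewrite ler_nat leqW.
  by move/(ler_wpM2r (ltW W0)); rewrite /a /T; lra.
have a_ge j : p <= a j by rewrite lerDl mulr_ge0 // ltW.
(* Otherwise the increments over successive intervals would grow by more than
   [W] from a nonnegative value, but the last one is at most [(1 - e) * W]. *)
have [j jN hj] : exists2 j, (j < N)%N &
    (f (a j.+2) + f (a j) - 2 * f (a j.+1)) / 2 <= W^-1.
  apply: contrapT => H.
  have incr j : (j <= N)%N -> j%:R * W^-1 <= f (a j.+1) - f (a j).
    elim: j => [_|j IH jN].
      by rewrite mul0r slope_ge0 // aS lerDl ltW.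
    have := IH (ltnW jN); rewrite -natr1 mulrDl mul1r.
    have : W^-1 < (f (a j.+2) + f (a j) - 2 * f (a j.+1)) / 2.
      by rewrite ltNge; apply/negP => h; apply: H; exists j.
    have : 0 < W^-1 by rewrite invr_gt0.
    lra.
  have := incr N (leqnn N).
  have aN : a N <= a N.+1 by rewrite aS lerDl ltW.
  have := slope_le (a N) (a N.+1) aN (a_le _ (leqnn _)).
  have -> : a N.+1 - a N = W by rewrite aS; ring.
  move=> h1 h2.
  have : W < N%:R * W^-1 by rewrite ltr_pdivlMr.
  have := mulr_gt0 e0 W0; lra.
exists x, (a j.+1), ((f (a j.+1 + W) - f (a j.+1 - W)) / (2 * W)).
have am : a j.+1 - W = a j by rewrite aS; ring.
have W2 : 0 < 2 * W by lra.
split.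
- rewrite am -aS ger0_norm; last first.
    by rewrite divr_ge0 ?(ltW W2) // slope_ge0 // !aS; lra.
  rewrite ler_pdivrMr //.
  have -> : 2 * W = a j.+2 - a j by rewrite !aS; ring.
  by apply: slope_le; [rewrite !aS; lra | apply: a_le].
- have h1 := hp (a j.+1).
  have h2 := slope_le p (p + T); rewrite lerDl (ltW T0) lexx in h2.
  have {}h2 := h2 isT isT.
  have := metric_triangle (c p) x (c (p + T)); rewrite line_dist //.
  rewrite (metric_sym (c p)) -/(f p) -/(f (p + T)) distrC.
  rewrite (_ : p + T - p = T) in h2 *; last by ring.
  rewrite ger0_norm; last exact: ltW.
  rewrite -/(f p) -/(f (a j.+1)) in h1 *.
  have : 2 * W <= e * T.
    rewrite /T mulrDr (mulrC e (_ / _)) divfK; last by apply/eqP; lra.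
    by rewrite lerDr !mulr_ge0 // ltW.
  lra.
move=> s hs; apply: le_trans (convex_almost_affine cf _ W0 hs) _.
by rewrite am -aS.
Qed.

End Periodic.

(** * Parallel lines *)

Lemma convex_bounded_const (R : realType) (f : R -> R) (K : R) :
  (forall s t l, 0 <= l <= 1 ->
    f ((1 - l) * s + l * t) <= (1 - l) * f s + l * f t) ->
  (forall t, `|f t| <= K) -> forall s t, f s <= f t.
Proof.
move=> cf bf s t; rewrite leNgt; apply/negP => fts.
have K0 : 0 <= K := le_trans (normr_ge0 _) (bf 0).
pose A := 2 * K / (f s - f t) + 1.
have d0 : 0 < f s - f t by lra.
have AE : A * (f s - f t) = 2 * K + (f s - f t).
  by rewrite /A mulrDl divfK ?mul1r //; apply/eqP; lra.
have A0 : 0 < A by rewrite /A ltr_wpDl // divr_ge0 //; lra.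
have := bf s; rewrite ler_norml => /andP[bs1 bs2].
have [st|ts|st] := ltgtP s t; last by move: fts; rewrite st; lra.
- have B0 : 0 <= A * (t - s) by rewrite mulr_ge0 //; lra.
  have := @convex_chord _ f cf (s - A * (t - s)) s t ltac:(lra) (ltW st).
  have := bf (s - A * (t - s)); rewrite ler_norml => /andP[b1 b2].
  have -> : t - (s - A * (t - s)) = (1 + A) * (t - s) by ring.
  have -> : s - (s - A * (t - s)) = A * (t - s) by ring.
  set v := f (s - _) in b1 b2 * => H.
  have p : 0 < t - s by lra.
  have : (t - s) * ((1 + A) * f s) <= (t - s) * (v + A * f t) by lra.
  rewrite ler_pM2l //; lra.
have B0 : 0 <= A * (s - t) by rewrite mulr_ge0 //; lra.
have := @convex_chord _ f cf t s (s + A * (s - t)) (ltW ts) ltac:(lra).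
have := bf (s + A * (s - t)); rewrite ler_norml => /andP[b1 b2].
have -> : s + A * (s - t) - t = (1 + A) * (s - t) by ring.
have -> : s + A * (s - t) - s = A * (s - t) by ring.
set v := f (s + _) in b1 b2 * => H.
have p : 0 < s - t by lra.
have : (s - t) * ((1 + A) * f s) <= (s - t) * (v + A * f t) by lra.
rewrite ler_pM2l //; lra.
Qed.

Lemma lipschitz1_within (R : realType) (f : R -> R) (a b k : R) : a <= b ->
  (forall s t, a <= s <= b -> a <= t <= b -> `|f s - f t| <= k * `|s - t|) ->
  {within `[a, b], continuous f}.
Proof.
move=> ab lip.
pose cl (t : R) := if t < a then a else if b < t then b else t.
have cl_in t : a <= cl t <= b.
  rewrite /cl; case: ltP => ?; first by rewrite lexx.
  by case: ltP => ?; [rewrite lexx andbT | apply/andP].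
have cl_lip s t : `|cl s - cl t| <= `|s - t|.
  have st1 := ler_norm (s - t); have st2 := ler_norm (t - s).
  rewrite (distrC t) in st2.
  rewrite ler_norml /cl.
  case: (ltP s a) => ?; case: (ltP t a) => ?; case: (ltP b s) => ?;
    case: (ltP b t) => ?; apply/andP; lra.
have cont : continuous (f \o cl).
  apply: (@lipschitz1_continuous _ _ `|k|) => s t /=.
  apply: le_trans (lip _ _ (cl_in s) (cl_in t)) _.
  apply: le_trans (_ : `|k| * `|cl s - cl t| <= _).
    by apply: ler_wpM2r => //; exact: ler_norm.
  exact: ler_wpM2l.
apply: (@subspace_eq_continuous R `[a, b]%classic R (f \o cl) f); last first.
  exact: continuous_subspaceT.
move=> t; rewrite inE /= in_itv /= => /andP[h1 h2].
by rewrite /cl !ltNge h1 h2.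
Qed.

Section Parallel.
Context {R : realType} {X : metricType R} (m : X -> X -> R -> X).
Hypothesis hm : stewart m.
Hypothesis pX : proper_space X.

Lemma geo_reparam a b k l : 0 <= k <= 1 -> 0 <= l <= 1 ->
  m a (m a b l) k = m a b (k * l).
Proof.
move=> k01 l01; have /andP[k0 k1] := k01; have /andP[l0 l1] := l01.
have kl : 0 <= k * l <= 1 by apply/andP; split; nra.
apply: (geo_uniq hm) => //.
  by rewrite (geo_dist_left hm) // (geo_dist_left hm) // mulrA.
apply: le_trans (metric_triangle _ (m a b l) _) _.
rewrite !(geo_dist_right hm) // (geo_dist_left hm) //; lra.
Qed.

(** A bounded convex function on the real line is constant, so the distance of
    [c t] and [c' (t + u)] does not depend on [t].  With [u] the parameter of a
    projection, this distance is minimal, and roundness bounds the diagonals. *)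
Lemma parallel_dist (c c' : R -> X) (K : R) :
  geodesic_line c -> geodesic_line c' -> (forall u, mdist (c u) (c' u) <= K) ->
  exists u, near_param c' (c 0) u /\ forall t,
    mdist (c 0) (c' u) <= mdist (c t) (c' u) /\
    mdist (c t) (c' u) ^+ 2 <= mdist (c 0) (c' u) ^+ 2 + 2 * t ^+ 2.
Proof.
move=> hc hc' par.
have [u hu] := near_param_exists (c 0) hc'.
have eqd v s t : mdist (c s) (c' (s + v)) <= mdist (c t) (c' (t + v)).
  apply: (@convex_bounded_const _ (fun t => mdist (c t) (c' (t + v))) (K + `|v|)).
    move=> s' t' l l01.
    have -> : (1 - l) * s' + l * t' + v = (1 - l) * (s' + v) + l * (t' + v) by ring.
    by rewrite !(line_geo hm) //; exact: geo_convex.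
  move=> s'; rewrite ger0_norm ?mdist_ge0 //.
  apply: le_trans (metric_triangle _ (c' s') _) _; apply: lerD => //.
  by rewrite line_dist // opprD addrA subrr sub0r normrN.
exists u; split => // t; split.
  have := eqd (u - t) 0 t; rewrite add0r subrKC; apply: le_trans.
  exact: hu.
have := roundness hm (c 0) (c t) (c' (u + t)) (c' u).
rewrite !line_dist // !sqr_normr.
have h1 : mdist (c t) (c' (u + t)) ^+ 2 <= mdist (c 0) (c' u) ^+ 2.
  by rewrite ler_pXn2r ?nnegrE ?mdist_ge0 //; have := eqd u t 0; rewrite addrC add0r.
have h2 : mdist (c 0) (c' u) ^+ 2 <= mdist (c 0) (c' (u + t)) ^+ 2.
  by rewrite ler_pXn2r ?nnegrE ?mdist_ge0 //; exact: hu.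
rewrite (metric_sym (c' u) (c 0)); lra.
Qed.

(** From a point of a far parallel the distances to the points of a long segment
    of [c] are almost equal: far parallels would produce a flat half plane, with
    slope [0]. *)
Lemma parallel_bounded (c : R -> X) : periodic_line c ->
  ~ bounds_flat_half_plane c -> exists2 A, 0 < A & forall c' K,
  geodesic_line c' -> (forall u, mdist (c u) (c' u) <= K) ->
  exists u, mdist (c 0) (c' u) < A.
Proof.
move=> pc nflat; have [hc _] := pc.
apply: contrapT => nA; apply: nflat.
apply: (flat_half_plane_of_approx hm pX (e := 1)) => // W W0.
have W30 : 0 < W * W * W by rewrite !mulr_gt0.
have [c' [K [hc' par far]]] : exists c' K, [/\ geodesic_line c',
    forall u, mdist (c u) (c' u) <= K & forall u, W + W * W * W <= mdist (c 0) (c' u)].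
  apply: contrapT => H; apply: nA; exists (W + W * W * W); first by lra.
  move=> c' K hc' par; apply: contrapT => H'; apply: H; exists c', K; split => //.
  by move=> u; rewrite leNgt; apply/negP => h; apply: H'; exists u.
have [u [_ hu]] := parallel_dist hc hc' par.
exists (c' u), 0, 0; rewrite subrr normr0; split => //.
  by rewrite metric_sym; have := far u; lra.
move=> t tW; rewrite add0r mul0r subr0 !(metric_sym (c' u)).
have [h1 h2] := hu t; rewrite ger0_norm; last by lra.
set a := mdist (c 0) (c' u) in h1 h2 *.
have aW : W + W * W * W <= a := far u.
have V0 : 0 < W^-1 by rewrite invr_gt0.
have VE : W^-1 * W = 1 by rewrite mulVf //; apply/eqP; lra.
rewrite lerBlDr; apply: ler_sqr_nneg; first by lra.
apply: le_trans h2 _.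
have : t ^+ 2 <= W ^+ 2.
  by rewrite -(sqr_normr t) ler_pXn2r ?nnegrE //; lra.
have : W ^+ 2 <= a * W^-1.
  have -> : W ^+ 2 = (W * W * W) * W^-1 by rewrite -mulrA (mulrC W W^-1) VE mulr1 expr2.
  by rewrite ler_pM2r //; lra.
have := sqr_ge0 (W^-1); rewrite sqrrD; lra.
Qed.

Lemma periodic_line_opp (c : R -> X) :
  periodic_line c -> periodic_line (fun t => c (- t)).
Proof.
move=> [hc [l per]]; split.
  by move=> s t _ _; rewrite hc // -opprD normrN.
exists l => t0; have [psi [iso [t1 [ht1 e]]]] := per (- t0).
exists psi; split => //; exists (- t1); rewrite normrN; split => // t.
by rewrite !opprD opprK e.
Qed.

Lemma flat_half_plane_opp (c : R -> X) :
  bounds_flat_half_plane (fun t => c (- t)) -> bounds_flat_half_plane c.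
Proof.
move=> [F [F0 Fd]]; exists (fun u => F (- u.1, u.2)); split.
  by move=> t; rewrite F0 /= opprK.
move=> u v u0 v0; rewrite Fd //= /Defs.edist /=; congr Num.sqrt.
by ring.
Qed.

Lemma near_param_opp (c : R -> X) x p :
  near_param c x p -> near_param (fun t => c (- t)) x (- p).
Proof. by move=> h t /=; rewrite opprK. Qed.

(** At [c 0] the distance to [x] decreases towards the projection of [x] with almost
    unit slope, so the comparison triangle of [x], [c 0] and [c (- K)] is thin. *)
Lemma segment_follows_line (c : R -> X) (K d : R) : periodic_line c ->
  ~ bounds_flat_half_plane c -> 0 < K -> 0 < d ->
  exists T, forall x p, near_param c x p -> p + T <= 0 ->
    K <= mdist (c 0) x /\ mdist (c (- K)) (m (c 0) x (K / mdist (c 0) x)) <= d.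
Proof.
move=> pc nflat K0 d0; have [hc _] := pc.
pose e := d ^+ 2 / (d ^+ 2 + 2 * K ^+ 2 + 1).
have K20 := sqr_ge0 K.
have d20 : 0 < d ^+ 2 by rewrite exprn_gt0.
have D0 : 0 < d ^+ 2 + 2 * K ^+ 2 + 1 by lra.
have eE : e * (d ^+ 2 + 2 * K ^+ 2 + 1) = d ^+ 2.
  by rewrite divfK //; apply/eqP; lra.
have e0 : 0 < e by rewrite divr_gt0.
have e1 : e < 1 by rewrite ltr_pdivrMr //; lra.
have [|T T0 hT] := slope_after_projection hm pX (e := e) pc nflat.
  by rewrite e0.
exists (T + K) => x p hp pT.
have := near_param_sq hm 0 hc hp; rewrite sub0r sqrrN (metric_sym x (c 0)) => np.
set L := mdist (c 0) x in np *.
have L0 : 0 <= L := mdist_ge0 _ _.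
have KL : K <= L.
  apply: ler_sqr_nneg => //; have := sqr_ge0 (mdist x (c p)); nra.
split => //.
have := hT x p hp (- K) 0; rewrite sub0r opprK => /(_ ltac:(lra) ltac:(lra)).
rewrite (metric_sym x (c 0)) -/L (metric_sym x) => hs.
set b := mdist (c (- K)) x in hs.
have b0 : 0 <= b := mdist_ge0 _ _.
have Lp : 0 < L by lra.
pose lam := K / L; rewrite -/lam.
have lamE : lam * L = K by rewrite divfK //; apply/eqP; lra.
have l01 : 0 <= lam <= 1.
  by rewrite divr_ge0 ?(ltW K0) ?(ltW Lp) //= ler_pdivrMr // mul1r.
have /andP[l0 l1] := l01.
apply: ler_sqr_nneg; first exact: ltW.
apply: le_trans (hm (c 0) x (c (- K)) l01) _.
rewrite line_dist // subr0 normrN (ger0_norm (ltW K0)) -/b -/L.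
have hb : b ^+ 2 <= (L - (1 - e) * K) ^+ 2.
  by rewrite ler_pXn2r ?nnegrE //; lra.
have h1 : lam * b ^+ 2 <= lam * (L - (1 - e) * K) ^+ 2 by exact: ler_wpM2l.
have h2 : lam * (L - (1 - e) * K) ^+ 2 - lam * (1 - lam) * L ^+ 2 =
   - 2 * (1 - e) * K * (lam * L) + lam * ((1 - e) * K) ^+ 2 + (lam * L) ^+ 2.
  by ring.
rewrite lamE in h2.
have h3 : ((1 - e) * K) ^+ 2 <= K ^+ 2.
  have e10 : 0 <= 1 - e by rewrite subr_ge0 ltW.
  have K0' := ltW K0; rewrite ler_pXn2r ?nnegrE ?mulr_ge0 //.
  by rewrite ler_piMl // gerBl ltW.
have h4 : lam * ((1 - e) * K) ^+ 2 <= lam * K ^+ 2 by exact: ler_wpM2l.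
have h5 : 2 * e * K ^+ 2 <= d ^+ 2.
  have := mulr_gt0 e0 d20; lra.
lra.
Qed.

End Parallel.

(** * Isosceles triangles over a line *)

Lemma ratio_itv (R : realType) (a b : R) : 0 <= a -> a <= b -> 0 < b ->
  0 <= a / b <= 1.
Proof. by move=> a0 ab b0; rewrite divr_ge0 ?(ltW b0) //= ler_pdivrMr // mul1r. Qed.

Section GromovProduct.
Context {R : realType} {X : metricType R} (m : X -> X -> R -> X).
Hypothesis hm : stewart m.
Implicit Types (o x y z p : X).

Lemma half01 : 0 <= (2^-1 : R) <= 1. Proof. by apply/andP; lra. Qed.

Lemma midpoint_sym x y : m x y 2^-1 = m y x 2^-1.
Proof. by rewrite (geo_sym hm) ?half01 //; congr m; field. Qed.

(** Comparison in the triangle of [o], [x], [y]: cutting the longer side down to the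
    length of the other one loses at most half of the Gromov product. *)
Lemma gromov_truncate o x y g : 0 <= g -> 0 < mdist o y ->
  mdist o y <= mdist o x -> mdist x y + g <= mdist o x + mdist o y ->
  mdist (m o x (mdist o y / mdist o x)) y + g / 2 <= 2 * mdist o y.
Proof.
move=> g0 r0 rL hg.
set r := mdist o y in r0 rL hg *; set L := mdist o x in rL hg *.
have L0 : 0 < L by lra.
have := metric_triangle o y x; rewrite (metric_sym y x) -/r -/L => tr.
pose l := r / L; rewrite -/l.
have lE : l * L = r by rewrite divfK //; apply/eqP; lra.
have l01 : 0 <= l <= 1.
  by rewrite /l; apply: ratio_itv => //; exact: ltW.
have /andP[l0 l1] := l01.
suff : mdist (m o x l) y <= 2 * r - g / 2 by lra.
apply: ler_sqr_nneg; first by lra.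
rewrite (metric_sym _ y); apply: le_trans (hm o x y l01) _.
rewrite (metric_sym y o) (metric_sym y x) -/r -/L.
have h1 : mdist x y ^+ 2 <= (L + r - g) ^+ 2.
  by rewrite ler_pXn2r ?nnegrE ?mdist_ge0 //; have := mdist_ge0 x y; lra.
have h2 : l * mdist x y ^+ 2 <= l * (L + r - g) ^+ 2 by exact: ler_wpM2l.
have h3 : l * (L + r - g) ^+ 2 - l * (1 - l) * L ^+ 2 =
  2 * (l * L) * (r - g) + l * (r - g) ^+ 2 + (l * L) ^+ 2 by ring.
rewrite lE in h3.
have h4 : l * (g * (2 * r - g)) >= 0 by apply: mulr_ge0 => //; apply: mulr_ge0; lra.
have := sqr_ge0 g; nra.
Qed.

(** A point of the base that is close to the apex would make one of the equal
    sides too short, unless it is also close to the midpoint. *)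
Lemma isosceles_midpoint o x y l : mdist o x = mdist o y -> 0 <= l <= 1 ->
  mdist o (m x y 2^-1) <= 2 * mdist o (m x y l).
Proof.
move=> iso l01; have /andP[l0 l1] := l01.
have h := half01.
have t0 := metric_triangle o (m x y l) (m x y 2^-1).
rewrite (geo_dist hm) // in t0.
have t1 := metric_triangle x o y; rewrite (metric_sym x o) iso in t1.
have t2 := metric_triangle o (m x y l) x.
rewrite (metric_sym (m x y l) x) (geo_dist_left hm) // in t2.
have t3 := metric_triangle o (m x y l) y; rewrite (geo_dist_right hm) // in t3.
case: (ger0P (l - 2^-1)) t0 => ?; nra.
Qed.

(** Half of the base and a side of an isosceles triangle have a common end, so
    they stay as close as their other ends, the midpoint and the apex. *)
Lemma isosceles_half_follows o x y A u : mdist o x = mdist o y ->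
  mdist o (m x y 2^-1) <= A -> 0 <= u -> u <= mdist x y / 2 ->
  0 < mdist x y -> 0 < mdist o y ->
  mdist (m x y (2^-1 + u / mdist x y)) (m o y (u / mdist o y)) <= 2 * A.
Proof.
move=> iso zA u0 ud d0 s0; have h := half01.
set z := m x y 2^-1 in zA *; set d := mdist x y in ud d0 *.
set s := mdist o y in iso s0 *.
have zy : mdist z y = d / 2 by rewrite (geo_dist_right hm) // -/d; lra.
have t1 := metric_triangle z o y; have t2 := metric_triangle o z y.
rewrite (metric_sym z o) -/s zy in t1; rewrite -/s zy in t2.
have t3 := metric_triangle x o y; rewrite (metric_sym x o) iso -/d -/s in t3.
pose k := u / (d / 2).
have kE : k * d = 2 * u.
  have -> : k * d = k * (d / 2) * 2 by field.
  by rewrite divfK; [ring | apply/eqP; lra].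
have k01 : 0 <= k <= 1.
  by rewrite /k; apply: ratio_itv => //; rewrite divr_gt0.
have /andP[k0 k1] := k01.
have lE : 2^-1 + u / d = 1 - (1 - k) * 2^-1.
  have -> : u / d = k / 2 by rewrite /k; field; apply/eqP; lra.
  by field.
have l01 : 0 <= (1 - k) * 2^-1 <= 1 by apply/andP; split; nra.
have -> : m x y (2^-1 + u / d) = m z y k.
  rewrite lE (geo_sym hm) ?subKr; last by apply/andP; split; nra.
  rewrite -(geo_reparam hm) ?half01 //; last by apply/andP; lra.
  by rewrite midpoint_sym -/z [RHS](geo_sym hm).
have v01 : 0 <= u / s <= 1.
  by apply: ratio_itv => //; lra.
apply: le_trans (metric_triangle _ (m o y k) _) _.
have -> : 2 * A = A + A by ring.
apply: lerD.
  apply: le_trans (geo_convex hm _ _ _ _ k01) _.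
  rewrite mdistxx mulr0 addr0 (metric_sym z o).
  have := mdist_ge0 o z; nra.
rewrite (geo_dist hm) // -/s -{2}(ger0_norm (ltW s0)) -normrM mulrBl divfK; last first.
  by apply/eqP; lra.
have ks : k * (s - d / 2) = k * s - u by rewrite mulrBr; lra.
by rewrite -ks ler_norml; apply/andP; split; nra.
Qed.

(** Convexity of the distance between two geodesics with a common origin. *)
Lemma follows_initially (c : R -> X) o x W d s : geodesic_line c -> c 0 = o ->
  0 < W -> W <= mdist o x -> mdist (c W) (m o x (W / mdist o x)) <= d ->
  0 <= s -> s <= W -> mdist (c s) (m o x (s / mdist o x)) <= s / W * d.
Proof.
move=> hc <- W0 WL hd s0 sW.
set L := mdist (c 0) x in WL hd *.
have L0 : 0 < L by lra.
have l01 : 0 <= s / W <= 1 by exact: ratio_itv.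
have w01 : 0 <= W / L <= 1.
  by apply: ratio_itv => //; exact: ltW.
have -> : s / L = s / W * (W / L) by field; apply/andP; split; apply/eqP; lra.
rewrite -(geo_reparam hm) //.
have := line_geo hm hc 0 W l01.
have -> : (1 - s / W) * 0 + s / W * W = s.
  by rewrite mulr0 add0r divfK //; apply/eqP; lra.
move=> ->; apply: le_trans (geo_fan hm _ _ _ l01) _.
by apply: ler_wpM2l => //; move/andP: l01 => [].
Qed.

Lemma geodesic_line_opp (c : R -> X) :
  geodesic_line c -> geodesic_line (fun t => c (- t)).
Proof. by move=> hc s t _ _; rewrite hc // -opprD normrN. Qed.

(** Isosceles triangles with sides on the two sides of a given triangle shrink
    from a triangle of height at least [A] to a point; by continuity the
    height of one of them is [A].  Its sides are still long, because close to
    [c 0] the two sides run along the line in opposite directions. *)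
Lemma slide_midpoint (c : R -> X) x y A W d : geodesic_line c ->
  0 < A -> 0 < W -> d < A ->
  W <= mdist (c 0) x -> W <= mdist (c 0) y ->
  mdist x y + 4 * A <= mdist (c 0) x + mdist (c 0) y ->
  mdist (c (- W)) (m (c 0) x (W / mdist (c 0) x)) <= d ->
  mdist (c W) (m (c 0) y (W / mdist (c 0) y)) <= d ->
  exists x' y', [/\ mdist (c 0) x' = mdist (c 0) y',
    mdist (c 0) (m x' y' 2^-1) = A, W <= mdist (c 0) y',
    mdist (c (- W)) (m (c 0) x' (W / mdist (c 0) x')) <= d &
    mdist (c W) (m (c 0) y' (W / mdist (c 0) y')) <= d].
Proof.
move=> hc A0 W0 dA Wx Wy hg fx fy.
set o := c 0 in Wx Wy hg fx fy *; have h := half01.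
have Lx0 : 0 < mdist o x by lra.
have Ly0 : 0 < mdist o y by lra.
have [r [r0 Wr rx ry hr]] : exists r, [/\ 0 < r, W <= r, r <= mdist o x,
    r <= mdist o y & mdist (m o x (r / mdist o x)) (m o y (r / mdist o y)) + 2 * A
      <= 2 * r].
  have [yx|xy] := lerP (mdist o y) (mdist o x).
    exists (mdist o y); split => //.
    rewrite divff ?(geo1 hm); last by apply/eqP; lra.
    by have := gromov_truncate _ Ly0 yx hg; lra.
  exists (mdist o x); split => //; first exact: ltW.
  rewrite divff ?(geo1 hm); last by apply/eqP; lra.
  rewrite metric_sym (metric_sym x) addrC in hg *; rewrite addrC.
  by have := @gromov_truncate o y x (4 * A) ltac:(lra) Lx0 (ltW xy) ltac:(lra); lra.
have frac z : r <= mdist o z -> 0 <= r / mdist o z <= 1.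
  move=> rz; have ? : 0 < mdist o z by lra.
  by apply: ratio_itv => //; exact: ltW.
have hx := frac _ rx; have hy := frac _ ry.
set x1 := m o x _ in hr; set y1 := m o y _ in hr.
have dx1 : mdist o x1 = r by rewrite (geo_dist_left hm) // divfK //; apply/eqP; lra.
have dy1 : mdist o y1 = r by rewrite (geo_dist_left hm) // divfK //; apply/eqP; lra.
pose f t := mdist o (m (m o x1 t) (m o y1 t) 2^-1).
have fcont : {within `[0, 1], continuous f}.
  apply: (@lipschitz1_within _ _ _ _ r) => // s t s01 t01.
  have h1 := geo_convex hm (m o x1 s) (m o y1 s) (m o x1 t) (m o y1 t) h.
  rewrite !(geo_dist hm) // dx1 dy1 in h1.
  set z := m _ _ 2^-1 in h1; set z' := m (m o x1 t) _ _ in h1.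
  have := metric_triangle o z z'; have := metric_triangle o z' z.
  rewrite (metric_sym z' z) /f -/z -/z' ler_norml => *; apply/andP; lra.
have [t t01 ft] : exists2 t, t \in `[0, 1] & f t = A.
  apply: IVT fcont _ => //.
  have -> : f 0 = 0.
    rewrite /f !(geo0 hm); have := dist_geo_convex hm o o o h.
    rewrite mdistxx !mulr0 addr0 => h0; apply/eqP.
    by rewrite eq_le h0 mdist_ge0.
  have f1 : A <= f 1.
    rewrite /f !(geo1 hm); have := metric_triangle o (m x1 y1 2^-1) x1.
    by rewrite dx1 (metric_sym (m x1 y1 2^-1)) (geo_dist_left hm) //; lra.
  by rewrite ge_min le_max (ltW A0) f1 orbT.
rewrite in_itv /= in t01; have /andP[t0 t1] := t01.
have reparam z : r <= mdist o z ->
    m o (m o z (r / mdist o z)) t = m o z (t * r / mdist o z).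
  by move=> rz; rewrite (geo_reparam hm) ?frac // mulrA.
have s_le : t * r <= r by rewrite ler_piMl // ltW.
have s_ge : 0 <= t * r by rewrite mulr_ge0 // ltW.
have ds z : r <= mdist o z -> mdist o (m o z (t * r / mdist o z)) = t * r.
  move=> rz; rewrite -reparam // !(geo_dist_left hm) ?frac //.
  by rewrite divfK //; apply/eqP; lra.
have Ws : W <= t * r.
  rewrite leNgt; apply/negP => sW; move: ft; rewrite /f /x1 /y1 !reparam // => ft.
  have fo := @follows_initially _ o y W d (t * r) hc erefl W0 Wy fy s_ge (ltW sW).
  have fo' := @follows_initially (fun t => c (- t)) o x W d (t * r)
    (geodesic_line_opp hc) (congr1 c (oppr0 _)) W0 Wx fx s_ge (ltW sW).
  have d0 : 0 <= d by apply: le_trans fy; exact: mdist_ge0.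
  have sW1 : t * r / W * d <= d.
    by rewrite ler_piMl // ler_pdivrMr // mul1r ltW.
  have cE : o = m (c (- (t * r))) (c (t * r)) 2^-1.
    by rewrite -(line_geo hm) //; congr c; lra.
  have := geo_convex hm (c (- (t * r))) (c (t * r)) _ _ h.
  by move=> /(_ (m o x (t * r / mdist o x)) (m o y (t * r / mdist o y))); rewrite -cE; lra.
have tail z : r <= mdist o z ->
    m o (m o (m o z (r / mdist o z)) t) (W / (t * r)) = m o z (W / mdist o z).
  move=> rz; have rz0 : 0 < mdist o z by lra.
  have tr0 : 0 < t * r by lra.
  rewrite reparam // (geo_reparam hm).
  - congr m; move: (mdist o z) rz0 => L L0; move: (t * r) tr0 => q q0.
    by field; rewrite !gt_eqF.
  - by apply: ratio_itv => //; exact: ltW.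
  by apply: ratio_itv => //; exact: le_trans s_le rz.
exists (m o x1 t), (m o y1 t).
by rewrite !(geo_dist_left hm o x1) // !(geo_dist_left hm o y1) // dx1 dy1 !tail.
Qed.

End GromovProduct.

(** * Contraction for lines that bound no flat half plane *)

Section Contraction.
Context {R : realType} {X : metricType R} (m : X -> X -> R -> X).
Hypothesis hm : stewart m.
Hypothesis pX : proper_space X.
Implicit Types (c : R -> X) (x y : X).

(** The bases of isosceles triangles of constant height, with sides that follow
    the two halves of the line for longer and longer, converge to a parallel
    line. *)
Lemma limit_parallel c A : geodesic_line c -> 0 < A ->
  (forall W, 0 < W -> exists x y, [/\ mdist (c 0) x = mdist (c 0) y,
    mdist (c 0) (m x y 2^-1) = A, W <= mdist (c 0) y,
    mdist (c (- W)) (m (c 0) x (W / mdist (c 0) x)) <= 1 &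
    mdist (c W) (m (c 0) y (W / mdist (c 0) y)) <= 1]) ->
  exists c', [/\ geodesic_line c',
    forall u, mdist (c u) (c' u) <= 2 * A + 1 &
    forall u, A <= 2 * mdist (c 0) (c' u)].
Proof.
move=> hc A0 H; have h := @half01 R.
have /choice[D hD] : forall n : nat, exists D : X * X,
  [/\ mdist (c 0) D.1 = mdist (c 0) D.2,
    mdist (c 0) (m D.1 D.2 2^-1) = A, n.+1%:R <= mdist (c 0) D.2,
    mdist (c (- n.+1%:R)) (m (c 0) D.1 (n.+1%:R / mdist (c 0) D.1)) <= 1 &
    mdist (c n.+1%:R) (m (c 0) D.2 (n.+1%:R / mdist (c 0) D.2)) <= 1].
  by move=> n; have [|x [y hxy]] := H n.+1%:R; [by [] | exists (x, y)].
have [U [UU oU]] := ultra_nat.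
have UP : ProperFilter U := ultra_proper.
have big B : \forall n \near U, B <= n.+1%:R :> R.
  by apply/oU; near=> n; rewrite -addn1 natrD; apply: (@le_trans _ _ n%:R);
   [near: n; exact: nbhs_infty_ger | rewrite lerDl].
pose d n := mdist (D n).1 (D n).2.
pose y u n := m (D n).1 (D n).2 (2^-1 + u / d n).
have dbig B : \forall n \near U, B <= d n.
  apply: filterS (big (B / 2 + A)) => n hn.
  have [_ hz hs _ _] := hD n.
  have := metric_triangle (c 0) (m (D n).1 (D n).2 2^-1) (D n).2.
  by rewrite (geo_dist_right hm) // hz -/(d n); lra.
have frac u : \forall n \near U, 0 <= 2^-1 + u / d n <= 1 /\ 0 < d n.
  apply: filterS (dbig (2 * `|u| + 1)) => n hn.
  have u0 : 0 <= `|u| by [].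
  have d0 : 0 < d n by lra.
  split => //; have := ler_norm u; have := ler_norm (- u); rewrite normrN => u1 u2.
  have E : u / d n * d n = u by rewrite divfK //; apply/eqP; lra.
  by apply/andP; split; rewrite -(ler_pM2r d0) ?mul0r; lra.
have ydist u v : \forall n \near U, mdist (y u n) (y v n) = `|u - v|.
  apply: filterS2 (frac u) (frac v) => n [fu d0] [fv _].
  rewrite (geo_dist hm) // -/(d n) -{3}(ger0_norm (ltW d0)) -normrM; congr `|_|.
  by rewrite opprD addrACA subrr add0r -mulrBl divfK //; apply/eqP; lra.
have y0 n : y 0 n = m (D n).1 (D n).2 2^-1 by rewrite /y mul0r addr0.
have /choice[c' hc'] : forall u, exists p : X, y u @ U --> p.
  move=> u; apply: (@proper_ultra_cvg _ _ U UU pX (c 0) (A + `|u|)).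
  apply: filterS (ydist 0 u) => n e.
  apply: le_trans (metric_triangle _ (y 0 n) _) _; apply: lerD.
    by rewrite y0; have [_ -> _ _ _] := hD n.
  by rewrite e sub0r normrN.
exists c'; split.
- move=> s t _ _; apply: (@cvg_eq_limit _ U UU (fun n => mdist (y s n) (y t n))).
    exact: cvg_mdist.
  exact: ydist.
- move=> u.
  have cl : (fun n => mdist (c u) (y u n)) @ U --> mdist (c u) (c' u).
    by apply: cvg_mdist => //; exact: cvg_cst.
  apply: (ler_cvg_to cl (cvg_cst (2 * A + 1))).
  apply: filterS3 (frac u) (big (`|u| + 1)) (dbig (2 * `|u| + 1)).
  move=> n [fu d0] nu du; have [iso hz hs fx fy] := hD n.
  rewrite /y metric_sym.
  have u0 : 0 <= `|u| by [].
  have W0 : (0 : R) < n.+1%:R by [].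
  have frac1 (a : R) : a <= `|u| -> 0 <= a -> a / n.+1%:R * 1 <= 1.
    by move=> au a0; rewrite mulr1 ler_pdivrMr //; lra.
  set W := n.+1%:R in W0 nu hs fx fy frac1.
  have [up|un] := lerP 0 u.
    rewrite (ger0_norm up) in u0 nu du frac1.
    apply: le_trans (metric_triangle _ (m (c 0) (D n).2 (u / mdist (c 0) (D n).2)) _) _.
    apply: lerD.
      by apply: (isosceles_half_follows hm) => //; rewrite ?hz // -/(d n); lra.
    rewrite metric_sym.
    have := follows_initially hm hc erefl W0 hs fy up ltac:(lra).
    by move/le_trans; apply; exact: frac1.
  rewrite (ltr0_norm un) in u0 nu du frac1.
  have -> : m (D n).1 (D n).2 (2^-1 + u / d n) =
      m (D n).2 (D n).1 (2^-1 + (- u) / mdist (D n).2 (D n).1).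
    by rewrite (geo_sym hm) // (metric_sym (D n).2) -/(d n); congr m; lra.
  apply: le_trans (metric_triangle _ (m (c 0) (D n).1 (- u / mdist (c 0) (D n).1)) _) _.
  apply: lerD.
    apply: (isosceles_half_follows hm); rewrite ?(midpoint_sym hm (D n).2) ?hz //
      ?(metric_sym (D n).2) -/(d n) ?iso //; lra.
  rewrite metric_sym.
  have := @follows_initially _ _ _ hm (fun t => c (- t)) (c 0) (D n).1 W 1 (- u)
    (geodesic_line_opp hc) (congr1 c (oppr0 _)) W0 _ fx _ _.
  rewrite opprK iso => /(_ hs ltac:(lra) ltac:(lra)).
  by move/le_trans; apply; apply: frac1; lra.
move=> u.
have cl : (fun n => 2 * mdist (c 0) (y u n)) @ U --> 2 * mdist (c 0) (c' u).
  by apply: cvgMr; apply: cvg_mdist => //; exact: cvg_cst.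
apply: (ler_cvg_to (cvg_cst A) cl); apply: filterS (frac u) => n [fu d0].
have [iso hz _ _ _] := hD n.
by rewrite -hz; exact: (isosceles_midpoint hm iso fu).
Unshelve. all: by end_near. Qed.

(** Large Gromov products would give isosceles triangles of any prescribed height
    over [c], hence, in the limit, parallel lines that are too far away. *)
Lemma gromov_product_bounded c : periodic_line c -> ~ bounds_flat_half_plane c ->
  exists2 T, 0 < T & forall x y p q t0, near_param c x p -> near_param c y q ->
  p + T <= t0 -> t0 + T <= q ->
  mdist x (c t0) + mdist (c t0) y <= mdist x y + T.
Proof.
move=> pc nflat; have [hc [l per]] := pc.
apply: contrapT => nT.
have [A A0 hA] := parallel_bounded hm pX pc nflat.
have key W : exists x y p q, [/\ near_param c x p, near_param c y q,
    p + W <= 0, W <= q & mdist x y + W <= mdist (c 0) x + mdist (c 0) y].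
  pose T := `|W| + 2 * `|l| + 1.
  have W0 : 0 <= `|W| by []. have l0 : 0 <= `|l| by [].
  have ll := ler_norm l; have WW := ler_norm W.
  have [x [y [p [q [t0 [hp hq pt tq hg]]]]]] : exists x y p q t0,
    [/\ near_param c x p, near_param c y q, p + T <= t0, t0 + T <= q &
        mdist x y + T < mdist x (c t0) + mdist (c t0) y].
    apply: contrapT => H; apply: nT; exists T; first by rewrite /T; lra.
    move=> x y p q t0 hp hq pt tq; rewrite leNgt; apply/negP => h; apply: H.
    by exists x, y, p, q, t0.
  have [psi [iso [t1 [ht1 psic]]]] := per t0.
  have near_psi z s : near_param c z s -> near_param c (psi z) (t1 + (s - t0)).
    move=> hs t; have := hs (t0 + (t - t1)).
    rewrite -(iso z (c s)) -(iso z (c (t0 + _))).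
    have e : s = t0 + (s - t0) by rewrite subrKC.
    by rewrite {1}e !psic subrKC.
  exists (psi x), (psi y), (t1 + (p - t0)), (t1 + (q - t0)).
  move: ht1; rewrite ler_norml => /andP[ht1 ht1'].
  split; [exact: near_psi | exact: near_psi | rewrite /T in pt; lra
    | rewrite /T in tq; lra |].
  have pt0 : psi (c t0) = c t1 by have := psic 0; rewrite !addr0.
  rewrite -(iso x (c t0)) -(iso (c t0) y) pt0 -(iso x y) in hg.
  have : mdist (c 0) (c t1) <= `|l|.
    by rewrite line_dist // sub0r normrN ler_norml; apply/andP; lra.
  have := metric_triangle (c t1) (c 0) (psi y).
  have := metric_triangle (psi x) (c 0) (c t1).
  rewrite (metric_sym (psi x) (c 0)) (metric_sym (c t1) (c 0)) /T in hg *; lra.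
have A2 : 0 < 2 * A by lra.
suff /(limit_parallel hc A2)[c' [hc' par far]] : forall W, 0 < W ->
    exists x y, [/\ mdist (c 0) x = mdist (c 0) y,
    mdist (c 0) (m x y 2^-1) = 2 * A, W <= mdist (c 0) y,
    mdist (c (- W)) (m (c 0) x (W / mdist (c 0) x)) <= 1 &
    mdist (c W) (m (c 0) y (W / mdist (c 0) y)) <= 1].
  by have [u hu] := hA c' _ hc' par; have := far u; lra.
move=> W W0; pose d := Num.min 1 A.
have d0 : 0 < d by rewrite lt_min ltr01.
have d1 : d <= 1 by rewrite ge_min lexx.
have dA : d < 2 * A.
  by have : d <= A by [rewrite ge_min lexx orbT]; lra.
have [T1 hT1] := segment_follows_line hm pX pc nflat W0 d0.
have nflat' : ~ bounds_flat_half_plane (fun t => c (- t)).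
  by move/flat_half_plane_opp.
have [T2 hT2] := segment_follows_line hm pX (periodic_line_opp pc) nflat' W0 d0.
have [x [y [p [q [hp hq pW qW hg]]]]] := key (`|T1| + `|T2| + 8 * A).
have := ler_norm T1; have := ler_norm T2.
have N1 : 0 <= `|T1| by []. have N2 : 0 <= `|T2| by [].
move=> n2 n1; have [Wx fx] := hT1 x p hp ltac:(lra).
have [Wy fy] := hT2 y (- q) (near_param_opp hq) ltac:(lra).
rewrite oppr0 opprK in Wy fy.
have [||x' [y' [iso hz Wy' fx' fy']]] := @slide_midpoint _ _ _ hm c x y (2 * A) W d
  hc _ W0 dA Wx Wy _ fx fy; [lra | lra |].
by exists x', y'; split => //; [apply: le_trans fx' d1 | apply: le_trans fy' d1].
Qed.

(** Strong contraction: the concatenation of the two projection segments and a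
    long piece of the line is a geodesic up to [B]. *)
Definition contracting c (B : R) : Prop := forall x y p q,
  near_param c x p -> near_param c y q -> B <= `|p - q| ->
  mdist x (c p) + `|p - q| + mdist y (c q) - B <= mdist x y.

(** The bound on the Gromov product, at a point after the projection of [x] and at
    a point before the projection of [y]. *)
Lemma rank_one_contracting c : periodic_line c -> ~ bounds_flat_half_plane c ->
  exists2 B, 0 < B & contracting c B.
Proof.
move=> pc nflat; have [hc _] := pc.
have [T T0 hT] := gromov_product_bounded pc nflat.
have half x y p q : near_param c x p -> near_param c y q -> 4 * T <= q - p ->
    mdist x (c p) + (q - p) + mdist y (c q) - 4 * T <= mdist x y.
  move=> hp hq pq.
  have h1 := hT x y p q (p + T) hp hq (lexx _) ltac:(lra).
  have h2 := hT (c p) y p q (q - T) (near_param_line p hc) hq ltac:(lra) ltac:(lra).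
  have h3 := hp (p + T); have h4 := hq (q - T).
  have e1 : `|p - (p + T)| = T by rewrite opprD addNKr normrN gtr0_norm.
  have e2 : `|p - (q - T)| = q - p - T by rewrite distrC ger0_norm; lra.
  have h5 := metric_triangle (c p) (c (p + T)) y.
  rewrite line_dist // e1 in h5; rewrite line_dist // e2 in h2.
  rewrite !(metric_sym y) in h4 *; lra.
exists (4 * T); first by lra.
move=> x y p q hp hq; case: (ger0P (p - q)) => pq h.
  by have := half y x q p hq hp h; rewrite (metric_sym y x); lra.
by have := half x y p q hp hq ltac:(lra); lra.
Qed.

(** The projection is continuous, so it takes on the geodesic the value at distance
    [B] from [p]; there the two contraction inequalities leave no room for a
    detour. *)
Lemma contracting_visits c B x y p q : geodesic_line c -> contracting c B ->
  near_param c x p -> near_param c y q -> 2 * B <= `|p - q| -> 0 < B ->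
  exists l s, [/\ 0 <= l <= 1, near_param c (m x y l) s, `|s - p| = B &
    mdist (m x y l) (c s) <= B].
Proof.
move=> hc cB hp hq pq B0.
have /choice[f hf] : forall l, exists s, near_param c (m x y l) s.
  by move=> l; exact: near_param_exists.
have f0 : f 0 = p.
  by apply: (near_param_uniq hm hc (hf 0)); rewrite (geo0 hm).
have f1 : f 1 = q.
  by apply: (near_param_uniq hm hc (hf 1)); rewrite (geo1 hm).
have fc : {within `[0, 1], continuous f}.
  apply: (@lipschitz1_within _ _ _ _ (mdist x y)) => // s t hs ht.
  by apply: le_trans (near_param_lip hm hc (hf s) (hf t)) _; rewrite (geo_dist hm) // mulrC.
pose s := if p <= q then p + B else p - B.
have sp : `|s - p| = B.
  rewrite /s; case: ifP => _; first by rewrite addrC addKr gtr0_norm.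
  by rewrite addrAC subrr sub0r normrN gtr0_norm.
have sq : B <= `|s - q| /\ `|p - s| + `|s - q| = `|p - q|.
  rewrite (distrC p s) sp /s; case: (ger0P (p - q)) pq => h pq.
    rewrite ifF; last by apply/negbTE; rewrite -ltNge; lra.
    by rewrite (@ger0_norm _ (_ - q)); lra.
  rewrite ifT; last by lra.
  by rewrite (@ler0_norm _ (_ - q)); lra.
have [l l01 fl] : exists2 l, l \in `[0, 1] & f l = s.
  apply: IVT fc _ => //; rewrite f0 f1 ge_min le_max /s.
  case: (ger0P (p - q)) pq => h pq.
    rewrite ifF; last by apply/negbTE; rewrite -ltNge; lra.
    by apply/andP; split; apply/orP; [right|left]; lra.
  rewrite ifT; last by lra.
  by apply/andP; split; apply/orP; [left|right]; lra.
rewrite in_itv /= in l01.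
exists l, s; rewrite -fl in sp sq *; split => //.
have [sq1 sq2] := sq.
have h1 := cB _ _ _ _ hp (hf l) ltac:(by rewrite distrC sp).
have h2 := cB _ _ _ _ (hf l) hq sq1.
rewrite (geo_dist_left hm) // in h1; rewrite (geo_dist_right hm) // in h2.
have := metric_triangle x (c p) y; have := metric_triangle (c p) (c q) y.
rewrite line_dist // (metric_sym (c q) y); lra.
Qed.

End Contraction.

(** * Projections between axes *)

Section Projections.
Context {R : realType} {X : metricType R} (m : X -> X -> R -> X).
Hypothesis hm : stewart m.
Implicit Types (c : R -> X) (x y : X) (f : X -> X).

Lemma contracting_opp c B : contracting c B -> contracting (fun t => c (- t)) B.
Proof.
move=> cB x y p q hp hq pq.
have near_opp z s : near_param (fun t => c (- t)) z s -> near_param c z (- s).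
  by move=> h t; have := h (- t); rewrite opprK.
have e : `|- p - - q| = `|p - q| by rewrite -opprD normrN.
by have := cB x y (- p) (- q) (near_opp _ _ hp) (near_opp _ _ hq); rewrite e; exact.
Qed.

(** By contraction a ray with unbounded projection to [c] comes close to every
    sufficiently distant point of [c]. *)
Lemma asymptotic_of_unbounded c c' B : geodesic_line c -> geodesic_line c' ->
  contracting c B -> 0 < B ->
  (forall N : R, exists t p, [/\ 0 <= t, N <= p & near_param c (c' t) p]) ->
  asymptotic c' c.
Proof.
move=> hc hc' cB B0 unb.
have /choice[f hf] : forall t, exists s, near_param c (c' t) s.
  by move=> t; exact: near_param_exists.
have fcont : continuous f.
  apply: (@lipschitz1_continuous _ _ 1) => s t; rewrite mul1r.
  by rewrite -(line_dist hc' s t); exact: (near_param_lip hm hc (hf s) (hf t)).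
pose D := mdist (c' 0) (c 0).
have D0 : 0 <= D := mdist_ge0 _ _.
pose s0 := `|f 0| + 2 * B.
have F0 : 0 <= `|f 0| by [].
exists (2 * s0 + D + 2 * B) => s sge0; rewrite -/D.
have tri : mdist (c' s) (c s) <= `|s - 0| + D + `|0 - s|.
  rewrite -(line_dist hc') -(line_dist hc); apply: le_trans (metric_triangle _ (c 0) _) _.
  by apply: lerD => //; exact: metric_triangle.
rewrite subr0 sub0r normrN ger0_norm // in tri.
have [ss0|s0s] := lerP s s0; first by lra.
have [t [p [t0 pN hp]]] := unb (s + 2 * B).
have fl := ler_norm (f 0).
have fp : f t = p := near_param_uniq hm hc (hf t) hp.
have [u u01 fu] : exists2 u, u \in `[0, t] & f u = s.
  apply: IVT => //; first exact: continuous_subspaceT.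
  by rewrite ge_min le_max fp; apply/andP; split; apply/orP; [left|right];
    rewrite /s0 in s0s; lra.
rewrite in_itv /= in u01; have /andP[u0 u1] := u01.
have hu := hf u; rewrite fu in hu.
have a1 : `|f 0 - s| = s - f 0 by rewrite distrC ger0_norm //; rewrite /s0 in s0s; lra.
have a2 : `|s - p| = p - s by rewrite distrC ger0_norm //; lra.
have h1 := cB _ _ _ _ (hf 0) hu; rewrite a1 in h1.
have h2 := cB _ _ _ _ hu hp; rewrite a2 in h2.
rewrite (line_dist hc') sub0r normrN ger0_norm // in h1.
rewrite (line_dist hc') distrC ger0_norm ?subr_ge0 // in h2.
have {}h1 := h1 ltac:(rewrite /s0 in s0s; lra).
have {}h2 := h2 ltac:(lra).
have := metric_triangle (c' 0) (c (f 0)) (c' t).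
have := metric_triangle (c (f 0)) (c p) (c' t).
rewrite (line_dist hc') (line_dist hc) sub0r normrN (ger0_norm t0).
rewrite (_ : `|f 0 - p| = p - f 0); last first.
  by rewrite distrC ger0_norm //; rewrite /s0 in s0s; lra.
rewrite (metric_sym (c p)) => k1 k2.
have near_u : mdist (c' u) (c s) <= B by lra.
have t1 := metric_triangle (c' 0) (c 0) (c s).
have t2 := metric_triangle (c' 0) (c s) (c' u).
have t3 := metric_triangle (c 0) (c' 0) (c s).
have t4 := metric_triangle (c' 0) (c' u) (c s).
rewrite (metric_sym (c 0) (c' 0)) -/D in t3.
rewrite (line_dist hc') sub0r normrN (ger0_norm u0) in t4.
rewrite (line_dist hc') sub0r normrN (ger0_norm u0) in t2.
rewrite (line_dist hc) sub0r normrN (ger0_norm sge0) -/D in t1.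
rewrite (line_dist hc) sub0r normrN (ger0_norm sge0) in t3.
rewrite (metric_sym (c s)) in t2.
have := metric_triangle (c' s) (c' u) (c s); rewrite (line_dist hc').
have : `|s - u| <= D + B by rewrite ler_norml; apply/andP; lra.
rewrite /s0; lra.
Qed.

Lemma asymptotic_sym (r r' : R -> X) : asymptotic r r' -> asymptotic r' r.
Proof. by move=> [K h]; exists K => t t0; rewrite metric_sym; exact: h. Qed.

Lemma asymptotic_trans (r1 r2 r3 : R -> X) :
  asymptotic r1 r2 -> asymptotic r2 r3 -> asymptotic r1 r3.
Proof.
move=> [K h] [K' h']; exists (K + K') => t t0.
by apply: le_trans (metric_triangle _ (r2 t) _) _; rewrite lerD ?h ?h'.
Qed.

Lemma boundary_point_eq (r r' : R -> X) :
  asymptotic r r' -> boundary_point r = boundary_point r'.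
Proof.
move=> a; apply/seteqP; split=> r2 [ray as2]; split=> //.
  exact: asymptotic_trans (asymptotic_sym a) as2.
exact: asymptotic_trans a as2.
Qed.

Lemma independent_not_asymptotic f f' c c' : independent_rank_one f f' ->
  rank_one_axis f c -> rank_one_axis f' c' ->
  [/\ ~ asymptotic c' c, ~ asymptotic c' (fun t => c (- t)),
      ~ asymptotic (fun t => c' (- t)) c &
      ~ asymptotic (fun t => c' (- t)) (fun t => c (- t))].
Proof.
move=> [_ _ disj] ax ax'.
have no xi : fixed_endpoints f xi -> fixed_endpoints f' xi -> False.
  move=> h h'; have : (fixed_endpoints f `&` fixed_endpoints f') xi by [].
  by rewrite disj.
split=> /boundary_point_eq e.
- apply: (no (boundary_point c)); first by exists c; split=> //; left.
  by exists c'; split=> //; left; rewrite e.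
- apply: (no (boundary_point (fun t => c (- t)))); first by exists c; split=> //; right.
  by exists c'; split=> //; left; rewrite e.
- apply: (no (boundary_point c)); first by exists c; split=> //; left.
  by exists c'; split=> //; right; rewrite e.
apply: (no (boundary_point (fun t => c (- t)))); first by exists c; split=> //; right.
by exists c'; split=> //; right; rewrite e.
Qed.

Lemma bounded_projection f f' c c' B : independent_rank_one f f' ->
  rank_one_axis f c -> rank_one_axis f' c' -> contracting c B -> 0 < B ->
  exists K, forall t p, near_param c (c' t) p -> `|p| <= K.
Proof.
move=> ind ax ax' cB B0.
have [hc _ _] := ax; have [hc' _ _] := ax'.
have [n1 n2 n3 n4] := independent_not_asymptotic ind ax ax'.
have bnd (d d' : R -> X) : geodesic_line d -> geodesic_line d' -> contracting d B ->
    ~ asymptotic d' d -> exists N, forall t p, 0 <= t -> near_param d (d' t) p -> p <= N.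
  move=> hd hd' dB na; apply: contrapT => H; apply: na.
  apply: (asymptotic_of_unbounded hd hd' dB B0) => N.
  apply: contrapT => H'; apply: H; exists N => t p t0 hp.
  by rewrite leNgt; apply/negP => h; apply: H'; exists t, p; rewrite (ltW h).
have ho := geodesic_line_opp hc; have ho' := geodesic_line_opp hc'.
have cBo := contracting_opp cB.
have [N1 h1] := bnd _ _ hc hc' cB n1; have [N2 h2] := bnd _ _ ho hc' cBo n2.
have [N3 h3] := bnd _ _ hc ho' cB n3; have [N4 h4] := bnd _ _ ho ho' cBo n4.
exists (`|N1| + `|N2| + `|N3| + `|N4|) => t p hp.
have := ler_norm N1; have := ler_norm N2; have := ler_norm N3; have := ler_norm N4.
have : 0 <= `|N1| by []. have : 0 <= `|N2| by []. have : 0 <= `|N3| by [].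
have : 0 <= `|N4| by [].
move=> *; rewrite ler_norml; case: (lerP 0 t) => t0.
  have b1 := h1 t p t0 hp; have b2 := h2 t (- p) t0 (near_param_opp hp).
  by apply/andP; lra.
have t0' : 0 <= - t by lra.
have b3 := h3 (- t) p t0'; have b4 := h4 (- t) (- p) t0'.
rewrite /= opprK in b3 b4.
have {}b3 := b3 hp; have {}b4 := b4 (near_param_opp hp).
by apply/andP; lra.
Qed.

(** If [x] projects to [c] far away from [c'], every geodesic from [x] to [c'] passes
    near the projection of [x] to [c], so that [x] and this point of [c] have
    almost the same projection to [c']. *)
Lemma behrstock c c' B B' K x p s : geodesic_line c -> geodesic_line c' ->
  contracting c B -> contracting c' B' -> 0 < B -> 0 < B' -> 0 <= K ->
  (forall t q, near_param c (c' t) q -> `|q| <= K) ->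
  (forall t q, near_param c' (c t) q -> `|q| <= K) ->
  near_param c x p -> K + B < `|p| -> near_param c' x s -> `|s| <= K + B + B'.
Proof.
move=> hc hc' cB cB' B0 B0' K0 bK bK' hp far hs.
have [q hq] := near_param_exists (c' s) hc.
have [r hr] := near_param_exists (c p) hc'.
have qK := bK _ _ hq; have rK := bK' _ _ hr.
have pq : B <= `|p - q| by have := lerB_dist p q; lra.
have h1 := cB _ _ _ _ hp hq pq.
have t1 := metric_triangle (c p) (c q) (c' s).
rewrite (line_dist hc) (metric_sym (c q)) in t1.
have t2 := metric_triangle x (c p) (c' r).
have h2 := hs r.
have sr : `|s - r| <= B + B'.
  case: (lerP B' `|r - s|) => [sr|]; last by rewrite distrC; lra.
  have h3 := cB' _ _ _ _ hr (near_param_line s hc') sr.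
  by rewrite mdistxx addr0 in h3; rewrite distrC; lra.
have := ler_distD 0 s r; rewrite distrC.
have : `|s| <= `|s - r| + `|r| by rewrite -{1}(subrK r s) ler_normD.
lra.
Qed.

Lemma geo_isometry f x y l : (forall a b, mdist (f a) (f b) = mdist a b) ->
  0 <= l <= 1 -> f (m x y l) = m (f x) (f y) l.
Proof.
move=> iso l01; apply: (geo_uniq hm) => //; rewrite !iso.
  by rewrite (geo_dist_left hm).
by rewrite (geo_dist_right hm).
Qed.

Lemma iter_isometry f n : (forall a b, mdist (f a) (f b) = mdist a b) ->
  forall a b, mdist (iter n f a) (iter n f b) = mdist a b.
Proof. by move=> iso; elim: n => //= n IH a b; rewrite iso IH. Qed.

Lemma iter_cancel (T : Type) (f f' : T -> T) n :
  cancel f f' -> cancel (iter n f) (iter n f').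
Proof. by move=> fK; elim: n => // n IH x; rewrite iterSr iterS fK IH. Qed.

Lemma iter_translation f c l n t : (forall t, f (c t) = c (t + l)) ->
  iter n f (c t) = c (t + n%:R * l).
Proof.
move=> tr; elim: n => [|n IH] /=; first by rewrite mul0r addr0.
by rewrite IH tr; congr c; rewrite -natr1; ring.
Qed.

Lemma near_param_translate f c l x s : (forall a b, mdist (f a) (f b) = mdist a b) ->
  (forall t, f (c t) = c (t + l)) -> near_param c x s -> near_param c (f x) (s + l).
Proof.
move=> iso tr h t; rewrite -tr iso -(subrK l t) -tr iso; exact: h.
Qed.

(** The axes of the conjugates of [g] by the powers of [h ^ M] have distant
    projections to the axis of [h], so by the Behrstock inequality a point
    projects far from the origin of at most one of these axes.  For the other
    axes both [x] and [y] project near the origin, and the large power of [g]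
    separates the projections so much that the geodesic visits the axis near
    the origin. *)
Lemma connecting_elements (g h h' : X -> X) (cg ch : R -> X) (o : X)
    (lg lh Bg Bh K : R) :
  (forall a b, mdist (g a) (g b) = mdist a b) ->
  (forall a b, mdist (h a) (h b) = mdist a b) ->
  cancel h h' -> cancel h' h ->
  geodesic_line cg -> geodesic_line ch ->
  (forall t, g (cg t) = cg (t + lg)) -> (forall t, h (ch t) = ch (t + lh)) ->
  0 < lg -> 0 < lh -> contracting cg Bg -> contracting ch Bh ->
  0 < Bg -> 0 < Bh -> 0 <= K ->
  (forall t q, near_param cg (ch t) q -> `|q| <= K) ->
  (forall t q, near_param ch (cg t) q -> `|q| <= K) ->
  exists M0, forall M N, (M0 <= M)%N -> (M0 <= N)%N ->
  exists C (bad : X -> nat), forall x y k, (k < 5)%N -> k <> bad x -> k <> bad y ->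
  exists2 l, 0 <= l <= 1 &
    mdist o (m x (iter (M * k) h (iter N g (iter (M * k) h' y))) l) <= C.
Proof.
move=> isog isoh hK hK' hcg hch trg trh lg0 lh0 cBg cBh Bg0 Bh0 K0 bg bh.
pose E := K + Bg; pose E' := K + Bg + Bh.
(* [E] bounds the projections of good points to [cg], and [E'] those of bad
   points to [ch]. *)
pose M0 := (Num.bound (2 * E' / lh) + Num.bound ((2 * E + 2 * Bg) / lg))%N.
have M0h M : (M0 <= M)%N -> 2 * E' < M%:R * lh.
  move=> MM; rewrite -ltr_pdivrMr //.
  have /archi_boundP b : 0 <= 2 * E' / lh.
    by apply: divr_ge0; rewrite /E'; lra.
  by apply: lt_le_trans b _; rewrite ler_nat; apply: leq_trans MM; exact: leq_addr.
have M0g N : (M0 <= N)%N -> 2 * E + 2 * Bg < N%:R * lg.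
  move=> MM; rewrite -ltr_pdivrMr //.
  have /archi_boundP b : 0 <= (2 * E + 2 * Bg) / lg.
    by apply: divr_ge0; rewrite /E; lra.
  by apply: lt_le_trans b _; rewrite ler_nat; apply: leq_trans MM; exact: leq_addl.
exists M0 => M N /M0h hM /M0g hN.
pose H k := iter (M * k) h; pose H' k := iter (M * k) h'.
have isoh' a b : mdist (h' a) (h' b) = mdist a b by rewrite -isoh !hK'.
have HK k : cancel (H' k) (H k) by exact: iter_cancel.
have isoH k : forall a b, mdist (H k a) (H k b) = mdist a b by exact: iter_isometry.
have isoH' k : forall a b, mdist (H' k a) (H' k b) = mdist a b by exact: iter_isometry.
have trH' k t : H' k (ch t) = ch (t + - ((M * k)%:R * lh)).
  have -> : ch t = H k (ch (t - (M * k)%:R * lh)).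
    by rewrite /H (iter_translation _ _ trh) subrK.
  by rewrite /H' /H iter_cancel.
pose isbad k x := exists2 p, near_param cg (H' k x) p & E < `|p|.
have bad_close k x s : isbad k x -> near_param ch x s ->
    `|s - (M * k)%:R * lh| <= E'.
  move=> [p hp pE] hs.
  have hs' := near_param_translate (isoH' k) (trH' k) hs.
  exact: (behrstock hcg hch cBg cBh Bg0 Bh0 K0 bg bh hp pE hs').
have bad_uniq x k k' : isbad k x -> isbad k' x -> k = k'.
  have [s hs] := near_param_exists x hch.
  move=> /bad_close/(_ hs) h1 /bad_close/(_ hs) h2.
  apply/eqP; rewrite eqn_leq; apply/andP.
  move: h1 h2; rewrite !ler_norml !natrM => /andP[a1 a2] /andP[b1 b2].
  have Mlh : 0 < M%:R * lh by apply: le_lt_trans hM; rewrite /E'; lra.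
  split; rewrite leqNgt; apply/negP => kk;
  have : (k'.+1%:R : R) <= k%:R \/ (k.+1%:R : R) <= k'%:R by rewrite !ler_nat; auto.
    move=> [q|q].
      move/(ler_wpM2r (ltW Mlh)): q; rewrite -natr1; lra.
    by move: q; rewrite ler_nat => /(leq_trans (leqW kk)); rewrite ltnn.
  move=> [q|q].
    by move: q; rewrite ler_nat => /(leq_trans (leqW kk)); rewrite ltnn.
  move/(ler_wpM2r (ltW Mlh)): q; rewrite -natr1; lra.
have /choice[bad hbad] : forall x, exists b, forall k, isbad k x -> k = b.
  move=> x; have [[k hk]|none] := pselect (exists k, isbad k x).
    by exists k => k' hk'; exact: bad_uniq hk' hk.
  by exists 0%N => k hk; case: none; exists k.
exists (\sum_(k < 5) mdist o (H k (cg 0)) + (E + 2 * Bg)), bad.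
move=> x y k k5 kx ky; rewrite -/(H k) -/(H' k).
have [p hp] := near_param_exists (H' k x) hcg.
have [q hq] := near_param_exists (H' k y) hcg.
have pE : `|p| <= E.
  by rewrite leNgt; apply/negP => pE; apply: kx; apply: hbad; exists p.
have qE : `|q| <= E.
  by rewrite leNgt; apply/negP => qE; apply: ky; apply: hbad; exists q.
have hgq := near_param_translate (iter_isometry N isog)
  (fun t => iter_translation N t trg) hq.
have pq : 2 * Bg <= `|p - (q + N%:R * lg)|.
  rewrite distrC; apply: le_trans (ler_norm _).
  have := ler_norm p; have := ler_norm (- q); rewrite normrN; lra.
have [l [s [l01 hs sp hz]]] := contracting_visits hm hcg cBg hp hgq pq Bg0.
exists l => //.
have -> : m x (H k (iter N g (H' k y))) l = H k (m (H' k x) (iter N g (H' k y)) l).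
  by rewrite (geo_isometry _ _ (isoH k)) // HK.
apply: le_trans (metric_triangle _ (H k (cg 0)) _) _; apply: lerD.
  rewrite (bigD1 (Ordinal k5)) //= lerDl sumr_ge0 // => i _; exact: mdist_ge0.
rewrite isoH; apply: le_trans (metric_triangle _ (cg s) _) _.
rewrite (line_dist hcg) sub0r normrN (metric_sym (cg s)).
have : `|s| <= `|s - p| + `|p| by rewrite -{1}(subrK p s) ler_normD.
lra.
Qed.

End Projections.

(** * Connecting elements of the group *)

Section Axes.
Context {R : realType} {X : metricType R}.

Lemma isometry_inverse (f : X -> X) : Defs.isometry f ->
  exists f', [/\ cancel f f', cancel f' f &
                 forall x y, mdist (f' x) (f' y) = mdist x y].
Proof.
move=> [iso surj]; have /choice[f' ff'] := surj.
exists f'; split => // [x|x y]; last by rewrite -iso !ff'.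
by apply: mdist_positivity; rewrite -iso ff' mdistxx.
Qed.

Lemma axis_periodic (f : X -> X) c : Defs.isometry f -> rank_one_axis f c ->
  periodic_line c.
Proof.
move=> isof [hc [l [l0 tr]] _]; split=> //; exists l => t0.
have [f' [fK f'K iso']] := isometry_inverse isof.
have tr' t : f' (c t) = c (t + - l) by rewrite -{1}(subrK l t) -tr fK.
pose z := Num.floor (t0 / l).
have /andP[z1 z2] : z%:~R <= t0 / l < z%:~R + 1.
  by rewrite ge_floor /= -intrD1 floorD1_gt.
rewrite ler_pdivlMr // in z1; rewrite ltr_pdivrMr // in z2.
have rem : `|t0 - z%:~R * l| <= l by rewrite ler_norml; apply/andP; lra.
case: (intP z) z1 z2 rem => [|n|n] _ _ rem.
- exists id; split => //; exists t0; split => //.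
  by move: rem; rewrite mul0r subr0.
- exists (iter n.+1 f'); split; first exact: iter_isometry.
  exists (t0 - n.+1%:R * l); split => // t.
  by rewrite (iter_translation _ _ tr'); congr c; ring.
exists (iter n.+1 f); split; first exact: iter_isometry isof.1.
exists (t0 + n.+1%:R * l); split.
  by move: rem; rewrite mulrNz mulNr opprK.
by move=> t; rewrite (iter_translation _ _ tr); congr c; ring.
Qed.

Variable m : X -> X -> R -> X.
Hypothesis hm : stewart m.
Hypothesis pX : proper_space X.

Lemma independent_connecting_elements (g h h' : X -> X) (o : X) :
  independent_rank_one g h -> cancel h h' -> cancel h' h ->
  exists M0, forall M N, (M0 <= M)%N -> (M0 <= N)%N ->
  exists (C : R) (bad : X -> nat), forall x y k,
  (k < 5)%N -> k <> bad x -> k <> bad y ->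
  exists2 l, 0 <= l <= 1 &
    mdist o (m x (iter (M * k) h (iter N g (iter (M * k) h' y))) l) <= C.
Proof.
move=> ind hK hK'; have [[isog [cg axg]] [isoh [ch axh]] disj] := ind.
have ind' : independent_rank_one h g.
  by split; [split=> //; exists ch | split=> //; exists cg | rewrite setIC].
have [hcg [lg [lg0 trg]] nfg] := axg; have [hch [lh [lh0 trh]] nfh] := axh.
have [Bg Bg0 cBg] := rank_one_contracting hm pX (axis_periodic isog axg) nfg.
have [Bh Bh0 cBh] := rank_one_contracting hm pX (axis_periodic isoh axh) nfh.
have [K1 hK1] := bounded_projection hm ind axg axh cBg Bg0.
have [K2 hK2] := bounded_projection hm ind' axh axg cBh Bh0.
apply: (@connecting_elements _ _ m hm g h h' cg ch o lg lh Bg Bh (`|K1| + `|K2|)) => //.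
- exact: isog.1.
- exact: isoh.1.
- by move=> t q /hK1/le_trans; apply; rewrite ler_wpDr // ler_norm.
by move=> t q /hK2/le_trans; apply; rewrite ler_wpDl // ler_norm.
Qed.

End Axes.

(** Each of the two points has at most one bad index in each of the two factors. *)
Lemma fifth_choice (a b c d : nat) : exists k, [/\ (k < 5)%N,
  k <> a, k <> b, k <> c & k <> d].
Proof.
have [k k5 kn] : exists2 k, (k < 5)%N & k \notin [:: a; b; c; d].
  apply: contrapT => H.
  suff /(uniq_leq_size (iota_uniq 0 5)) : {subset iota 0 5 <= [:: a; b; c; d]} by [].
  move=> k; rewrite mem_iota add0n => /andP[_ k5].
  by apply: contrapT => /negP kn; apply: H; exists k.
exists k; move: kn; rewrite !inE !negb_or => /and4P[/eqP ? /eqP ? /eqP ? /eqP ?].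
by split.
Qed.

Section ProductMap.
Context {R : realType} {X1 X2 : metricType R}.
Local Notation E := ((X1 -> X1) * (X2 -> X2))%type.
Implicit Types (g h : E).

Definition mulE g h : E := (g.1 \o h.1, g.2 \o h.2).
Definition expE g n : E := iter n (mulE g) (id, id).

Lemma expE_fst g n x : (expE g n).1 x = iter n g.1 x.
Proof. by elim: n => //= n IH; rewrite IH. Qed.

Lemma expE_snd g n x : (expE g n).2 x = iter n g.2 x.
Proof. by elim: n => //= n IH; rewrite IH. Qed.

Variable G : set E.
Hypothesis hG : isometry_group G.

Lemma mulE_closed g h : G g -> G h -> G (mulE g h).
Proof. by case: hG => _ _ + _; apply. Qed.

Lemma expE_closed g n : G g -> G (expE g n).
Proof. by move=> Gg; elim: n => [|n IH]; [case: hG | exact: mulE_closed]. Qed.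

Variables (m1 : X1 -> X1 -> R -> X1) (m2 : X2 -> X2 -> R -> X2).
Hypotheses (hm1 : stewart m1) (hm2 : stewart m2).
Hypotheses (pX1 : proper_space X1) (pX2 : proper_space X2).

(** Five connecting elements are enough to serve both factors at once, since the
    two points exclude at most four of them. *)
Lemma group_connecting_elements (o : X1 * X2) :
  (exists g h, [/\ G g, G h, independent_rank_one g.1 h.1 &
                   independent_rank_one g.2 h.2]) ->
  exists (al : nat -> E) (C : R), (forall k, G (al k)) /\
  forall x y : X1 * X2, exists k, [/\ (k < 5)%N,
    exists2 l, 0 <= l <= 1 & mdist o.1 (m1 x.1 ((al k).1 y.1) l) <= C &
    exists2 l, 0 <= l <= 1 & mdist o.2 (m2 x.2 ((al k).2 y.2) l) <= C].
Proof.
move=> [g [h [Gg Gh ind1 ind2]]].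
have [_ _ _ /(_ h Gh)[h' [Gh' h1 h1' h2 h2']]] := hG.
have [M1 hM1] := independent_connecting_elements hm1 pX1 o.1 ind1 h1 h1'.
have [M2 hM2] := independent_connecting_elements hm2 pX2 o.2 ind2 h2 h2'.
pose M := (M1 + M2)%N.
have [C1 [b1 hb1]] := hM1 M M (leq_addr _ _) (leq_addr _ _).
have [C2 [b2 hb2]] := hM2 M M (leq_addl _ _) (leq_addl _ _).
exists (fun k => mulE (expE h (M * k)) (mulE (expE g M) (expE h' (M * k)))).
exists (`|C1| + `|C2|); split=> [k|x y].
  by apply: mulE_closed; [exact: expE_closed | apply: mulE_closed; exact: expE_closed].
have [k [k5 k1 k2 k3 k4]] := fifth_choice (b1 x.1) (b1 y.1) (b2 x.2) (b2 y.2).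
exists k; split => //=.
  have [l l01 hl] := hb1 x.1 y.1 k k5 k1 k2; exists l => //.
  rewrite !expE_fst; apply: le_trans hl _.
  by rewrite ler_wpDr // ler_norm.
have [l l01 hl] := hb2 x.2 y.2 k k5 k3 k4; exists l => //.
rewrite !expE_snd; apply: le_trans hl _.
by rewrite ler_wpDl // ler_norm.
Qed.

End ProductMap.

(** * The product map *)

Lemma sqr_sum_le (R : realType) (x y z : R) : 0 <= x -> 0 <= y -> x + y <= z ->
  x ^+ 2 + y ^+ 2 <= z ^+ 2.
Proof. by move=> *; nra. Qed.

Section Factor.
Context {R : realType} {X : metricType R} (m : X -> X -> R -> X).
Hypothesis hm : stewart m.

(** Translate by [g] the geodesic from [gi o] that passes near [o]. *)
Lemma product_near_geodesic (o : X) (g gi : X -> X) p l C :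
  (forall x y, mdist (g x) (g y) = mdist x y) -> cancel gi g -> 0 <= l <= 1 ->
  mdist o (m (gi o) p l) <= C -> mdist (g o) (m o (g p) l) <= C.
Proof.
by move=> iso giK l01 h; rewrite -{2}(giK o) -(geo_isometry hm _ _ iso l01) iso.
Qed.

Lemma product_displacement (o : X) (g a h : X -> X) l C :
  (forall x y, mdist (g x) (g y) = mdist x y) ->
  (forall x y, mdist (a x) (a y) = mdist x y) -> 0 <= l <= 1 ->
  mdist (g o) (m o (g (a (h o))) l) <= C ->
  `|mdist o (g (a (h o))) - (mdist o (g o) + mdist o (h o))|
    <= 2 * C + mdist o (a o).
Proof.
move=> isog isoa l01 hC; set p := g (a (h o)) in hC *; set z := m o p l in hC.
have e : mdist o p = mdist o z + mdist z p.
  by rewrite (geo_dist_left hm) // (geo_dist_right hm) //; ring.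
have e1 : mdist (g o) p = mdist o (a (h o)) by rewrite isog.
have e2 : mdist (a o) (a (h o)) = mdist o (h o) by rewrite isoa.
have := metric_triangle o (g o) z; have := metric_triangle o z (g o).
have := metric_triangle (g o) z p; have := metric_triangle z (g o) p.
have := metric_triangle o (a o) (a (h o)).
have := metric_triangle (a o) o (a (h o)).
rewrite e1 e2 e (metric_sym z (g o)) (metric_sym (a o) o) => *.
by rewrite ler_norml; apply/andP; lra.
Qed.

(** A point near a geodesic issued from [o] is determined, up to a bounded error,
    by its distance to [o]. *)
Lemma same_geodesic_close (o p x y : X) l l' C : 0 <= l <= 1 -> 0 <= l' <= 1 ->
  mdist x (m o p l) <= C -> mdist y (m o p l') <= C ->
  `|mdist o x - mdist o y| <= 1 -> mdist x y <= 4 * C + 1.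
Proof.
move=> l01 l01' hx hy; set z := m o p l in hx; set z' := m o p l' in hy.
rewrite ler_norml => /andP[h1 h2].
have zz : mdist z z' <= 2 * C + 1.
  rewrite (geo_dist hm) // -{1}(ger0_norm (mdist_ge0 o p)) -normrM mulrBl.
  rewrite -!(geo_dist_left hm) // -/z -/z'.
  have := metric_triangle o x z; have := metric_triangle o z x.
  have := metric_triangle o y z'; have := metric_triangle o z' y.
  rewrite (metric_sym z x) (metric_sym z' y) => *.
  by rewrite ler_norml; apply/andP; lra.
have := metric_triangle x z y; have := metric_triangle z z' y.
rewrite (metric_sym z' y); lra.
Qed.

End Factor.

(** Fix for every product one factorization [base c] of it.  A pair is determined
    by its product, by the difference between its first factor and that of the
    fixed factorization, and by its label. *)
Lemma card_product_le (K L : choiceType) (S T : {fset K}) (F : {fset K})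
    (P : {fset L}) (Phi dif : K -> K -> K) (lab : K -> K -> L) :
  (forall g h, lab g h \in P) ->
  (forall g g' h h', g \in S -> g' \in S -> h \in T -> h' \in T ->
     Phi g h = Phi g' h' -> dif g g' \in F) ->
  (forall a g g', a \in S -> g \in S -> g' \in S ->
     dif a g = dif a g' -> g = g') ->
  (forall g h h', g \in S -> h \in T -> h' \in T -> lab g h = lab g h' ->
     Phi g h = Phi g h' -> h = h') ->
  (#|` S| * #|` T| <= #|` F| * #|` P| * #|` [fset Phi g h | g in S, h in T]%fset|)%N.
Proof.
move=> labP difF difI labI.
have /choice[base hb] : forall c : K, exists a : K,
    (exists g h, [/\ g \in S, h \in T & Phi g h = c]) ->
    a \in S /\ exists2 h, h \in T & Phi a h = c.
  move=> c; have [[g [h [gS hT e]]]|no] := pselect (exists g h,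
    [/\ g \in S, h \in T & Phi g h = c]).
    by exists g => _; split=> //; exists h.
  by exists c.
pose im := [fset Phi g h | g in S, h in T]%fset.
pose code (p : K * K) := (dif (base (Phi p.1 p.2)) p.1, lab p.1 p.2, Phi p.1 p.2).
pose s := [seq (g, h) | g <- enum_fset S, h <- enum_fset T].
pose t := [seq (a, b) | a <- [seq (x, y) | x <- enum_fset F, y <- enum_fset P],
                        b <- enum_fset im].
have memP p : p \in s -> p.1 \in S /\ p.2 \in T.
  by case/allpairsP => -[g h] /= [gS hT ->].
have bP g h : g \in S -> h \in T -> base (Phi g h) \in S /\
    exists2 h0, h0 \in T & Phi (base (Phi g h)) h0 = Phi g h.
  by move=> gS hT; apply: hb; exists g, h.
have inj : {in s &, injective code}.
  move=> [g h] [g' h'] /memP[/= gS hT] /memP[/= g'S h'T].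
  rewrite /code /= => -[e1 e2 e3].
  have [bS _] := bP g h gS hT.
  rewrite -e3 in e1.
  have gg : g = g' by exact: difI bS gS g'S e1.
  by rewrite -gg in e2 e3 *; rewrite (labI _ _ _ gS hT h'T e2 e3).
have us : uniq s by apply: allpairs_uniq => // -[? ?] [? ?].
have := uniq_leq_size (s1 := map code s) (s2 := t).
rewrite map_inj_in_uniq // => /(_ us).
rewrite size_map !size_allpairs; apply.
move=> c /mapP[[g h] /memP[/= gS hT] ->].
have [bS [h0 h0T e]] := bP g h gS hT.
apply/allpairsP; exists ((dif (base (Phi g h)) g, lab g h), Phi g h).
split=> //=; last by apply/imfset2P; exists g => //; exists h.
apply/allpairsP; exists (dif (base (Phi g h)) g, lab g h).
by split=> //=; exact: (difF _ _ h0 h).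
Qed.

Section ProductMapTheorem.
Context {R : realType} {X1 X2 : metricType R}.
Local Notation E := ((X1 -> X1) * (X2 -> X2))%type.
Variable G : set E.
Hypothesis hG : isometry_group G.
Variables (m1 : X1 -> X1 -> R -> X1) (m2 : X2 -> X2 -> R -> X2).
Hypotheses (hm1 : stewart m1) (hm2 : stewart m2).
Hypotheses (pX1 : proper_space X1) (pX2 : proper_space X2).
Variable o : X1 * X2.

Definition disp1 (g : E) : R := mdist o.1 (g.1 o.1).
Definition disp2 (g : E) : R := mdist o.2 (g.2 o.2).

(** The product of [g] and [h] is [g a h] with a connecting element [a] that suits
    the two points [g^-1 o] and [h o].  The geodesics from [o] to the image of [o]
    then pass near [g o], which makes displacements almost additive and, for
    first factors with almost equal displacements, bounds the number of pairs
    with a given product. *)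
Theorem product_map : acts_properly G ->
  (exists g h, [/\ G g, G h, independent_rank_one g.1 h.1 &
                   independent_rank_one g.2 h.2]) ->
  exists (Phi : E -> E -> E) (C : R) (N : nat), [/\
    forall g h, G g -> G h -> [/\ G (Phi g h),
      `|disp1 (Phi g h) - (disp1 g + disp1 h)| <= C &
      `|disp2 (Phi g h) - (disp2 g + disp2 h)| <= C] &
    forall S T : {fset E}, (forall g, g \in S -> G g) ->
      (forall h, h \in T -> G h) ->
      (forall g g', g \in S -> g' \in S ->
        `|disp1 g - disp1 g'| <= 1 /\ `|disp2 g - disp2 g'| <= 1) ->
      (#|` S| * #|` T| <= N * #|` [fset Phi g h | g in S, h in T]%fset|)%N].
Proof.
move=> pG /(group_connecting_elements hG hm1 hm2 pX1 pX2 o)[al [C [Gal hal]]].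
have [isoG _ mul_cl invG] := hG.
have /choice[inv hinv] : forall g, exists gi, G g -> [/\ G gi, cancel g.1 gi.1,
    cancel gi.1 g.1, cancel g.2 gi.2 & cancel gi.2 g.2].
  move=> g; have [Gg|nG] := pselect (G g); last by exists g.
  by have [gi h] := invG g Gg; exists gi.
have /choice[k hk] : forall gh : E * E, exists k, [/\ (k < 5)%N,
    exists2 l, 0 <= l <= 1 &
      mdist o.1 (m1 ((inv gh.1).1 o.1) ((al k).1 (gh.2.1 o.1)) l) <= C &
    exists2 l, 0 <= l <= 1 &
      mdist o.2 (m2 ((inv gh.1).2 o.2) ((al k).2 (gh.2.2 o.2)) l) <= C].
  by move=> [g h]; exact: (hal ((inv g).1 o.1, (inv g).2 o.2) (h.1 o.1, h.2 o.2)).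
pose Phi g h := mulE g (mulE (al (k (g, h))) h).
have geo1P g h : G g -> exists2 l, 0 <= l <= 1 &
    mdist (g.1 o.1) (m1 o.1 ((Phi g h).1 o.1) l) <= C.
  move=> Gg; have [_ [l l01 hl] _] := hk (g, h); exists l => //.
  have [_ _ gK _ _] := hinv g Gg; have [[iso _] _] := isoG g Gg.
  exact: (product_near_geodesic hm1 iso gK l01 hl).
have geo2P g h : G g -> exists2 l, 0 <= l <= 1 &
    mdist (g.2 o.2) (m2 o.2 ((Phi g h).2 o.2) l) <= C.
  move=> Gg; have [_ _ [l l01 hl]] := hk (g, h); exists l => //.
  have [_ _ _ _ gK] := hinv g Gg; have [_ [iso _]] := isoG g Gg.
  exact: (product_near_geodesic hm2 iso gK l01 hl).
pose A1 := \sum_(i < 5) disp1 (al i); pose A2 := \sum_(i < 5) disp2 (al i).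
have A1P g h : disp1 (al (k (g, h))) <= A1.
  have [k5 _ _] := hk (g, h).
  by rewrite /A1 (bigD1 (Ordinal k5)) //= lerDl sumr_ge0 // => i _; exact: mdist_ge0.
have A2P g h : disp2 (al (k (g, h))) <= A2.
  have [k5 _ _] := hk (g, h).
  by rewrite /A2 (bigD1 (Ordinal k5)) //= lerDl sumr_ge0 // => i _; exact: mdist_ge0.
have A10 : 0 <= A1 by apply: sumr_ge0 => i _; exact: mdist_ge0.
have A20 : 0 <= A2 by apply: sumr_ge0 => i _; exact: mdist_ge0.
pose r : R := 2 * (4 * `|C| + 1).
have r0 : 0 < r by rewrite /r; have : 0 <= `|C| by []; lra.
pose F := fset_set [set g | G g /\ prod_dist o (pact g o) <= r].
pose P := fset_set [set i | (i < 5)%N].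
exists Phi, (2 * `|C| + A1 + A2), (#|` F| * #|` P|)%N; split.
  move=> g h Gg Gh; have Gal' := Gal (k (g, h)).
  have [[iso1 _] [iso2 _]] := isoG g Gg.
  have [[isoa1 _] [isoa2 _]] := isoG _ Gal'.
  have CC := ler_norm C.
  split; first exact: (mul_cl _ _ Gg (mul_cl _ _ Gal' Gh)).
    have [l l01 hl] := geo1P g h Gg; have := A1P g h; rewrite /disp1.
    by have := product_displacement hm1 iso1 isoa1 l01 hl; rewrite /Phi /=; lra.
  have [l l01 hl] := geo2P g h Gg; have := A2P g h; rewrite /disp2.
  by have := product_displacement hm2 iso2 isoa2 l01 hl; rewrite /Phi /=; lra.
move=> S T SG TG box.
have gL g a b : G g -> mulE g a = mulE g b -> a = b.
  move=> Gg [e1 e2]; have [_ c1 _ c2 _] := hinv g Gg.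
  case: a e1 e2 => a1 a2; case: b => b1 b2 /= e1 e2; congr (_, _).
    apply/funext => x; apply: (can_inj c1).
    exact: (congr1 (fun f : X1 -> X1 => f x) e1).
  apply/funext => x; apply: (can_inj c2).
  exact: (congr1 (fun f : X2 -> X2 => f x) e2).
apply: (@card_product_le _ _ S T F P Phi (fun a g => mulE (inv a) g)
  (fun g h => k (g, h))).
- move=> g h; rewrite in_fset_set ?inE; last exact: finite_II.
  by have [] := hk (g, h).
- move=> g g' h h' gS g'S hT h'T e; rewrite in_fset_set; last exact: pG.
  rewrite inE /=; have Gg := SG _ gS; have Gg' := SG _ g'S.
  have [Ginv c1 _ c2 _] := hinv g Gg.
  split; first exact: mul_cl.
  have [l1 l101 hl1] := geo1P g h Gg; have [l2 l201 hl2] := geo1P g' h' Gg'.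
  have [l3 l301 hl3] := geo2P g h Gg; have [l4 l401 hl4] := geo2P g' h' Gg'.
  rewrite -e in hl2 hl4; have [b1 b2] := box g g' gS g'S.
  have q1 := same_geodesic_close hm1 l101 l201 hl1 hl2 b1.
  have q2 := same_geodesic_close hm2 l301 l401 hl3 hl4 b2.
  have [[iso1 _] [iso2 _]] := isoG _ Ginv.
  rewrite -iso1 c1 in q1; rewrite -iso2 c2 in q2.
  rewrite /prod_dist /pact /=; apply: ler_sqr_nneg; first exact: ltW.
  rewrite sqr_sqrtr; last by rewrite addr_ge0 // sqr_ge0.
  apply: sqr_sum_le; try exact: mdist_ge0.
  by rewrite /r; have := ler_norm C; lra.
- move=> a g g' aS _ _; apply: gL.
  by have [] := hinv a (SG _ aS).
move=> g h h' gS hT h'T e; rewrite /Phi -e => /(gL _ _ _ (SG _ gS)).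
exact: gL.
Qed.

End ProductMapTheorem.

(** * Slopes of plane vectors and upper limits *)

Section Trigonometry.
Context {R : realType}.
Implicit Types (s t x : R).

Lemma mvt_lipschitz (f df : R -> R) s t : (forall x, is_derive x (1 : R) f (df x)) ->
  (forall x, `|df x| <= 1) -> `|f s - f t| <= `|s - t|.
Proof.
move=> fdf df1.
have fc : continuous f.
  by move=> x; apply: differentiable_continuous; apply/derivable1_diffP; have [] := fdf x.
wlog ts : s t / t <= s.
  move=> H; have [|/ltW] := leP t s; first exact: H.
  by rewrite distrC (distrC s); exact: H.
have [x _ ->] := MVT_segment ts (fun x _ => fdf x) (continuous_subspaceT fc).
by rewrite normrM ler_piMl.
Qed.

Lemma cos_lipschitz s t : `|cos s - cos t| <= `|s - t|.
Proof.
apply: (@mvt_lipschitz cos (fun x => - sin x)) => x.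
by rewrite normrN ler_norml sin_geN1 sin_le1.
Qed.

Lemma sin_lipschitz s t : `|sin s - sin t| <= `|s - t|.
Proof.
apply: (@mvt_lipschitz sin cos) => x.
by rewrite ler_norml cos_geN1 cos_le1.
Qed.

Lemma sin_atanE x : sin (atan x) = x / Num.sqrt (1 + x ^+ 2).
Proof.
have c0 : cos (atan x) != 0.
  by rewrite cos_atan invr_eq0 sqrtr_eq0 -ltNge; have := sqr_ge0 x; lra.
by rewrite -cos_atan -{2}(atanK x) /tan divfK.
Qed.

Lemma atan_ge0 x : 0 <= x -> 0 <= atan x.
Proof. by rewrite -{2}(@atan0 R); exact: le_atan. Qed.

Lemma polar_coordinates (a b : R) : 0 <= a -> 0 <= b ->
  let s := if a == 0 then pi / 2 else atan (b / a) in
  [/\ 0 <= s <= pi / 2, a = Num.sqrt (a ^+ 2 + b ^+ 2) * cos s &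
      b = Num.sqrt (a ^+ 2 + b ^+ 2) * sin s].
Proof.
move=> a0 b0 s; rewrite /s; case: eqP => [->|/eqP an0].
  rewrite cos_pihalf sin_pihalf mulr0 mulr1 expr0n add0r sqrtr_sqr ger0_norm //.
  by split=> //; rewrite lexx andbT divr_ge0 // pi_ge0.
have ap : 0 < a by rewrite lt_neqAle eq_sym an0.
have x0 : 0 <= b / a by rewrite divr_ge0.
have q0 : 0 < 1 + (b / a) ^+ 2 by have := sqr_ge0 (b / a); lra.
have e : Num.sqrt (a ^+ 2 + b ^+ 2) = a * Num.sqrt (1 + (b / a) ^+ 2).
  have -> : a ^+ 2 + b ^+ 2 = a ^+ 2 * (1 + (b / a) ^+ 2) by field.
  by rewrite sqrtrM ?sqr_ge0 // sqrtr_sqr ger0_norm.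
have r0 : Num.sqrt (1 + (b / a) ^+ 2) != 0 by rewrite sqrtr_eq0 -ltNge.
split; first by rewrite atan_ge0 //= ltW // atan_ltpi2.
  by rewrite e cos_atan mulfK.
rewrite e sin_atanE; move: r0; set Q := Num.sqrt _ => r0.
by field; rewrite ?r0 ?an0.
Qed.

Lemma norm_le_of_sin (x d : R) : `|x| <= pi / 2 -> 0 < d <= pi / 2 ->
  `|sin x| < sin d -> `|x| <= d.
Proof.
rewrite ler_norml => /andP[x0 x1] /andP[d0 d1].
have dI : d \in `[- (pi / 2), pi / 2] by rewrite in_itv /=; apply/andP; lra.
have ndI : - d \in `[- (pi / 2), pi / 2] by rewrite in_itv /=; apply/andP; lra.
have xI : x \in `[- (pi / 2), pi / 2] by rewrite in_itv /=; apply/andP; lra.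
rewrite ltr_norml -sinN => /andP[].
rewrite (ltr_sin ndI xI) (ltr_sin xI dI) => /= h1 h2.
by rewrite ler_norml !ltW.
Qed.

Lemma scaled_norm_le (u v w : R) : `|u| <= w -> 0 <= v <= 1 -> `|u * v| <= w.
Proof.
move=> uw /andP[v0 v1]; apply: le_trans uw.
by rewrite normrM (ger0_norm v0) ler_piMr.
Qed.

(** [a * c + b * s] and [b * c - a * s] are the inner product and the determinant
    of [(a, b)] with the unit vector [(c, s)]. *)
Lemma near_unit_vector (a b r k c s : R) : 0 <= a -> 0 <= b -> 0 < r -> 0 < k ->
  0 <= c <= 1 -> 0 <= s <= 1 -> c ^+ 2 + s ^+ 2 = 1 ->
  `|a - r * c| <= k * r -> `|b - r * s| <= k * r ->
  [/\ r * (1 - 2 * k) <= a * c + b * s, `|b * c - a * s| <= 2 * (k * r) &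
      a ^+ 2 + b ^+ 2 <= (r * (1 + 2 * k)) ^+ 2].
Proof.
move=> a0 b0 r0 k0 c01 s01 cs ha hb.
have := scaled_norm_le ha c01; have := scaled_norm_le ha s01.
have := scaled_norm_le hb c01; have := scaled_norm_le hb s01.
move: ha hb; rewrite !ler_norml => /andP[? ?] /andP[? ?] /andP[? ?] /andP[? ?].
move=> /andP[? ?] /andP[? ?].
have rE : r = r * (c ^+ 2 + s ^+ 2) by rewrite cs mulr1.
split; [by lra | by apply/andP; lra |].
have /andP[c0 c1] := c01; have /andP[s0 s1] := s01.
have kr0 : 0 < k * r by rewrite mulr_gt0.
have a1 : a ^+ 2 <= (r * c + k * r) ^+ 2.
  have h : a <= r * c + k * r by lra.
  by rewrite ler_pXn2r // nnegrE (le_trans a0).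
have b1 : b ^+ 2 <= (r * s + k * r) ^+ 2.
  have h : b <= r * s + k * r by lra.
  by rewrite ler_pXn2r // nnegrE (le_trans b0).
apply: le_trans (lerD a1 b1) _.
have -> : (r * c + k * r) ^+ 2 + (r * s + k * r) ^+ 2 =
  r ^+ 2 * (c ^+ 2 + s ^+ 2) + 2 * k * r ^+ 2 * (c + s) + 2 * (k * r) ^+ 2 by ring.
rewrite cs mulr1.
have h : 2 * k * r ^+ 2 * (c + s) <= 2 * k * r ^+ 2 * 2.
  apply: ler_wpM2l; first by rewrite mulr_ge0 ?sqr_ge0 // mulr_ge0 // ltW.
  by move: c1 s1; lra.
by have := sqr_ge0 (k * r); lra.
Qed.

(** Bound the sine of the angle between the two vectors by their determinant. *)
Lemma slope_close (a b r k d t : R) : 0 <= a -> 0 <= b -> 0 < r ->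
  0 < k < 1 / 4 -> 0 < d <= pi / 2 -> 2 * k < sin d * (1 - 2 * k) ->
  0 <= t <= pi / 2 -> `|a - r * cos t| <= k * r -> `|b - r * sin t| <= k * r ->
  let s := if a == 0 then pi / 2 else atan (b / a) in
  [/\ `|s - t| <= d, r * (1 - 2 * k) <= Num.sqrt (a ^+ 2 + b ^+ 2) &
      Num.sqrt (a ^+ 2 + b ^+ 2) <= r * (1 + 2 * k)].
Proof.
move=> a0 b0 r0 /andP[k0 k1] /andP[d0 d1] hd /andP[t0 t1] ha hb s.
have [/andP[s0 s1] ea eb] := polar_coordinates a0 b0; rewrite -/s in s0 s1 ea eb.
set n := Num.sqrt _ in ea eb *.
have n0 : 0 <= n by exact: sqrtr_ge0.
have pi2 : 0 <= pi / 2 :> R by rewrite divr_ge0 // pi_ge0.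
have ct : 0 <= cos t <= 1.
  rewrite cos_le1 andbT; apply: cos_ge0_pihalf; rewrite t1 andbT.
  by apply: le_trans t0; rewrite oppr_le0.
have st : 0 <= sin t <= 1.
  rewrite sin_le1 andbT; apply: sin_ge0_pi; rewrite t0 /=; apply: le_trans t1 _.
  by rewrite ler_pdivrMr // ler_peMr ?pi_ge0 // ler1n.
have [lo det up] := near_unit_vector a0 b0 r0 k0 ct st (cos2Dsin2 t) ha hb.
have nc : n * cos (s - t) = a * cos t + b * sin t by rewrite cosB ea eb; ring.
have ns : n * sin (s - t) = b * cos t - a * sin t by rewrite sinB ea eb; ring.
have {}lo : r * (1 - 2 * k) <= n.
  by apply: le_trans lo _; rewrite -nc ler_piMr // cos_le1.
split => //; last first.
  apply: ler_sqr_nneg; last by rewrite sqr_sqrtr // addr_ge0 // sqr_ge0.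
  by rewrite mulr_ge0 ?addr_ge0 ?mulr_ge0 // ltW.
have k2 : 0 < 1 - 2 * k by move: k1; lra.
have np : 0 < n by apply: lt_le_trans lo; rewrite mulr_gt0.
have sd0 : 0 < sin d by rewrite -(pmulr_lgt0 _ k2); apply: lt_trans hd; rewrite mulr_gt0.
have lt : `|sin (s - t)| < sin d.
  rewrite -(ltr_pM2l np) -{1}(ger0_norm n0) -normrM ns.
  apply: le_lt_trans det _; apply: lt_le_trans (_ : sin d * (r * (1 - 2 * k)) <= _).
    by rewrite mulrA [sin d * (_ * _)]mulrCA (mulrC r) ltr_pM2r.
  by rewrite mulrC ler_pM2r.
apply: norm_le_of_sin lt; last by rewrite d0.
by rewrite ler_norml; apply/andP; split; move: s0 s1 t0 t1 pi2; lra.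
Qed.

End Trigonometry.

Section GrowthLimits.
Context {R : realType}.
Local Open Scope ereal_scope.

Lemma limf_esup_lt (T : choiceType) (X : filteredType T) (f : X -> \bar R)
    (F : set_system X) (b : \bar R) : Filter F ->
  limf_esup f F < b -> \forall x \near F, f x < b.
Proof.
move=> FF /ereal_inf_lt[_ [V FV <-] h].
by apply: filterS FV => x Vx; apply: le_lt_trans h; apply: ereal_sup_ubound; exists x.
Qed.

Lemma lt_limf_esup (T : choiceType) (X : filteredType T) (f : X -> \bar R)
    (F : set_system X) (a : \bar R) (V : set X) :
  a < limf_esup f F -> F V -> exists2 x, V x & a < f x.
Proof.
move=> h FV.
have : a < ereal_sup (f @` V).
  by apply: lt_le_trans h _; apply: ereal_inf_lbound; exists V.
by move=> /ereal_sup_gt[_ [x Vx <-] ax]; exists x.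
Qed.

Lemma lne_card_le (c n : nat) (b : R) : (0 < n)%N ->
  lne (c%:R)%:E * (n%:R^-1)%:E < b%:E -> (c%:R <= expR (b * n%:R))%R.
Proof.
move=> n0; have [->|c0] := posnP c; first by move=> _; exact: expR_ge0.
have cp : (0 < c%:R :> R)%R by rewrite ltr0n.
have np : (0 < n%:R :> R)%R by rewrite ltr0n.
rewrite lne_EFin // -EFinM lte_fin ltr_pdivrMr // => h.
by rewrite -(@lnK _ c%:R) ?posrE // ler_expR ltW.
Qed.

Lemma lne_card_ge (c n : nat) (a : R) : (0 < n)%N ->
  a%:E < lne (c%:R)%:E * (n%:R^-1)%:E -> (expR (a * n%:R) <= c%:R)%R.
Proof.
move=> n0; have np : (0 < n%:R :> R)%R by rewrite ltr0n.
have [->|c0] := posnP c.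
  by rewrite le0_lneNy // gt0_mulNye // lte_fin invr_gt0.
have cp : (0 < c%:R :> R)%R by rewrite ltr0n.
rewrite lne_EFin // -EFinM lte_fin ltr_pdivlMr // => h.
by rewrite -(@lnK _ c%:R) ?posrE // ler_expR ltW.
Qed.

End GrowthLimits.

(** * Counting words and annuli *)

Lemma pigeonhole_fset (K : choiceType) (L : eqType) (c0 : L) (f : K -> L)
    (P : seq L) (S : {fset K}) : (forall g, g \in S -> f g \in P) ->
  exists c, (#|` S| <= size P * #|` [fset g in S | f g == c]%fset|)%N.
Proof.
elim: P S => [|c P IH] S SP.
  exists c0; rewrite leqn0 cardfs_eq0; apply/eqP/fsetP => g; rewrite inE.
  by apply/negP => /SP.
pose S' := [fset g in S | f g != c]%fset.
have [g|c' hc'] := IH S'.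
  by rewrite !inE /= => /andP[/SP]; rewrite inE => /orP[/eqP -> /eqP|].
have sub : (#|` [fset g in S' | f g == c']| <= #|` [fset g in S | f g == c']|)%N%fset.
  apply: fsubset_leq_card; apply/fsubsetP => g.
  by rewrite !inE /= => /andP[/andP[-> _] ->].
have e : #|` S| = (#|` [fset g in S | f g == c]%fset| + #|` S'|)%N.
  rewrite -(cardfsID [fset g in S | f g == c]%fset S); congr (_ + _)%N;
  congr (#|` _|); apply/fsetP => g; rewrite !inE /=; case: (g \in S) => //=.
  by rewrite andbT.
have [le|/ltnW le] := leqP #|` [fset g in S | f g == c]%fset|
                           #|` [fset g in S | f g == c']%fset|.
  exists c'; rewrite e /= mulSn.
  by apply: leq_add => //; apply: leq_trans hc' _; rewrite leq_mul2l sub orbT.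
exists c; rewrite e /= mulSn leq_add2l; apply: leq_trans hc' _; rewrite leq_mul2l.
by rewrite (leq_trans sub le) orbT.
Qed.

Lemma ln_le_linear (R : realType) (d x : R) : 0 < d -> 0 < x ->
  ln x <= d * x - ln d.
Proof.
move=> d0 x0; rewrite lerBrDl -lnM ?posrE // ltW //.
by apply: ln_sublinear; rewrite mulr_gt0.
Qed.

Section Words.
Context {R : realType} {E : choiceType}.
Variables (G : set E) (v1 v2 : E -> R) (Phi : E -> E -> E) (C : R) (N : nat).
Hypothesis PhiP : forall g h, G g -> G h -> [/\ G (Phi g h),
  `|v1 (Phi g h) - (v1 g + v1 h)| <= C & `|v2 (Phi g h) - (v2 g + v2 h)| <= C].
Hypothesis PhiN : forall S T : {fset E}, (forall g, g \in S -> G g) ->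
  (forall h, h \in T -> G h) ->
  (forall g g', g \in S -> g' \in S -> `|v1 g - v1 g'| <= 1 /\ `|v2 g - v2 g'| <= 1) ->
  (#|` S| * #|` T| <= N * #|` [fset Phi g h | g in S, h in T]%fset|)%N.

(** Each step divides the number of elements that could be expected by at most [N]
    and adds at most [C] to the errors. *)
Lemma iterated_products (S T0 : {fset E}) (a1 a2 e b1 b2 e0 : R) (k : nat) :
  (forall g, g \in S -> [/\ G g, `|v1 g - a1| <= e & `|v2 g - a2| <= e]) ->
  (forall g g', g \in S -> g' \in S -> `|v1 g - v1 g'| <= 1 /\ `|v2 g - v2 g'| <= 1) ->
  (forall h, h \in T0 -> [/\ G h, `|v1 h - b1| <= e0 & `|v2 h - b2| <= e0]) ->
  exists T : {fset E}, (#|` S| ^ k * #|` T0| <= N ^ k * #|` T|)%N /\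
    forall h, h \in T -> [/\ G h, `|v1 h - (k%:R * a1 + b1)| <= k%:R * (e + C) + e0 &
      `|v2 h - (k%:R * a2 + b2)| <= k%:R * (e + C) + e0].
Proof.
move=> hS box hT0; elim: k => [|k [T [cT hT]]].
  exists T0; rewrite !expn0; split=> // h /hT0[? ? ?].
  by rewrite !mul0r !add0r.
exists [fset Phi g h | g in S, h in T]%fset; split.
  have SG g : g \in S -> G g by case/hS.
  have TG g : g \in T -> G g by case/hT.
  have := PhiN SG TG box; rewrite !expnS => c1.
  rewrite -mulnA; apply: leq_trans (leq_mul (leqnn _) cT) _.
  rewrite mulnCA; apply: leq_trans (leq_mul (leqnn _) c1) _.
  by rewrite mulnCA mulnA.
move=> _ /imfset2P[g /= gS [h /= hT' ->]].
have [Gg g1 g2] := hS _ gS; have [Gh h1 h2] := hT _ hT'.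
have [Gp p1 p2] := PhiP Gg Gh.
split=> //; rewrite -natr1.
  move: g1 h1 p1; rewrite !ler_norml => /andP[? ?] /andP[? ?] /andP[? ?].
  by apply/andP; lra.
move: g2 h2 p2; rewrite !ler_norml => /andP[? ?] /andP[? ?] /andP[? ?].
by apply/andP; lra.
Qed.

End Words.

Section Annuli.
Context {R : realType} {X1 X2 : metricType R}.
Local Notation E := ((X1 -> X1) * (X2 -> X2))%type.
Variables (G : set E) (o : X1 * X2).
Hypothesis pG : acts_properly G.
Implicit Types (g : E) (t eps : R) (n : nat).

Lemma disp1_ge0 g : 0 <= disp1 o g. Proof. exact: mdist_ge0. Qed.
Lemma disp2_ge0 g : 0 <= disp2 o g. Proof. exact: mdist_ge0. Qed.

Lemma annulus_finite eps t n : finite_set (annulus G o eps t n).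
Proof.
apply: (@sub_finite_set _ _ [set g | G g /\ prod_dist o (pact g o) <= n.+1%:R]).
  move=> g [Gg _ /andP[_ h] _]; split=> //; apply: ltW; apply: lt_trans h _.
  by rewrite ltr_nat.
exact: pG.
Qed.

Lemma annulus_disp eps t n g : annulus G o eps t n g ->
  `|disp1 o g - n%:R * cos t| <= n%:R * eps + 1 /\
  `|disp2 o g - n%:R * sin t| <= n%:R * eps + 1.
Proof.
move=> [Gg _ /andP[h1 h2] h3].
have [_ e1 e2] := polar_coordinates (disp1_ge0 g) (disp2_ge0 g).
rewrite -/(slope o g) in e1 e2.
have nE : Num.sqrt (disp1 o g ^+ 2 + disp2 o g ^+ 2) = prod_dist o (pact g o) by [].
rewrite nE in e1 e2; move: (slope o g) (prod_dist o (pact g o)) h1 h2 h3 e1 e2.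
move=> s nu h1 h2 h3 -> ->.
have n0 : 0 <= n%:R :> R by [].
have aux (f : R -> R) : `|f s| <= 1 -> `|f s - f t| <= `|s - t| ->
    `|nu * f s - n%:R * f t| <= n%:R * eps + 1.
  move=> f1 f2.
  have -> : nu * f s - n%:R * f t = n%:R * (f s - f t) + (nu - n%:R) * f s by ring.
  apply: le_trans (ler_normD _ _) _; rewrite !normrM ger0_norm //; apply: lerD.
    by apply: ler_wpM2l => //; exact: le_trans f2 h3.
  have q : `|nu - n%:R| <= 1 by rewrite ler_norml; apply/andP; lra.
  exact: mulr_ile1.
by split; apply: aux; rewrite ?cos_lipschitz ?sin_lipschitz // ler_norml
  ?cos_geN1 ?cos_le1 ?sin_geN1 ?sin_le1.
Qed.

Lemma disp_lt_annulus eps t n g : annulus G o eps t n g ->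
  disp1 o g < n%:R /\ disp2 o g < n%:R.
Proof.
move=> [_ _ /andP[_ h] _].
have d1 := disp1_ge0 g; have d2 := disp2_ge0 g.
have n0 : 0 <= n%:R :> R by [].
have e : prod_dist o (pact g o) ^+ 2 = disp1 o g ^+ 2 + disp2 o g ^+ 2.
  by rewrite sqr_sqrtr // addr_ge0 // sqr_ge0.
have nu0 : 0 <= prod_dist o (pact g o) by exact: sqrtr_ge0.
by split; apply: le_lt_trans h; apply: ler_sqr_nneg => //; rewrite e;
  have := sqr_ge0 (disp1 o g); have := sqr_ge0 (disp2 o g); lra.
Qed.

(** Pigeonhole over the unit squares of [[0, n] x [0, n]]: passing to elements with
    almost the same displacements costs only a polynomial factor. *)
Lemma annulus_box eps t n : exists S : {fset E}, [/\
  (#|` fset_set (annulus G o eps t n)| <= n * n * #|` S|)%N,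
  forall g, g \in S -> annulus G o eps t n g &
  forall g g', g \in S -> g' \in S ->
    `|disp1 o g - disp1 o g'| <= 1 /\ `|disp2 o g - disp2 o g'| <= 1].
Proof.
pose f g := (Num.truncn (disp1 o g), Num.truncn (disp2 o g)).
pose P := [seq (i, j) | i <- iota 0 n, j <- iota 0 n].
have memA g : g \in fset_set (annulus G o eps t n) -> annulus G o eps t n g.
  by rewrite in_fset_set ?inE //; exact: annulus_finite.
have [g gA|c hc] := @pigeonhole_fset _ _ (0%N, 0%N) f P (fset_set (annulus G o eps t n)).
  have [d1 d2] := disp_lt_annulus (memA g gA).
  apply/allpairsP; exists (f g); split=> //=; rewrite mem_iota /= add0n;
    by rewrite truncn_lt_nat // ?disp1_ge0 ?disp2_ge0.
exists [fset g in fset_set (annulus G o eps t n) | f g == c]%fset; split.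
- by move: hc; rewrite size_allpairs size_iota.
- by move=> g; rewrite !inE /= => /andP[/memA].
move=> g g'; rewrite !inE /= => /andP[_ /eqP gc] /andP[_ /eqP gc'].
have : f g = f g' by rewrite gc gc'.
move=> [e1 e2].
have /andP[a1 a2] := truncn_itv (disp1_ge0 g).
have /andP[b1 b2] := truncn_itv (disp1_ge0 g').
have /andP[a3 a4] := truncn_itv (disp2_ge0 g).
have /andP[b3 b4] := truncn_itv (disp2_ge0 g').
rewrite -e1 -natr1 in b1 b2; rewrite -e2 -natr1 in b3 b4.
rewrite -natr1 in a2; rewrite -natr1 in a4.
by split; rewrite ler_norml; apply/andP; lra.
Qed.

(** Sort the elements of [T] into the annuli that contain them; these are few, and
    all of them are among the annuli with a known bound. *)
Lemma card_near_direction (T : {fset E}) (b r k d t : R) (k0 : nat) :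
  0 < b -> 0 < r -> 0 < k < 1 / 4 -> 0 < d <= pi / 2 ->
  2 * k < sin d * (1 - 2 * k) -> 0 <= t <= pi / 2 ->
  (forall n, (k0 <= n)%N ->
    (#|` fset_set (annulus G o d t n)|%:R <= expR (b * n%:R))) ->
  k0%:R <= r * (1 - 2 * k) ->
  (forall g, g \in T -> [/\ G g, `|disp1 o g - r * cos t| <= k * r &
                           `|disp2 o g - r * sin t| <= k * r]) ->
  #|` T|%:R <= (r * (1 + 2 * k) + 1) * expR (b * (r * (1 + 2 * k) + 1)).
Proof.
move=> b0 r0 k01 d0 hd t0 up rk hT.
have /andP[kp k1] := k01.
have key g : g \in T -> [/\ `|slope o g - t| <= d,
    r * (1 - 2 * k) <= prod_dist o (pact g o) &
    prod_dist o (pact g o) <= r * (1 + 2 * k)].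
  move=> /hT[Gg h1 h2].
  exact: (slope_close (disp1_ge0 g) (disp2_ge0 g) r0 k01 d0 hd t0 h1 h2).
pose nu g := prod_dist o (pact g o).
have nu0 g : 0 <= nu g by exact: sqrtr_ge0.
pose Q := r * (1 + 2 * k).
have Q0 : 0 < Q by rewrite mulr_gt0 //; lra.
pose K := (Num.truncn Q).+1.
have KQ : K%:R <= Q + 1.
  by rewrite -natr1 lerD2r truncn_le ltW.
have KQ' : Q < K%:R by exact: truncnS_gt.
have [g gT|c] := @pigeonhole_fset _ _ 0%N (fun g => Num.truncn (nu g)) (iota 0 K) T.
  rewrite mem_iota add0n leq0n /= truncn_lt_nat //.
  by have [_ _ h] := key g gT; apply: le_lt_trans h KQ'.
rewrite size_iota; set T' := [fset g in T | _]%fset => cT.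
have [T'0|[g gT']] := fset_0Vmem T'.
  move: cT; rewrite T'0 cardfs0 muln0 leqn0 => /eqP ->.
  by rewrite mulr_ge0 ?expR_ge0 //; rewrite -/Q; lra.
have memT' g' : g' \in T' -> g' \in T /\ Num.truncn (nu g') = c.
  by rewrite !inE /= => /andP[? /eqP].
have cR g' : g' \in T' -> c%:R <= nu g' < c.+1%:R.
  by move=> /memT'[_ <-]; exact: truncn_itv.
have sub : (#|` T'| <= #|` fset_set (annulus G o d t c.+1)|)%N.
  apply: fsubset_leq_card; apply/fsubsetP => g' g'T'.
  rewrite in_fset_set ?inE; last exact: annulus_finite.
  have [g'T _] := memT' _ g'T'; have [s1 s2 s3] := key _ g'T.
  have [Gg' _ _] := hT _ g'T.
  split=> //.
    move=> e; move: s2; rewrite e /prod_dist !mdistxx expr0n addr0 sqrtr0.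
    have : 0 < r * (1 - 2 * k) by rewrite mulr_gt0 //; lra.
    lra.
  by have := cR _ g'T'; rewrite -/(nu g') -natr1 addrK.
have [gT _] := memT' _ gT'; have [_ s2 s3] := key _ gT.
have /andP[c1 c2] := cR _ gT'.
have k0c : (k0 <= c.+1)%N.
  by rewrite -(ler_nat R); apply: le_trans rk _; apply: le_trans s2 _; exact: ltW.
have cK : c%:R + 1 <= Q + 1 :> R by rewrite lerD2r; apply: le_trans c1 s3.
have h1 := up _ k0c.
have h2 : (#|` T|%:R : R) <= K%:R * #|` T'|%:R by rewrite -natrM ler_nat.
apply: le_trans h2 _; apply: ler_pM => //.
apply: le_trans (_ : #|` fset_set (annulus G o d t c.+1)|%:R <= _).
  by rewrite ler_nat.
apply: le_trans h1 _; rewrite ler_expR; apply: ler_wpM2l; first exact: ltW.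
by rewrite -natr1.
Qed.

End Annuli.

(** * Growth rates *)

Section GrowthRates.
Context {R : realType} {X1 X2 : metricType R}.
Local Notation E := ((X1 -> X1) * (X2 -> X2))%type.
Variables (G : set E) (o : X1 * X2).
Hypothesis pG : acts_properly G.
Implicit Types (g : E) (t eps : R) (n : nat).
Local Notation card_annulus e t n := (#|` fset_set (annulus G o e t n)|).

Lemma growth_eps_upper e t b : (growth_eps G o e t < b%:E)%E ->
  exists k0, forall n, (k0 <= n)%N -> (card_annulus e t n)%:R <= expR (b * n%:R).
Proof.
move=> /limf_esup_lt[K _ hK]; exists K.+1 => n Kn; apply: lne_card_le.
  by apply: leq_trans Kn.
by apply: hK => /=; exact: ltnW.
Qed.

Lemma growth_eps_lower e t a (K : nat) : (a%:E < growth_eps G o e t)%E ->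
  exists n, [/\ (K <= n)%N, (0 < n)%N & expR (a * n%:R) <= (card_annulus e t n)%:R].
Proof.
move=> h; have [|n /= Kn hn] := lt_limf_esup (V := [set n | (K < n)%N]) h.
  by exists K.+1.
have n0 : (0 < n)%N by apply: leq_ltn_trans Kn.
by exists n; split => //; [exact: ltnW | exact: lne_card_ge].
Qed.

Lemma growth_eps_le e t e' t' : `|t - t'| + e <= e' ->
  (growth_eps G o e t <= growth_eps G o e' t')%E.
Proof.
move=> h; have sub n : annulus G o e t n `<=` annulus G o e' t' n.
  move=> g [Gg go ab st]; split=> //; apply: le_trans h.
  by rewrite (addrC _ e); apply: le_trans (ler_distD t _ _) _; rewrite lerD2r.
apply: le_ereal_inf_tmp.
move=> _ [V FV <-]; apply: (@le_trans _ _ (ereal_sup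
  ((fun n : nat => (lne (card_annulus e t n)%:R%:E * (n%:R^-1)%:E)%E) @` V))).
  by apply: ereal_inf_lbound; exists V.
apply: ge_ereal_sup => _ [n Vn <-].
apply: (@le_trans _ _ (lne (card_annulus e' t' n)%:R%:E * (n%:R^-1)%:E)%E); last first.
  by apply: ereal_sup_ubound; exists n.
apply: lee_wpmul2r; first by rewrite lee_fin invr_ge0.
have c : ((card_annulus e t n)%:R%:E <= (card_annulus e' t' n)%:R%:E :> \bar R)%E.
  rewrite lee_fin ler_nat; apply: fsubset_leq_card; apply/fsubsetP => g.
  rewrite !in_fset_set; [|exact: annulus_finite|exact: annulus_finite].
  by rewrite !inE; exact: sub.
rewrite lee_lne // in_itv /= leey andbT lee_fin //.
Qed.

Lemma growth_rate_le e t : 0 < e -> (growth_rate G o t <= growth_eps G o e t)%E.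
Proof.
move=> e0; rewrite /growth_rate limf_einfE; apply: ge_ereal_sup => _ [V FV <-].
have [e' [[Ve' e'0] e'e]] : exists e', (V e' /\ 0 < e') /\ e' < e.
  have F1 : \forall x \near (0 : R)^'+, 0 < x by exact: nbhs_right_gt.
  have F2 : \forall x \near (0 : R)^'+, x < e by exact: nbhs_right_lt.
  exact: (@filter_ex _ _ _ _ (filterI (filterI FV F1) F2)).
apply: (@le_trans _ _ (growth_eps G o e' t)).
  by apply: ereal_inf_lbound; exists e'.
by apply: growth_eps_le; rewrite subrr normr0 add0r ltW.
Qed.

Lemma growth_rate_ge t y : (forall e, 0 < e -> (y <= growth_eps G o e t)%E) ->
  (y <= growth_rate G o t)%E.
Proof.
move=> h; rewrite /growth_rate limf_einfE.
apply: (@le_trans _ _ (ereal_inf ((fun e => growth_eps G o e t) @` [set e | 0 < e]))).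
  by apply: le_ereal_inf_tmp => _ [e e0 <-]; exact: h.
by apply: ereal_sup_ubound; exists [set e | 0 < e] => //; exact: nbhs_right_gt.
Qed.

Lemma choose_angle_margin (a b s1 s2 sd : R) : 0 < a -> 0 < b -> 0 < s1 -> 0 <= s2 ->
  b < s1 * a -> 0 < sd -> sd <= 1 -> exists k, [/\ 0 < k < 1 / 4, k < a,
    2 * k < sd * (1 - 2 * k) & b * (1 + 2 * k) + s2 * k < (a - k) * s1].
Proof.
move=> a0 b0 s10 s20 bsa sd0 sd1.
pose D := 2 * b + s1 + s2 + 1.
have D0 : 0 < D by rewrite /D; lra.
have q0 : 0 < (s1 * a - b) / D by rewrite divr_gt0 //; lra.
pose k := Num.min (Num.min (1 / 8) (a / 2)) (Num.min (sd / 8) ((s1 * a - b) / D)).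
have k0 : 0 < k by rewrite !lt_min q0 !divr_gt0 //; lra.
have : k <= k by []. rewrite {2}/k !le_min => /andP[/andP[k1 k2] /andP[k3 k4]].
rewrite ler_pdivlMr // /D in k4.
exists k; split; [by apply/andP; lra | lra | nra | ].
have : 0 < k * 1 by rewrite mulr1.
nra.
Qed.

Lemma large_scale (k e L : R) : 0 < k -> 0 < e -> exists K : nat,
  forall n, (K <= n)%N -> (0 < n)%N -> 1 + L <= e * n%:R /\
    2 * ln n%:R + L <= k * n%:R.
Proof.
move=> k0 e0; pose B := `|(1 + L) / e| + `|2 * (L - 2 * ln (k / 4)) / k|.
exists (Num.bound B) => n Kn n0.
have : B < n%:R.
  apply: lt_le_trans (archi_boundP _) _; first by rewrite addr_ge0.
  by rewrite ler_nat.
have h1 := ler_norm ((1 + L) / e).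
have h2 := ler_norm (2 * (L - 2 * ln (k / 4)) / k).
have h3 : 0 <= `|(1 + L) / e| by [].
have h4 : 0 <= `|2 * (L - 2 * ln (k / 4)) / k| by [].
rewrite /B => h.
have a1 : (1 + L) / e <= n%:R by lra.
have a2 : 2 * (L - 2 * ln (k / 4)) / k <= n%:R by lra.
rewrite ler_pdivrMr // in a1; rewrite ler_pdivrMr // in a2.
have k40 : 0 < k / 4 by lra.
have np : 0 < n%:R :> R by rewrite ltr0n.
have := ln_le_linear k40 np.
by split; lra.
Qed.

Variables (Phi : E -> E -> E) (C : R) (N : nat).
Hypothesis hG : isometry_group G.
Hypothesis PhiP : forall g h, G g -> G h -> [/\ G (Phi g h),
  `|disp1 o (Phi g h) - (disp1 o g + disp1 o h)| <= C &
  `|disp2 o (Phi g h) - (disp2 o g + disp2 o h)| <= C].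
Hypothesis PhiN : forall S T : {fset E}, (forall g, g \in S -> G g) ->
  (forall h, h \in T -> G h) ->
  (forall g g', g \in S -> g' \in S ->
    `|disp1 o g - disp1 o g'| <= 1 /\ `|disp2 o g - disp2 o g'| <= 1) ->
  (#|` S| * #|` T| <= N * #|` [fset Phi g h | g in S, h in T]%fset|)%N.

(** Words in [j] elements of [S] and [i] copies of [h], of which only the first
    contribute to the cardinality while both contribute to the direction. *)
Lemma mixed_products (e t0 p : R) (n m i j : nat) (S : {fset E}) h :
  0 < e -> 1 + C <= e * n%:R -> 1 + C <= e * m%:R ->
  (forall g, g \in S -> annulus G o e t0 n g) ->
  (forall g g', g \in S -> g' \in S ->
    `|disp1 o g - disp1 o g'| <= 1 /\ `|disp2 o g - disp2 o g'| <= 1) ->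
  annulus G o e p m h ->
  exists T : {fset E}, (#|` S| ^ j <= N ^ (i + j) * #|` T|)%N /\
    forall g, g \in T -> let err := 2 * e * (j%:R * n%:R + i%:R * m%:R) in
      [/\ G g,
      `|disp1 o g - (j%:R * n%:R * cos t0 + i%:R * m%:R * cos p)| <= err &
      `|disp2 o g - (j%:R * n%:R * sin t0 + i%:R * m%:R * sin p)| <= err].
Proof.
move=> e0 Cn Cm hS box hh.
pose id0 : E := (id, id).
have [|||T1 [cT1 hT1]] := iterated_products PhiP PhiN (S := [fset h]%fset)
  (T0 := [fset id0]%fset) (a1 := m%:R * cos p) (a2 := m%:R * sin p)
  (e := m%:R * e + 1) (b1 := 0) (b2 := 0) (e0 := 0) i.
- move=> g; rewrite inE => /eqP ->; have [Gh _ _ _] := hh.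
  by have [? ?] := annulus_disp hh.
- by move=> g g'; rewrite !inE => /eqP -> /eqP ->; rewrite !subrr normr0.
- move=> g; rewrite inE => /eqP ->; rewrite /disp1 /disp2 /= !mdistxx subrr normr0.
  by split=> //; case: hG.
have [|||T [cT hT]] := iterated_products PhiP PhiN (S := S)
  (T0 := T1) (a1 := n%:R * cos t0) (a2 := n%:R * sin t0)
  (e := n%:R * e + 1) (b1 := i%:R * (m%:R * cos p) + 0)
  (b2 := i%:R * (m%:R * sin p) + 0) (e0 := i%:R * (m%:R * e + 1 + C) + 0) j.
- by move=> g gS; have [Gg _ _ _] := hS g gS; have [? ?] := annulus_disp (hS g gS).
- exact: box.
- exact: hT1.
exists T; split.
  rewrite !cardfs1 exp1n mul1n in cT1.
  have := leq_mul (leqnn (#|` S| ^ j)) cT1; rewrite muln1 => /leq_trans; apply.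
  by rewrite mulnCA expnD -mulnA leq_mul2l cT orbT.
move=> g gT err; have [Gg g1 g2] := hT g gT.
have errP : j%:R * (n%:R * e + 1 + C) + (i%:R * (m%:R * e + 1 + C) + 0) <= err.
  have j0 : 0 <= j%:R :> R by []. have i0 : 0 <= i%:R :> R by [].
  have q1 : j%:R * (n%:R * e + 1 + C) <= j%:R * (2 * (e * n%:R)).
    by apply: ler_wpM2l => //; lra.
  have q2 : i%:R * (m%:R * e + 1 + C) <= i%:R * (2 * (e * m%:R)).
    by apply: ler_wpM2l => //; lra.
  by rewrite /err; lra.
rewrite !addr0 !mulrA in g1 g2 errP.
by split=> //; [apply: le_trans g1 _ | apply: le_trans g2 _]; rewrite ?mulrA.
Qed.

End GrowthRates.

(** * Lower bound for the growth rate *)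

Section RealEstimates.
Context {R : realType}.

Lemma truncn_quotient (x y : R) : 0 <= x -> 0 < y ->
  x - y <= (Num.truncn (x / y))%:R * y <= x.
Proof.
move=> x0 y0; have /andP[h1 h2] := truncn_itv (divr_ge0 x0 (ltW y0)).
rewrite ler_pdivlMr // in h1; rewrite ltr_pdivrMr // -natr1 in h2.
by apply/andP; lra.
Qed.

Lemma ereal_lt_real (x : \bar R) (a : R) : (x < a%:E)%E -> 0 < a ->
  exists b, [/\ 0 < b, b < a & (x < b%:E)%E].
Proof.
case: x => [c| |] // h a0; last by exists (a / 2); split; [lra|lra|exact: ltNyr].
rewrite lte_fin in h; exists ((Num.max c 0 + a) / 2).
have : c <= Num.max c 0 by rewrite le_max lexx.
have : 0 <= Num.max c 0 by rewrite le_max lexx orbT.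
have : Num.max c 0 < a by rewrite gt_max h.
by split; rewrite ?lte_fin; lra.
Qed.

Lemma choose_radius (A B K k D : R) : 0 <= A -> 0 <= B -> 0 <= K ->
  0 < k < 1 / 4 -> 0 < D ->
  exists r, [/\ 0 < r, A <= k * r, 2 * B < D * r & K <= r * (1 - 2 * k)].
Proof.
move=> A0 B0 K0 /andP[k0 k1] D0; exists (1 + A / k + 2 * K + 2 * B / D).
have r1 : 0 <= A / k by rewrite divr_ge0 // ltW.
have r2 : 0 <= 2 * B / D by rewrite divr_ge0 ?mulr_ge0 // ltW.
have e1 : A / k * k = A by rewrite divfK //; apply/eqP; lra.
have e2 : 2 * B / D * D = 2 * B by rewrite divfK //; apply/eqP; lra.
move: (A / k) (2 * B / D) r1 r2 e1 e2 => x y r1 r2 e1 e2.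
by split; [lra | nra | nra | nra].
Qed.

(** The exponential rates on the two sides of the count: [D] is the surplus of the
    words over the bound for the annuli, and it beats the error terms [M] at a
    large scale [r]. *)
Lemma counting_contradiction (a b k s1 s2 n m r i j sg L tau D M : R) :
  0 < k < 1 / 4 -> k < a -> 0 < r -> 0 < b -> 0 <= j -> 0 <= i ->
  r * s1 - n <= j * n -> i * m <= r * s2 -> n * (a - k) <= sg - L -> L <= k * m ->
  j * sg <= (i + j) * L + tau ->
  D = (a - k) * s1 - s2 * k - b * (1 + 2 * k) ->
  M = n * (a - k) + D / 4 - ln (D / 4) + b ->
  0 < D -> 2 * `|M| < D * r ->
  tau <= D / 4 * (r * (1 + 2 * k) + 1) - ln (D / 4) + b * (r * (1 + 2 * k) + 1) ->
  False.
Proof.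
move=> /andP[k0 k1] ka r0 b0 j0 i0 j1 i2 hsg hL cT DE ME D0 rM hTau.
have jn : j * (n * (a - k)) <= j * (sg - L) by exact: ler_wpM2l.
have im : i * L <= i * (k * m) by exact: ler_wpM2l.
have im2 : k * (i * m) <= k * (r * s2) by apply: ler_wpM2l => //; exact: ltW.
have jn2 : (r * s1 - n) * (a - k) <= (j * n) * (a - k).
  by apply: ler_wpM2r => //; rewrite subr_ge0 ltW.
have D4 : 0 <= D / 4 by rewrite divr_ge0 // ltW.
have Qle : D / 4 * (r * (1 + 2 * k) + 1) <= D / 4 * (2 * r + 1).
  by apply: ler_wpM2l => //; nra.
have rDE : r * D = r * ((a - k) * s1 - s2 * k - b * (1 + 2 * k)) by rewrite DE.
move: (ln (D / 4)) (D / 4 * (r * (1 + 2 * k) + 1)) hTau ME Qle => x y hTau ME Qle.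
have final : r * D <= y - x + b + n * (a - k).
  by move: jn im im2 jn2 cT hTau rDE; lra.
have Mle := ler_norm M.
have rD : 0 < r * D by rewrite mulr_gt0.
by move: final Mle rM ME Qle rD; lra.
Qed.

Lemma scaled_between (u n f : R) : 0 <= u <= n -> -1 <= f <= 1 -> `|u * f| <= n.
Proof.
move=> /andP[u0 un] f1; rewrite normrM ger0_norm //; apply: le_trans un.
by rewrite ler_piMr // ler_norml.
Qed.

Lemma direction_estimate (r s1 s2 n m jn im f0 fp ft x e k : R) :
  0 < e -> e * (4 * (s1 + s2)) = k -> r * s1 - n <= jn <= r * s1 ->
  r * s2 - m <= im <= r * s2 -> -1 <= f0 <= 1 -> -1 <= fp <= 1 ->
  ft = s1 * f0 + s2 * fp -> 2 * (n + m) <= k * r ->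
  `|x - (jn * f0 + im * fp)| <= 2 * e * (jn + im) -> `|x - r * ft| <= k * r.
Proof.
move=> e0 eE /andP[j1 j2] /andP[i1 i2] hf0 hfp -> rk hx.
have /scaled_between/(_ hf0) b1 : 0 <= r * s1 - jn <= n by apply/andP; lra.
have /scaled_between/(_ hfp) b2 : 0 <= r * s2 - im <= m by apply/andP; lra.
have h : e * (jn + im) <= e * (r * s1 + r * s2).
  by apply: ler_wpM2l; [exact: ltW | lra].
have err : 2 * e * (jn + im) <= k * r / 2 by rewrite -eE; lra.
move: hx b1 b2; rewrite !ler_norml => /andP[? ?] /andP[? ?] /andP[? ?].
by apply/andP; lra.
Qed.

Lemma net_exponent (a k n x sg L : R) : a * n <= 2 * x + sg ->
  2 * x + L <= k * n -> n * (a - k) <= sg - L.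
Proof. lra. Qed.

End RealEstimates.

Section LowerBound.
Context {R : realType} {X1 X2 : metricType R}.
Local Notation E := ((X1 -> X1) * (X2 -> X2))%type.
Variables (G : set E) (o : X1 * X2).
Hypothesis pG : acts_properly G.
Variables (Phi : E -> E -> E) (C : R) (N : nat).
Hypothesis hG : isometry_group G.
Hypothesis PhiP : forall g h, G g -> G h -> [/\ G (Phi g h),
  `|disp1 o (Phi g h) - (disp1 o g + disp1 o h)| <= C &
  `|disp2 o (Phi g h) - (disp2 o g + disp2 o h)| <= C].
Hypothesis PhiN : forall S T : {fset E}, (forall g, g \in S -> G g) ->
  (forall h, h \in T -> G h) ->
  (forall g g', g \in S -> g' \in S ->
    `|disp1 o g - disp1 o g'| <= 1 /\ `|disp2 o g - disp2 o g'| <= 1) ->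
  (#|` S| * #|` T| <= N * #|` [fset Phi g h | g in S, h in T]%fset|)%N.

(** Let [S] be a large set of elements of slope close to [t0] and length close to
    [n], and [h] an element of slope close to [p] and length close to [m].  Words
    with about [r * s1 / n] letters from [S] and [r * s2 / m] letters [h] have
    displacement close to [r] times the unit vector of slope [t], and there are
    at least about [expR (r * s1 * a)] of them.  A single [h] suffices, since the
    letters [h] are only there to turn the direction. *)
Lemma growth_lower (t0 p t s1 s2 a : R) :
  0 <= t <= pi / 2 -> 0 < s1 -> 0 <= s2 ->
  cos t = s1 * cos t0 + s2 * cos p -> sin t = s1 * sin t0 + s2 * sin p ->
  (0 <= growth_rate G o p)%E -> 0 < a -> (a%:E < growth_rate G o t0)%E ->
  ((s1 * a)%:E <= growth_rate G o t)%E.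
Proof.
move=> ht s10 s20 ct st gp a0 ga; apply: growth_rate_ge => d' d'0.
have pi2 : 0 < pi / 2 :> R by rewrite divr_gt0 // pi_gt0.
pose d := Num.min d' (pi / 2).
have d0 : 0 < d by rewrite lt_min d'0 pi2.
have dpi : d <= pi / 2 by rewrite ge_min lexx orbT.
apply: (@le_trans _ _ (growth_eps G o d t)); last first.
  by apply: growth_eps_le => //; rewrite subrr normr0 add0r ge_min lexx.
rewrite leNgt; apply/negP => hlt.
have sa0 : 0 < s1 * a by rewrite mulr_gt0.
have [b [b0 bsa hb]] := ereal_lt_real hlt sa0.
have sd0 : 0 < sin d by apply: sin_gt0_pi; rewrite d0 /=; lra.
have [k [k01 ka kd kb]] := choose_angle_margin a0 b0 s10 s20 bsa sd0 (sin_le1 d).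
have /andP[k0 k1] := k01.
pose e := k / (4 * (s1 + s2)).
have s0 : 0 < 4 * (s1 + s2) by lra.
have e0 : 0 < e by rewrite divr_gt0.
have eE : e * (4 * (s1 + s2)) = k by rewrite divfK //; apply/eqP; lra.
pose L := ln (N.+1%:R : R).
have L0 : 0 <= L by apply: ln_ge0; rewrite ler1n.
have [K hK] := large_scale (`|C| + L) k0 e0.
have [n [Kn n0 hn]] := growth_eps_lower K (lt_le_trans ga (growth_rate_le o pG t0 e0)).
have hneg : ((-1)%:E < growth_eps G o e p)%E.
  apply: lt_le_trans (growth_rate_le o pG p e0).
  by apply: lt_le_trans gp; rewrite lte_fin ltrN10.
have [m [Km m0 hm]] := growth_eps_lower K hneg.
have [k0' hk0] := growth_eps_upper hb.
have [Cn Ln] := hK n Kn n0; have [Cm Lm] := hK m Km m0.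
have Cn1 : 1 + C <= e * n%:R.
  apply: le_trans Cn; rewrite lerD2l; apply: le_trans (ler_norm C) _.
  by rewrite lerDl.
have Cm1 : 1 + C <= e * m%:R.
  apply: le_trans Cm; rewrite lerD2l; apply: le_trans (ler_norm C) _.
  by rewrite lerDl.
have LC : L <= `|C| + L by rewrite lerDr.
have np : 0 < n%:R :> R by rewrite ltr0n.
have mp : 0 < m%:R :> R by rewrite ltr0n.
have lnm : 0 <= ln (m%:R : R) by apply: ln_ge0; rewrite ler1n.
have [h hh] : exists h, annulus G o e p m h.
  have /fset0Pn[h hA] : fset_set (annulus G o e p m) != fset0.
    rewrite -cardfs_gt0 -(ltr_nat R); apply: lt_le_trans hm; exact: expR_gt0.
  exists h; rewrite in_fset_set ?inE in hA => //; exact: annulus_finite.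
have [S [cS hS boxS]] := annulus_box o pG e t0 n.
have S0 : (0 < #|` S|)%N.
  rewrite lt0n; apply/eqP => S0; move: cS; rewrite S0 muln0 leqn0 => /eqP cS0.
  by move: hn; rewrite cS0 leNgt expR_gt0.
pose sg := ln (#|` S|%:R : R).
have Sp : 0 < #|` S|%:R :> R by rewrite ltr0n.
have sgE : a * n%:R <= 2 * ln n%:R + sg.
  have : expR (a * n%:R) <= n%:R * n%:R * #|` S|%:R.
    by apply: le_trans hn _; rewrite -!natrM ler_nat.
  rewrite -ler_ln ?posrE ?expR_gt0 ?mulr_gt0 // expRK !lnM ?posrE ?mulr_gt0 //.
  by rewrite (mulr_natl (ln n%:R) 2) mulr2n.
have sgn : n%:R * (a - k) <= sg - L.
  exact: net_exponent sgE (le_trans (lerD (lexx _) LC) Ln).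
pose D := (a - k) * s1 - s2 * k - b * (1 + 2 * k).
have D0 : 0 < D by rewrite /D -addrA -opprD subr_gt0 addrC.
pose M := n%:R * (a - k) + D / 4 - ln (D / 4) + b.
have nm0 : 0 <= 2 * (n%:R + m%:R) :> R by rewrite mulr_ge0 // addr_ge0 // ltW.
have [r [r0 rk rM rk0]] := choose_radius nm0 (normr_ge0 M) (ler0n R k0') k01 D0.
pose j := Num.truncn (r * s1 / n%:R); pose i := Num.truncn (r * s2 / m%:R).
have rs1 : 0 <= r * s1 by rewrite mulr_ge0 ?ltW.
have rs2 : 0 <= r * s2 by rewrite mulr_ge0 // ltW.
have jE := truncn_quotient rs1 np; have iE := truncn_quotient rs2 mp.
rewrite -/j -/i in jE iE.
have /andP[j1 _] := jE; have /andP[_ i2] := iE.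
have [T [cT hT]] := mixed_products hG PhiP PhiN i j e0 Cn1 Cm1 hS boxS hh.
have T0 : (0 < #|` T|)%N.
  have : (0 < N ^ (i + j) * #|` T|)%N by apply: leq_trans cT; rewrite expn_gt0 S0.
  by rewrite muln_gt0 => /andP[].
have Tp : 0 < #|` T|%:R :> R by rewrite ltr0n.
pose tau := ln (#|` T|%:R : R).
have cTR : j%:R * sg <= (i%:R + j%:R) * L + tau.
  have cT' : (#|` S| ^ j <= N.+1 ^ (i + j) * #|` T|)%N.
    apply: leq_trans cT _; apply: leq_mul => //.
    by case: (i + j)%N => [|q]; rewrite ?expn0 // leq_exp2r.
  have : (#|` S|%:R : R) ^+ j <= N.+1%:R ^+ (i + j) * #|` T|%:R.
    by rewrite -!natrX -natrM ler_nat.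
  rewrite -ler_ln ?posrE ?mulr_gt0 ?exprn_gt0 // lnM ?posrE ?exprn_gt0 //.
  by rewrite !lnXn // -/sg -/L -/tau -(mulr_natl sg) -(mulr_natl L) natrD.
have hT' g : g \in T -> [/\ G g, `|disp1 o g - r * cos t| <= k * r &
    `|disp2 o g - r * sin t| <= k * r].
  move=> /hT /= [Gg g1 g2]; split=> //.
    apply: (direction_estimate e0 eE jE iE _ _ ct rk g1); rewrite ?cos_geN1 ?cos_le1 //.
  apply: (direction_estimate e0 eE jE iE _ _ st rk g2); rewrite ?sin_geN1 ?sin_le1 //.
have dd : 0 < d <= pi / 2 by rewrite d0.
have := card_near_direction pG b0 r0 k01 dd kd ht hk0 rk0 hT'.
set Q := r * (1 + 2 * k) + 1.
have Q0 : 0 < Q by rewrite addr_gt0 // mulr_gt0 // addr_gt0 // mulr_gt0.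
rewrite -ler_ln ?posrE ?mulr_gt0 ?expR_gt0 // lnM ?posrE ?expR_gt0 // expRK -/tau.
have D40 : 0 < D / 4 by rewrite divr_gt0.
move=> /le_trans/(_ (lerD (ln_le_linear D40 Q0) (lexx _))).
apply: (counting_contradiction k01 ka r0 b0 (ler0n R j) (ler0n R i) j1 i2 sgn _ cTR
  erefl erefl D0 rM) => //.
apply: le_trans Lm; apply: le_trans LC _.
by rewrite lerDr mulr_ge0.
Qed.

End LowerBound.

(** * Continuity *)

Lemma ereal_cvg_semicontinuous (R : realType) (T : Type) (F : set_system T)
    (f : T -> \bar R) (l : \bar R) : Filter F ->
  (forall a : R, (a%:E < l)%E -> \forall x \near F, (a%:E < f x)%E) ->
  (forall b : R, (l < b%:E)%E -> \forall x \near F, (f x < b%:E)%E) ->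
  f @ F --> l.
Proof.
move=> FF lo up V; case: l lo up => [r| |] lo up.
- move=> hV0; have hV1 : nbhs r (fun y => V y%:E) := hV0.
  have [e /= e0 hV] := (nbhs_ballP _ _).1 hV1.
  have lr : ((r - e)%:E < r%:E)%E by rewrite lte_fin ltrBlDr ltrDl.
  have ru : (r%:E < (r + e)%:E)%E by rewrite lte_fin ltrDl.
  apply: filterS2 (lo _ lr) (up _ ru) => x; rewrite /preimage /=.
  case: (f x) => [y| |] //; rewrite !lte_fin => h1 h2.
  by apply: hV; rewrite -ball_normE /= ltr_norml; apply/andP; lra.
- by move=> [M [Mr hM]]; apply: filterS (lo M (ltry _)) => x; exact: hM.
by move=> [M [Mr hM]]; apply: filterS (up M (ltNyr _)) => x; exact: hM.
Qed.

Lemma ereal_between (R : realType) (x : \bar R) (a : R) : (a%:E < x)%E ->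
  exists2 a', a < a' & (a'%:E < x)%E.
Proof.
case: x => [c| |] // h; last by exists (a + 1); [rewrite ltrDl | exact: ltry].
by rewrite lte_fin in h; exists ((a + c) / 2); rewrite ?lte_fin; lra.
Qed.

Section Continuity.
Context {R : realType} {X1 X2 : metricType R}.
Local Notation E := ((X1 -> X1) * (X2 -> X2))%type.
Variables (G : set E) (o : X1 * X2).
Hypothesis pG : acts_properly G.

(** The sector of width [e / 2] around [t] lies in the sector of width [e] around
    [t0]. *)
Lemma growth_rate_usc t0 b : (growth_rate G o t0 < b%:E)%E ->
  \forall t \near t0, (growth_rate G o t < b%:E)%E.
Proof.
move=> h.
have [e e0 he] : exists2 e, 0 < e & (growth_eps G o e t0 < b%:E)%E.
  apply: contrapT => H; move: h; rewrite ltNge => /negP; apply.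
  apply: growth_rate_ge => e e0; rewrite leNgt; apply/negP => he.
  by apply: H; exists e.
apply/nbhs_ballP; exists (e / 2) => /=; first by rewrite divr_gt0.
move=> t; rewrite -ball_normE /= => tt; apply: le_lt_trans he.
apply: le_trans (growth_rate_le o pG t (_ : 0 < e / 2)) _; first by rewrite divr_gt0.
by apply: growth_eps_le => //; rewrite distrC; lra.
Qed.

(** The unit vector of slope [t] is a combination of the one of slope [t0] and of
    the one of slope [pi / 2] or [0], depending on the order of [t] and [t0].  The
    first coefficient tends to [1] as [t] tends to [t0], and the nonnegative
    contribution of the second vector can be dropped. *)
Lemma growth_rate_lsc (t0 a : R) :
  (forall t p s1 s2 a : R, 0 <= t <= pi / 2 -> 0 < s1 -> 0 <= s2 ->
    cos t = s1 * cos t0 + s2 * cos p -> sin t = s1 * sin t0 + s2 * sin p ->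
    (0 <= growth_rate G o p)%E -> 0 < a -> (a%:E < growth_rate G o t0)%E ->
    ((s1 * a)%:E <= growth_rate G o t)%E) ->
  (forall t, 0 <= t <= pi / 2 -> (0 <= growth_rate G o t)%E) ->
  0 <= t0 <= pi / 2 -> (a%:E < growth_rate G o t0)%E ->
  \forall t \near t0, 0 <= t <= pi / 2 -> (a%:E < growth_rate G o t)%E.
Proof.
move=> lower reg /andP[t00 t01] ha.
have pi2 : 0 <= pi / 2 :> R by rewrite divr_ge0 // pi_ge0.
have [a0|a0] := ltP a 0.
  by near=> t => ht; apply: lt_le_trans (reg t ht); rewrite lte_fin.
have [a' aa' ha'] := ereal_between ha.
have a'0 : 0 < a' by lra.
have ncos : \forall t \near t0, t0 < pi / 2 -> a * cos t0 < a' * cos t.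
  have [t0p|t0p] := ltP t0 (pi / 2); last by near=> t; lra.
  have c0 : 0 < cos t0 by apply: cos_gt0_pihalf; rewrite t0p andbT; lra.
  have d0 : 0 < (a' - a) * cos t0 / a' by rewrite divr_gt0 // mulr_gt0 //; lra.
  apply/nbhs_ballP; exists ((a' - a) * cos t0 / a') => //= t; rewrite -ball_normE /= => tt _.
  have := le_lt_trans (cos_lipschitz t0 t) tt; rewrite ltr_pdivlMr //.
  have := ler_norm (cos t0 - cos t); nra.
have nsin : \forall t \near t0, 0 < t0 -> a * sin t0 < a' * sin t.
  have [t0p|t0p] := ltP 0 t0; last by near=> t; lra.
  have c0 : 0 < sin t0 by apply: sin_gt0_pi; rewrite t0p /=; lra.
  have d0 : 0 < (a' - a) * sin t0 / a' by rewrite divr_gt0 // mulr_gt0 //; lra.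
  apply/nbhs_ballP; exists ((a' - a) * sin t0 / a') => //= t; rewrite -ball_normE /= => tt _.
  have := le_lt_trans (sin_lipschitz t0 t) tt; rewrite ltr_pdivlMr //.
  have := ler_norm (sin t0 - sin t); nra.
apply: filterS2 ncos nsin => t hc hs ht; have /andP[tge tle] := ht.
have [tt|tt|-> //] := ltgtP t t0.
- have t0p : 0 < t0 by lra.
  have s0 : 0 < sin t0 by apply: sin_gt0_pi; rewrite t0p /=; lra.
  have {}hs := hs t0p.
  pose s1 := sin t / sin t0.
  have s1E : s1 * sin t0 = sin t by rewrite divfK //; apply/eqP; lra.
  have s1a : a < s1 * a'.
    by rewrite mulrC mulrA ltr_pdivlMr.
  have s10 : 0 < s1 by rewrite -(pmulr_lgt0 _ a'0); lra.
  apply: (@lt_le_trans _ _ (s1 * a')%:E); first by rewrite lte_fin.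
  apply: (lower t 0 s1 (sin (t0 - t) / sin t0) a' ht s10 _ _ _ _ a'0 ha').
  + by rewrite divr_ge0 ?(ltW s0) // sin_ge0_pi //; apply/andP; lra.
  + by rewrite cos0 mulr1 sinB /s1; field; apply/eqP; lra.
  + by rewrite sin0 mulr0 addr0 s1E.
  + by apply: reg; rewrite lexx.
have t0p : t0 < pi / 2 by lra.
have c0 : 0 < cos t0 by apply: cos_gt0_pihalf; rewrite t0p andbT; lra.
have {}hc := hc t0p.
pose s1 := cos t / cos t0.
have s1E : s1 * cos t0 = cos t by rewrite divfK //; apply/eqP; lra.
have s1a : a < s1 * a'.
  by rewrite mulrC mulrA ltr_pdivlMr.
have s10 : 0 < s1 by rewrite -(pmulr_lgt0 _ a'0); lra.
apply: (@lt_le_trans _ _ (s1 * a')%:E); first by rewrite lte_fin.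
apply: (lower t (pi / 2) s1 (sin (t - t0) / cos t0) a' ht s10 _ _ _ _ a'0 ha').
+ by rewrite divr_ge0 ?(ltW c0) // sin_ge0_pi //; apply/andP; lra.
+ by rewrite cos_pihalf mulr0 addr0 s1E.
+ by rewrite sin_pihalf mulr1 sinB /s1; field; apply/eqP; lra.
by apply: reg; rewrite lexx andbT.
Unshelve. all: by end_near. Qed.

End Continuity.

Unset Implicit Arguments.

Theorem theorem1p1 (R : realType) (X1 X2 : metricType R)
    (hX1 : hadamard X1) (pX1 : proper_space X1)
    (hX2 : hadamard X2) (pX2 : proper_space X2)
    (o : X1 * X2) (G : set ((X1 -> X1) * (X2 -> X2)))
    (hG : isometry_group G) (pG : acts_properly G)
    (indep : exists g h, [/\ G g, G h, independent_rank_one g.1 h.1 &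
                             independent_rank_one g.2 h.2])
    (regular : forall theta : R, 0 <= theta <= pi / 2 ->
                 (0 <= growth_rate G o theta)%E) :
  {within `[0, pi / 2], continuous (growth_rate G o)}.
Proof.
have [m1 hm1] := CAT0_stewart hX1.2; have [m2 hm2] := CAT0_stewart hX2.2.
have [Phi [C [N [PhiP PhiN]]]] := product_map hG hm1 hm2 pX1 pX2 o pG indep.
apply/subspace_continuousP => t0 t0I.
have ht0 : 0 <= t0 <= pi / 2 by move: t0I; rewrite /= in_itv.
apply: ereal_cvg_semicontinuous => [a ha|b hb].
  have lower t p s1 s2 a' := @growth_lower R X1 X2 G o pG Phi C N hG PhiP PhiN
    t0 p t s1 s2 a'.
  have := growth_rate_lsc lower regular ht0 ha.
  by apply: filterS => t h; rewrite /= in_itv /= => /h.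
by apply: cvg_within; exact: growth_rate_usc.
Qed.
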